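(* Let $\{\varepsilon_k, k\in\mathbb{Z}\}$ be an i.i.d. sequence of real random variables and let $c,g:\mathbb{R}\to\mathbb{R}$ be measurable with $c(\varepsilon_0)\ge 0$ and $g(\varepsilon_0)\ge 0$ almost surely. Assume that for every $k\in\mathbb{Z}$ the series $$X_k=\sum_{i=1}^{\infty} g(\varepsilon_{k-i})\prod_{1\le j<i}c(\varepsilon_{k-j})$$ converges almost surely. Let $\delta>0$, $\Lambda(x)=x^{\delta}$, let $\sigma_k\ge 0$ be defined by $\Lambda(\sigma_k^2)=X_k$, and let $y_k=\sigma_k\varepsilon_k$. Let $\nu>0$ and let $f$ be one of the functions $f(x)=|x|^{\nu}$ or $f(x)=\operatorname{sign}(x)\cdot|x|^{\nu}$, and assume $\mathbb{E}|f(y_0)|^3<\infty$. Put $$S_n=f(y_1)+\cdots+f(y_n)-n\mathbb{E}f(y_1),\qquad B_n^2=\operatorname{Var}S_n,\qquad \beta_n^2=B_n^2/n$$ with $B_n,\beta_n\ge 0$. Then $\beta:=\lim_{n\to\infty}\beta_n$ exists, and if $\beta>0$, there is some $C>0$ (which may depend on $f$, $\Lambda$, $c$, $g$ and the law of $\varepsilon_0$) such that $$|P\{S_n<xB_n\}-\Phi(x)|\le C\,\frac{(\log n)^2}{\sqrt n}\qquad\text{for all } n\ge 2 \text{ and } x\in\mathbb{R}.$$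
   Context: The empty product (for $i=1$) equals $1$. $\Phi$ is the standard normal distribution function. Equivalently $\beta_n^2=\operatorname{Var}f(y_0)+2\sum_{j=1}^{n-1}(1-j/n)\operatorname{Cov}(f(y_1),f(y_{j+1}))$. The process $(y_k)$ is the polynomial augmented GARCH(1,1) process. *)

(* Defs.v *)
From mathcomp Require Import all_boot all_order all_algebra.
From mathcomp Require Import all_classical all_reals all_analysis.

Set Implicit Arguments.
Unset Strict Implicit.
Unset Printing Implicit Defensive.

Import Order.TTheory GRing.Theory Num.Theory.
Import numFieldNormedType.Exports.

Local Open Scope classical_set_scope.
Local Open Scope ring_scope.

Section Iid.
Context (d : measure_display) (T : measurableType d) (R : realType)
  (P : probability T R).

Definition mutually_independent (I : eqType) (X : I -> {RV P >-> R}) : Prop :=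
  forall (J : seq I) (B : I -> set R), uniq J ->
    (forall i, measurable (B i)) ->
    P [set w | forall i, i \in J -> B i (X i w)] =
    (\prod_(i <- J) P (X i @^-1` B i))%E.

Definition identically_distributed (I : Type) (X : I -> {RV P >-> R}) : Prop :=
  forall (i j : I) (B : set R), measurable B ->
    distribution P (X i) B = distribution P (X j) B.

Definition iid (I : eqType) (X : I -> {RV P >-> R}) : Prop :=
  mutually_independent X /\ identically_distributed X.

End Iid.

Section AugmentedGarch.
Context (T : Type) (R : realType).

Definition garch_partial (c g : R -> R) (eps : int -> T -> R) (k : int) (w : T)
    (n : nat) : R :=
  \sum_(1 <= i < n)
    g (eps (k - i%:Z) w) * \prod_(1 <= j < i) c (eps (k - j%:Z) w).

(* Only meaningful at points [w] where the partial sums converge. *)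
Definition garch_X (c g : R -> R) (eps : int -> T -> R) (k : int) (w : T) : R :=
  limn (garch_partial c g eps k w).

Definition garch_y (sigma eps : int -> T -> R) (k : int) (w : T) : R :=
  sigma k w * eps k w.

End AugmentedGarch.

Section Sums.
Context (d : measure_display) (T : measurableType d) (R : realType)
  (P : probability T R).

(* [Z k] stands for [f(y_k)].  In [S_], [B_] and [beta_], [fine] reads an
   extended real as a real; it loses nothing when the [Z k] have finite second
   moments. *)
Definition S_ (Z : int -> T -> R) (n : nat) (w : T) : R :=
  \sum_(1 <= k < n.+1) Z k%:Z w - n%:R * fine 'E_P[Z 1%R].

Definition B_ (Z : int -> T -> R) (n : nat) : R :=
  Num.sqrt (fine 'V_P[S_ Z n]).

Definition beta_ (Z : int -> T -> R) (n : nat) : R :=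
  Num.sqrt (B_ Z n ^+ 2 / n%:R).

End Sums.

Definition Phi (R : realType) (x : R) : R :=
  fine (normal_prob (0 : R) 1 `]-oo, x]).

(* Main.v *)
Require Import Defs.
From HB Require Import structures.
From mathcomp Require Import all_boot all_order all_algebra.
From mathcomp Require Import all_classical all_reals all_analysis.
From mathcomp Require Import measurable_realfun ring lra zify.

(** The function [f] is homogeneous of order [nu] under nonnegative factors, so
    [f (y_k)] is the power [p = nu / (2 delta)] of the series [X_k] times
    [f (eps_k)].  Listing the innovations backwards from a given time, every
    observation is one fixed functional [garch_obs] of a sequence of independent
    variables, the observation at an earlier time being the same functional of
    the shifted sequence ([past_has_law], [prob_E], [B_E]).  The statement is
    thus one about sums of shifts of a functional.

    Approximation by finite windows.  The series satisfies [X = g + c X'], where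
    [X'] is a copy of [X] independent of [c] and [g].  A finite moment of order
    [3 p] therefore forces the moment of [c] of that order to be less than 1
    ([contraction_lt1]), unless the observations vanish almost surely.  Hence
    the remainder of the series after [m] terms, a product of [m] independent
    factors [c] and a copy of [X], is geometrically small, and so is the third
    moment of the error made on the observation ([garch_approx]).

    The variance.  An observation truncated to [k] terms is independent of the
    observation [k + 1] steps earlier.  The covariances therefore decay
    geometrically, the increments of the variance of the sums converge, and
    Cesaro means give the limit [beta] ([cvg_sum_var]).

    The rate.  If [beta > 0], the series is truncated to a window [m] of order
    [ln n], which changes the sums by a negligible amount, and it remains to prove
    a Berry-Esseen bound of order [m ^+ 2 / sqrt n] for [m]-dependent summands
    with bounded third moments whose block variances grow linearly
    ([berry_esseen], [functional_berry_esseen]).  This is Stein's method.  The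
    derivative of a bounded solution of Stein's equation is expanded around each
    summand ([expand_one]).  The remainder is local, of third order, except for
    the probability that the sum lies in a short interval near a point given by
    the summands of a window.  This probability is bounded by freezing all the
    coordinates outside a block far from the window: only the concentration of
    the sum over this block, uniformly over what is frozen ([conc]), is needed
    ([Ex_osc]).  The same expansion, with a smoothed indicator instead of the
    solution of Stein's equation, bounds the concentration of a block by that of
    a shorter one ([conc_step]).  At a width of order [m ^+ 2] this recursion
    contracts, and an induction on the length of the block shows that an interval
    of that width has probability of order [m ^+ 2 / sqrt n] ([concentration]).
    Ramps of the same width then lead from smooth test functions to indicators
    ([stein_prob]).

    Independence is used in a single form: replacing some coordinates of the
    sequence by an independent copy does not change its law ([splice_law]). *)

Set Implicit Arguments.
Unset Strict Implicit.
Unset Printing Implicit Defensive.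

Import Order.TTheory GRing.Theory Num.Theory.
Import numFieldNormedType.Exports.

Local Open Scope classical_set_scope.
Local Open Scope ring_scope.

(** * Expectation of real random variables *)

Section RealExpectation.
Context d (T : measurableType d) (R : realType) (P : probability T R).
Implicit Types f g : T -> R.

Definition Int f := P.-integrable setT (EFin \o f).
Definition Ex f : R := \int[P]_x f x.

Lemma Int_measurable f : Int f -> measurable_fun setT f.
Proof. by move=> /measurable_int/measurable_EFinP. Qed.

Lemma Int_cst c : Int (fun=> c).
Proof. exact: finite_measure_integrable_cst. Qed.

Lemma IntD f g : Int f -> Int g -> Int (fun x => f x + g x).
Proof. by move=> If Ig; apply: (integrableD measurableT If Ig). Qed.

Lemma IntN f : Int f -> Int (fun x => - f x).
Proof. by move=> If; apply: (integrableN If). Qed.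

Lemma IntB f g : Int f -> Int g -> Int (fun x => f x - g x).
Proof. by move=> If Ig; apply: IntD => //; exact: IntN. Qed.

Lemma IntZ c f : Int f -> Int (fun x => c * f x).
Proof. by move=> If; apply: (integrableZl measurableT c If). Qed.

Lemma Int_abs f : Int f -> Int (fun x => `|f x|).
Proof. by move=> If; apply: (integrable_norm If). Qed.

Lemma Int_sum (I : Type) (s : seq I) (p : pred I) (F : I -> T -> R) :
  (forall i, p i -> Int (F i)) -> Int (fun x => \sum_(i <- s | p i) F i x).
Proof.
move=> IF; rewrite /Int.
have -> : EFin \o (fun x => \sum_(i <- s | p i) F i x) =
          (fun x => (\sum_(i <- s | p i) (F i x)%:E)%E).
  by apply/funext => x /=; rewrite sumEFin.
by apply: integrable_sum => // i pi; exact: IF.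
Qed.

Lemma Int_dom f g : measurable_fun setT f -> Int g ->
  (forall x, `|f x| <= g x) -> Int f.
Proof.
move=> mf Ig fg; apply: le_integrable Ig => //.
  exact/measurable_EFinP.
move=> x _ /=; rewrite lee_fin.
by rewrite (le_trans (fg x))// ler_norm.
Qed.

Lemma Int_bounded f (c : R) : measurable_fun setT f ->
  (forall x, `|f x| <= c) -> Int f.
Proof. by move=> mf fc; apply: Int_dom (Int_cst c) _. Qed.

Lemma Ex_cst c : Ex (fun=> c) = c.
Proof.
rewrite /Ex Rintegral_cst//.
transitivity (c * fine (1%E : \bar R)); last by rewrite mulr1.
by congr (_ * fine _); exact: probability_setT.
Qed.

Lemma ExD f g : Int f -> Int g -> Ex (fun x => f x + g x) = Ex f + Ex g.
Proof. by move=> If Ig; rewrite /Ex RintegralD. Qed.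

Lemma ExB f g : Int f -> Int g -> Ex (fun x => f x - g x) = Ex f - Ex g.
Proof. by move=> If Ig; rewrite /Ex RintegralB. Qed.

Lemma ExZ c f : Int f -> Ex (fun x => c * f x) = c * Ex f.
Proof. by move=> If; rewrite /Ex RintegralZl. Qed.

Lemma ExN f : Int f -> Ex (fun x => - f x) = - Ex f.
Proof.
move=> If; rewrite -mulN1r -ExZ//.
by congr Ex; apply/funext => x; rewrite mulN1r.
Qed.

Lemma Ex_sum (I : eqType) (s : seq I) (F : I -> T -> R) :
  (forall i, i \in s -> Int (F i)) ->
  Ex (fun x => \sum_(i <- s) F i x) = \sum_(i <- s) Ex (F i).
Proof.
elim: s => [|i s IH] IF.
  by rewrite big_nil; under eq_fun do rewrite big_nil; rewrite Ex_cst.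
rewrite big_cons -IH; last by move=> j js; apply: IF; rewrite inE js orbT.
rewrite -ExD; first by congr Ex; apply/funext => x; rewrite big_cons.
  by apply: IF; rewrite inE eqxx.
rewrite (_ : (fun x => _) = (fun x => \sum_(j <- s | j \in s) F j x)).
  by apply: Int_sum => j js; apply: IF; rewrite inE js orbT.
by apply/funext => x; rewrite [LHS]big_seq.
Qed.

Lemma Ex_le f g : Int f -> Int g -> (forall x, f x <= g x) -> Ex f <= Ex g.
Proof. by move=> If Ig fg; rewrite /Ex le_Rintegral. Qed.

Lemma Ex_ge0 f : (forall x, 0 <= f x) -> 0 <= Ex f.
Proof. by move=> f0; apply: Rintegral_ge0. Qed.

Lemma Ex_abs f : Int f -> `|Ex f| <= Ex (fun x => `|f x|).
Proof. by move=> If; rewrite /Ex le_normr_Rintegral. Qed.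

Lemma Int_indic A : measurable A -> Int (\1_A).
Proof. by move=> mA; exact: integrable_indic. Qed.

Lemma Ex_indic A : measurable A -> Ex (\1_A) = fine (P A).
Proof. by move=> mA; rewrite /Ex /Rintegral integral_indic// setIT. Qed.

Lemma EFin_Ex f : Int f -> (Ex f)%:E = (\int[P]_x (f x)%:E)%E.
Proof. by move=> If; rewrite /Ex /Rintegral fineK//; exact: integrable_fin_num. Qed.

Lemma measurable_sum_cond (I : Type) (s : seq I) (p : pred I) (F : I -> T -> R) :
  (forall i, measurable_fun setT (F i)) ->
  measurable_fun setT (fun x => \sum_(i <- s | p i) F i x).
Proof.
move=> mF; have -> : (fun x => \sum_(i <- s | p i) F i x) =
    (fun x => \sum_(i <- [seq i <- s | p i]) F i x).
  by apply/funext => x; rewrite big_filter.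
exact: measurable_sum.
Qed.

End RealExpectation.

(** * Image laws *)

Section ImageLaw.
Context d1 d2 (T1 : measurableType d1) (T2 : measurableType d2) (R : realType).
Variables (P1 : probability T1 R) (P2 : probability T2 R) (X : T1 -> T2).

Definition has_law := measurable_fun setT X /\
  forall A, measurable A -> P2 A = P1 (X @^-1` A).

Hypothesis XP : has_law.

Lemma has_law_ge0_integral (f : T2 -> \bar R) : measurable_fun setT f ->
  (forall y, (0 <= f y)%E) ->
  (\int[P2]_y f y = \int[P1]_x f (X x))%E.
Proof.
move=> mf f0; have [mX PX] := XP.
rewrite -[RHS](@ge0_integral_pushforward _ _ _ _ _ _ mX P1 setT f)//.
by apply: eq_measure_integral => A mA _; exact: PX.
Qed.

Lemma has_law_Int (f : T2 -> R) : measurable_fun setT f ->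
  Int P2 f <-> Int P1 (f \o X).
Proof.
move=> mf; have [mX PX] := XP.
have e : (\int[P2]_x `|(f x)%:E| = \int[P1]_x `|(f (X x))%:E|)%E.
  rewrite (has_law_ge0_integral (f := fun y => `|(f y)%:E|%E))//.
  by apply: measurableT_comp => //; exact/measurable_EFinP.
split=> /integrableP[m1 i1]; apply/integrableP; split => //=.
- by apply/measurable_EFinP; exact: measurableT_comp.
- by rewrite -e.
- exact/measurable_EFinP.
- by rewrite e.
Qed.

Lemma has_law_Ex (f : T2 -> R) : measurable_fun setT f -> Int P1 (f \o X) ->
  Ex P2 f = Ex P1 (f \o X).
Proof.
move=> mf If; have [mX PX] := XP.
have mEf : measurable_fun setT (EFin \o f) by exact/measurable_EFinP.
rewrite /Ex /Rintegral; congr fine.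
rewrite -[RHS](@integral_pushforward _ _ _ _ _ _ mX P1 setT (EFin \o f))//.
by apply: eq_measure_integral => A mA _; exact: PX.
Qed.

End ImageLaw.

(** * The space of real sequences *)

Section SequenceSpace.
Context (R : realType).

Definition coordinate_sets : set (set (nat -> R)) :=
  [set A | exists i B, measurable B /\ A = [set u | B (u i)]].

(** The sequences are one-sided: an observation at time [k] only involves the
    innovations up to time [k], and these are listed backwards in time. *)
Definition seqsp := g_sigma_algebraType coordinate_sets.
HB.instance Definition _ := Measurable.on seqsp.

Definition cyl (n : nat) (B : nat -> set R) : set seqsp :=
  [set u | forall i, (i < n)%N -> B i (u i)].

Definition cylinders : set (set seqsp) :=
  [set A | exists n B, (forall i, measurable (B i)) /\ A = cyl n B].

Lemma measurable_coord i : measurable_fun setT (fun u : seqsp => u i).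
Proof.
move=> _ B mB; rewrite setTI; apply: sub_sigma_algebra.
by exists i, B.
Qed.

Lemma measurable_cyl n B : (forall i, measurable (B i)) ->
  measurable (cyl n B).
Proof.
move=> mB; rewrite (_ : cyl n B =
    \bigcap_(i in [set i | (i < n)%N]) ((fun u : seqsp => u i) @^-1` B i)).
  apply: bigcap_measurableType => i _.
  by rewrite -[X in measurable X]setTI; exact: measurable_coord.
by apply/seteqP; split.
Qed.

Lemma cylindersI : setI_closed cylinders.
Proof.
move=> _ _ [n [B [mB ->]]] [m [C [mC ->]]].
exists (maxn n m), (fun i => (if (i < n)%N then B i else setT) `&`
                             (if (i < m)%N then C i else setT)).
split=> [i|]; first by apply: measurableI; case: ifP.
apply/seteqP; split => u /=.
  by move=> [uB uC] i _; split; case: ifP => // ?; [exact: uB|exact: uC].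
move=> uBC; split => i ilt.
  have := uBC i; rewrite ilt leq_max ilt => /(_ isT)[+ _]; exact.
by have := uBC i; rewrite ilt leq_max ilt orbT => /(_ isT)[_].
Qed.

Lemma measurable_seqspE : @measurable _ seqsp = <<s cylinders >>.
Proof.
apply/seteqP; split; apply: smallest_sub; try exact: smallest_sigma_algebra.
- move=> _ [i [B [mB ->]]]; apply: sub_sigma_algebra.
  exists i.+1, (fun j => if j == i then B else setT); split.
    by move=> j; case: ifP.
  apply/seteqP; split => u /=.
    by move=> Bu j _; case: eqP => // ->.
  by move=> /(_ i (ltnSn i)); rewrite eqxx.
- by move=> _ [n [B [mB ->]]]; exact: measurable_cyl.
Qed.

Lemma measurable_to_seq d (T : measurableType d) (f : T -> seqsp) :
  (forall i, measurable_fun setT (fun x => f x i)) -> measurable_fun setT f.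
Proof.
move=> mf; apply: (@measurability _ _ _ seqsp _ _ coordinate_sets) => //.
move=> _ [_ [i [B [mB ->]] <-]].
exact: (mf i measurableT B mB).
Qed.

Definition iid_law (mu : probability seqsp R) (nu : set R -> \bar R) :=
  forall n B, (forall i, measurable (B i)) ->
    mu (cyl n B) = (\prod_(i < n) nu (B i))%E.

Lemma iid_law_unique (m1 m2 : {measure set seqsp -> \bar R}) :
  (m1 setT < +oo)%E ->
  (forall n B, (forall i, measurable (B i)) -> m1 (cyl n B) = m2 (cyl n B)) ->
  forall A, measurable A -> m1 A = m2 A.
Proof.
move=> fin m12 A mA.
apply: (measure_unique cylinders (fun=> setT)) => //.
- exact: measurable_seqspE.
- exact: cylindersI.
- by move=> _; exists 0%N, (fun=> setT); split => //; apply/seteqP; split.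
- by rewrite bigcup_const//; exists 0%N.
- by move=> _ [n [B [mB ->]]]; exact: m12.
Qed.

Definition splice (J : pred nat) (v u : seqsp) : seqsp :=
  fun i => if J i then u i else v i.

Lemma measurable_splice J :
  measurable_fun setT (fun p : seqsp * seqsp => splice J p.1 p.2).
Proof.
apply: measurable_to_seq => i; rewrite /splice; case: (J i).
  exact: (measurableT_comp (measurable_coord i) measurable_snd).
exact: (measurableT_comp (measurable_coord i) measurable_fst).
Qed.

Variables (mu : probability seqsp R) (nu : probability R R).
Hypothesis mu_iid : iid_law mu nu.

(** Replacing the coordinates in [J] by an independent copy does not change the
    law.  This is the form in which independence is used everywhere: averaging
    over the new coordinates with the old ones frozen is conditioning. *)
Lemma splice_law J :
  has_law (mu \x mu)%E mu (fun p : seqsp * seqsp => splice J p.1 p.2).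
Proof.
split; first exact: measurable_splice.
pose phi : {mfun (seqsp * seqsp)%type >-> seqsp} :=
  HB.pack (fun p : seqsp * seqsp => splice J p.1 p.2)
    (isMeasurableFun.Build _ _ _ _ _ (measurable_splice J)).
apply: (@iid_law_unique mu (pushforward (mu \x mu)%E phi)).
  by rewrite (le_lt_trans (probability_le1 _ _))// ltry.
move=> n B mB; rewrite /pushforward.
pose BJ (b : bool) i := if J i == b then B i else setT.
have mBJ b i : measurable (BJ b i) by rewrite /BJ; case: ifP.
have phiE : phi @^-1` cyl n B = cyl n (BJ false) `*` cyl n (BJ true).
  apply/seteqP; split => -[v u] /=; rewrite /cyl /splice /BJ /=.
    by move=> H; split => i /H; case: (J i).
  by move=> [H1 H2] i ilt; move: (H1 i ilt) (H2 i ilt); case: (J i).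
transitivity ((mu \x mu)%E (cyl n (BJ false) `*` cyl n (BJ true))); last first.
  exact: (esym (congr1 (mu \x mu)%E phiE)).
rewrite product_measure1E; [|exact: measurable_cyl..].
transitivity (\prod_(i < n) nu (BJ false i) * \prod_(i < n) nu (BJ true i))%E; last first.
  by congr (_ * _)%E; apply/esym/mu_iid.
apply: etrans (mu_iid n mB) _.
rewrite -big_split/=; apply: eq_bigr => i _; rewrite /BJ.
have nuT : nu setT = 1%E by exact: probability_setT.
by case: (J i) => /=; rewrite [X in (X * _)%E]nuT mul1e
  || rewrite [X in (_ * X)%E]nuT mule1.
Qed.

(** Measurability with respect to the coordinates in [I], as a pointwise
    condition; measurability itself is required separately where it matters. *)
Definition dep (I : pred nat) (S : Type) (f : seqsp -> S) :=
  forall v u : seqsp, (forall i, I i -> v i = u i) -> f v = f u.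

Lemma dep_spliceN J S (f : seqsp -> S) v u : dep (predC J) f ->
  f (splice J v u) = f v.
Proof. by apply=> i /= /negbTE; rewrite /splice => ->. Qed.

Lemma dep_splice J S (f : seqsp -> S) v u : dep J f ->
  f (splice J v u) = f u.
Proof. by apply=> i /= ; rewrite /splice => ->. Qed.

Lemma sub_dep (I J : pred nat) S (f : seqsp -> S) : (forall i, I i -> J i) ->
  dep I f -> dep J f.
Proof. by move=> IJ fI v u vu; apply: fI => i /IJ; exact: vu. Qed.

Lemma measurable_splice_r J v : measurable_fun setT (splice J v).
Proof.
apply: measurable_to_seq => i; rewrite /splice; case: (J i) => //.
exact: measurable_coord.
Qed.

Lemma splice_ge0_integral J (F : seqsp -> R) : measurable_fun setT F ->
  (forall u, 0 <= F u) ->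
  (\int[mu]_u (F u)%:E = \int[mu]_v \int[mu]_u (F (splice J v u))%:E)%E.
Proof.
move=> mF F0; rewrite (has_law_ge0_integral (splice_law J)).
- rewrite fubini_tonelli1//; last by move=> p; rewrite lee_fin.
  apply/measurable_EFinP; apply: measurableT_comp => //.
  exact: measurable_splice.
- exact/measurable_EFinP.
- by move=> u; rewrite lee_fin.
Qed.

(** Freezing the coordinates outside [J]: if for each frozen past the average
    over the coordinates in [J] is controlled, so is the expectation. *)
Lemma Ex_freeze J (F K : seqsp -> R) : measurable_fun setT F ->
  (forall u, 0 <= F u) -> Int mu K ->
  (forall v, (\int[mu]_u (F (splice J v u))%:E <= (K v)%:E)%E) ->
  Int mu F /\ Ex mu F <= Ex mu K.
Proof.
move=> mF F0 IK FK.
have mS : measurable_fun setT (fun p : seqsp * seqsp => F (splice J p.1 p.2)).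
  by apply: measurableT_comp => //; exact: measurable_splice.
have le : (\int[mu]_u (F u)%:E <= \int[mu]_v (K v)%:E)%E.
  rewrite (splice_ge0_integral J)//; apply: ge0_le_integral => //.
  - by move=> v _; apply: integral_ge0 => u _; rewrite lee_fin.
  - apply: (measurable_fun_fubini_tonelli_F
      (fun p : seqsp * seqsp => (F (splice J p.1 p.2))%:E)).
      exact/measurable_EFinP.
    by move=> p; rewrite lee_fin.
  - exact: measurable_int IK.
have IF : Int mu F.
  apply/integrableP; split; first exact/measurable_EFinP.
  rewrite (eq_integral (fun u => (F u)%:E)); last first.
    by move=> u _ /=; rewrite ger0_norm.
  by apply: (le_lt_trans le); exact: integrable_lty.
by split => //; rewrite -lee_fin !EFin_Ex.
Qed.

Lemma dep_mul (I J : pred nat) (f g : seqsp -> R) :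
  (forall i, I i -> J i -> false) -> dep I f -> dep J g ->
  Int mu f -> Int mu g ->
  Int mu (fun u => f u * g u) /\ Ex mu (fun u => f u * g u) = Ex mu f * Ex mu g.
Proof.
move=> IJ fI gJ If Ig.
have fJ : dep (predC J) f.
  by apply: sub_dep fI => i /= iI; apply/negP => /(IJ _ iI).
have mf := Int_measurable If; have mg := Int_measurable Ig.
have mfg : measurable_fun setT (fun u => f u * g u) by exact: measurable_funM.
have mfg' : measurable_fun setT (fun p : seqsp * seqsp => (f p.1 * g p.2)%:E).
  apply/measurable_EFinP; apply: measurable_funM;
    exact: measurableT_comp.
have E : (fun u => f u * g u) \o (fun p : seqsp * seqsp => splice J p.1 p.2) =
         (fun p => f p.1 * g p.2).
  by apply/funext => -[v u] /=; rewrite dep_spliceN// (dep_splice _ _ gJ).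
have IT : (mu \x mu)%E.-integrable setT
    (EFin \o (fun p : seqsp * seqsp => f p.1 * g p.2)).
  apply/integrable12ltyP => //=.
  rewrite (eq_integral (fun v => `|(f v)%:E| * \int[mu]_u `|(g u)%:E|)%E).
    rewrite ge0_integralZr//.
    - move/integrableP: If => [_ If]; move/integrableP: Ig => [_ Ig].
      by rewrite lte_mul_pinfty// ?integral_ge0// ge0_fin_numE// integral_ge0.
    - by apply: measurableT_comp => //; exact/measurable_EFinP.
    - exact: integral_ge0.
  move=> v _; under eq_integral do rewrite normrM EFinM.
  rewrite ge0_integralZl//.
  by apply/measurable_EFinP; exact: measurableT_comp.
have Imul : Int mu (fun u => f u * g u).
  by apply/(has_law_Int (splice_law J) mfg); rewrite E.
split=> //.
rewrite (has_law_Ex (splice_law J))// E; last exact: IT.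
rewrite /Ex {1}/Rintegral -(integral12_prod_meas1 (f:=EFin \o _))//=.
rewrite /fubini_F.
rewrite (eq_integral (fun v => (f v)%:E * (Ex mu g)%:E)%E); last first.
  move=> v _; rewrite EFin_Ex// -integralZl//.
by rewrite integralZr// -EFin_Ex.
Qed.

End SequenceSpace.

(** * Elementary inequalities *)

Section Elementary.
Context (R : realType).
Implicit Types x y z : R.

(** The reference slope [k] is arbitrary, so that it can be the derivative at a
    point that does not involve the increment [y - x]. *)
Lemma mean_value (f f1 : R -> R) x y (k D : R) :
  (forall t : R, is_derive t (1 : R) f (f1 t)) ->
  (forall t, Num.min x y <= t <= Num.max x y -> `|f1 t - k| <= D) ->
  `|f y - f x - (y - x) * k| <= `|y - x| * D.
Proof.
move=> df; wlog xy : x y / x <= y => [H fD|fD].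
  have [|/ltW yx] := leP x y; first by move=> xy; exact: H.
  rewrite -normrN [X in X <= _](_ : _ = `|f x - f y - (x - y) * k|); last first.
    by congr `|_|; ring.
  by rewrite [X in _ <= X * _]distrC; apply: H => // t; rewrite minC maxC; exact: fD.
have cf : {within `[x, y], continuous f}.
  apply: continuous_subspaceT => t.
  by apply/differentiable_continuous/derivable1_diffP; case: (df t).
have [c cxy ->] := MVT_segment xy (fun t _ => df t) cf.
rewrite -[X in `|X|]/(f1 c * (y - x) - (y - x) * k).
have -> : f1 c * (y - x) - (y - x) * k = (y - x) * (f1 c - k) by ring.
rewrite normrM ler_wpM2l// fD//.
by move: cxy; rewrite in_itv/= (min_idPl xy) (max_idPr xy).
Qed.

Lemma amgm3 x y z : `|x * y * z| <= (`|x| ^+ 3 + `|y| ^+ 3 + `|z| ^+ 3) / 3.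
Proof.
rewrite !normrM; move: (normr_ge0 x) (normr_ge0 y) (normr_ge0 z).
move: `|x| `|y| `|z| => a b c a0 b0 c0.
rewrite ler_pdivlMr// -subr_ge0 (_ : _ - _ =
  (a + b + c) * ((a - b) ^+ 2 + (b - c) ^+ 2 + (c - a) ^+ 2) / 2); last by field.
by rewrite divr_ge0// mulr_ge0// ?addr_ge0// ?sqr_ge0.
Qed.

Lemma sqr_le1_cube x : x ^+ 2 <= 1 + `|x| ^+ 3.
Proof.
rewrite -real_normK ?num_real//; move: (normr_ge0 x); move: `|x| => a a0.
have [a1|a1] := leP a 1.
  by rewrite (@le_trans _ _ 1) ?expr_le1// lerDl exprn_ge0.
by rewrite (@le_trans _ _ (a ^+ 3))// ?lerDr// ler_weXn2l// ltW.
Qed.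

Lemma norm_le1_cube x : `|x| <= 1 + `|x| ^+ 3.
Proof.
move: (normr_ge0 x); move: `|x| => a a0.
have [a1|a1] := leP a 1.
  by rewrite (le_trans a1)// lerDl exprn_ge0.
rewrite (@le_trans _ _ (a ^+ 3))// ?lerDr// -[X in X <= _]expr1.
by rewrite ler_weXn2l// ltW.
Qed.

Lemma mul_le1_cube x y : `|x * y| <= 1 + (`|x| ^+ 3 + `|y| ^+ 3) / 2.
Proof.
have := sqr_le1_cube x; have := sqr_le1_cube y.
rewrite normrM -(@real_normK _ x) ?num_real// -(@real_normK _ y) ?num_real//.
have := sqr_ge0 (`|x| - `|y|); move: `|x| `|y| => a b; rewrite sqrrB; lra.
Qed.

End Elementary.

Lemma window_count (R : realType) r m : (0 < m)%N ->
  (2 * r * m).+1%:R <= (2 * r).+1%:R * m%:R :> R.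
Proof. by move=> m0; rewrite -natrM ler_nat mulSn -add1n leq_add2r. Qed.

(** * Oscillation on a scale *)

(** A bound for the variation over a distance [s] of a function whose slope is
    at most [1 / e] and which is constant outside an interval of length [4 e].
    The truncation of [s / e] at 1 matters: multiplied by the probability of an
    interval of length [2 (2 e + s)] it still gives a term linear in [s]. *)
Definition osc (R : realType) (e s y : R) : R :=
  Num.min 1 (s / e) * (`|y| <= 2 * e + s)%R%:R.

Section Osc.
Context (R : realType).
Implicit Types e s y : R.

Lemma osc_ge0 e s y : 0 < e -> 0 <= s -> 0 <= osc e s y.
Proof.
move=> e0 s0; rewrite mulr_ge0//.
by rewrite le_min ler01 divr_ge0// ltW.
Qed.

Lemma osc_le1 e s y : osc e s y <= 1.
Proof.
by rewrite /osc; case: (`|y| <= _); rewrite ?mulr1 ?mulr0// ge_min lexx.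
Qed.

Lemma measurable_bool d (T : measurableType d) (b : T -> bool) :
  measurable_fun setT b -> measurable_fun setT (fun x => (b x)%:R : R).
Proof.
move=> mb; have -> : (fun x => (b x)%:R : R) = \1_[set x | b x].
  apply/funext => x; rewrite indicE; congr (_%:R); congr nat_of_bool.
  by apply/idP/idP => [?|]; rewrite inE.
apply: measurable_indic.
by rewrite -[X in measurable X]setTI; exact: (mb measurableT [set true]).
Qed.

Lemma measurable_osc d (T : measurableType d) e (s y : T -> R) :
  measurable_fun setT s -> measurable_fun setT y ->
  measurable_fun setT (fun x => osc e (s x) (y x)).
Proof.
move=> ms my; apply: measurable_funM.
  by apply: measurable_minr => //; exact: measurable_funM.
apply: measurable_bool; apply: measurable_fun_ler.
  exact: measurableT_comp.
exact: measurable_funD.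
Qed.

End Osc.

(** * Sums of an m-dependent family *)

Section MDependent.
Context (R : realType) (mu : probability (seqsp R) R) (nu : probability R R).
Hypothesis mu_iid : iid_law mu nu.
Variables (xi : nat -> seqsp R -> R) (m : nat).
Hypothesis xi_meas : forall j, measurable_fun setT (xi j).
Hypothesis xi_dep : forall j, dep (fun i => j <= i <= j + m)%N (xi j).

Local Notation E := (Ex mu).

Definition block_sum (a b : nat) (u : seqsp R) : R := \sum_(a <= j < b) xi j u.
Local Notation T := block_sum.

Lemma measurable_block_sum a b : measurable_fun setT (T a b).
Proof. exact: measurable_sum. Qed.

Lemma block_sum_dep a b : dep (fun i => a <= i < b + m)%N (T a b).
Proof.
move=> v u vu; rewrite /block_sum; apply: eq_big_nat => j /andP[aj jb].
by apply: xi_dep => i /andP[ji ijm]; apply: vu; lia.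
Qed.

Lemma block_sum_cat a b c u : (a <= b <= c)%N -> T a c u = T a b u + T b c u.
Proof. by move=> /andP[ab bc]; rewrite /block_sum -big_cat_nat. Qed.

(** The concentration of [T a b], uniformly over perturbations that may depend
    on all the coordinates outside the block and, at the two ends of the block,
    on the coordinates shared with the terms beyond it.  Conditioning on what
    happens outside a sub-block produces exactly such a perturbation, so this
    class is stable under conditioning. *)
Definition conc (a b : nat) (e q : R) :=
  forall psi : seqsp R -> R, measurable_fun setT psi ->
    dep (fun i => ~~ (a + m <= i < b)%N) psi ->
    forall x : R, fine (mu [set u | x <= psi u + T a b u <= x + e]) <= q.

Lemma conc_widen a b a' b' e q : (a' <= a <= b)%N -> (b <= b')%N ->
  conc a b e q -> conc a' b' e q.
Proof.
move=> /andP[a'a ab] bb' abq psi mpsi dpsi x.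
have e1 u : psi u + T a' b' u = (psi u + T a' a u + T b b' u) + T a b u.
  have -> : T a' b' u = T a' a u + T a b' u by apply: block_sum_cat; lia.
  have -> : T a b' u = T a b u + T b b' u by apply: block_sum_cat; lia.
  by rewrite [T a b u + _]addrC !addrA.
under eq_set do rewrite e1.
apply: abq.
  by apply: measurable_funD; [apply: measurable_funD|]; try exact: measurable_block_sum.
move=> v u vu; congr (_ + _ + _).
- by apply: dpsi => i Hi; apply: vu; apply: contra Hi; lia.
- by apply: block_sum_dep => i Hi; apply: vu; lia.
- by apply: block_sum_dep => i Hi; apply: vu; lia.
Qed.

Lemma measurable_itvE (W : seqsp R -> R) x y : measurable_fun setT W ->
  measurable [set u | x <= W u <= y].
Proof.
move=> mW.
have -> : [set u | x <= W u <= y] = setT `&` (W @^-1` `[x, y]).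
  by rewrite setTI; apply/seteqP; split => u /=; rewrite in_itv.
exact: mW.
Qed.

(** Covering an interval of length [l] by intervals of length [e]. *)
Lemma conc_cover a b (e q : R) (psi : seqsp R -> R) (x l : R) : 0 < e -> conc a b e q ->
  measurable_fun setT psi -> dep (fun i => ~~ (a + m <= i < b)%N) psi ->
  0 <= l ->
  fine (mu [set u | x <= psi u + T a b u <= x + l]) <= (l / e + 1) * q.
Proof.
move=> e0 abq mpsi dpsi l0.
pose W u := psi u + T a b u.
have mW : measurable_fun setT W by apply: measurable_funD => //; exact: measurable_block_sum.
have q0 : 0 <= q by apply: le_trans (abq psi mpsi dpsi 0); rewrite fine_ge0.
have H (k : nat) y : fine (mu [set u | y <= W u <= y + k.+1%:R * e]) <= k.+1%:R * q.
  elim: k y => [|k IH] y; first by rewrite !mul1r; exact: abq.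
  apply: (@le_trans _ _ (fine (mu [set u | y <= W u <= y + e]) +
     fine (mu [set u | y + e <= W u <= y + e + k.+1%:R * e]))).
    rewrite -fineD ?fin_num_measure//; try exact: measurable_itvE.
    rewrite fine_le ?fin_numD ?fin_num_measure//; try exact: measurable_itvE.
    apply: le_trans (measureU2 _ _ _); try exact: measurable_itvE.
    rewrite le_measure ?inE//; try exact: measurable_itvE.
      by apply: measurableU; exact: measurable_itvE.
    move=> u /= /andP[yW Wy]; have [We|We] := leP (W u) (y + e).
      by left; rewrite yW.
    right; rewrite (ltW We)/= (le_trans Wy)// -addrA lerD2l.
    by rewrite [k.+2%:R]mulrS mulrDl mul1r.
  rewrite [k.+2%:R]mulrS mulrDl mul1r lerD//; first exact: abq.
have le0 : 0 <= l / e by rewrite divr_ge0// ltW.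
have /andP[tr1 tr2] := truncn_itv le0.
apply: (@le_trans _ _ ((Num.truncn (l / e)).+1%:R * q)); last first.
  by rewrite ler_wpM2r// -natr1 lerD2r.
apply: le_trans (H (Num.truncn (l / e)) x).
rewrite fine_le ?fin_num_measure//; try exact: measurable_itvE.
rewrite le_measure ?inE//; try exact: measurable_itvE.
move=> u /= /andP[-> Wx] /=; rewrite (le_trans Wx)// lerD2l.
by rewrite -ler_pdivrMr// ltW.
Qed.

Section Freeze.
Variables (a b c d : nat) (psi : seqsp R -> R).
Hypotheses (ac : (a + m <= c)%N) (cd : (c + m <= d)%N) (db : (d <= b)%N).
Hypothesis mpsi : measurable_fun setT psi.
Hypothesis dpsi : dep (fun i => ~~ (a + m <= i < b)%N) psi.

Let W u := psi u + T a b u.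
Let J : pred nat := fun i => (c <= i < d)%N.
Let frozen (v u : seqsp R) : R := W (splice J v u) - T c (d - m) u.

Lemma measurable_W : measurable_fun setT W.
Proof. by apply: measurable_funD => //; exact: measurable_block_sum. Qed.

Lemma measurable_frozen v : measurable_fun setT (frozen v).
Proof.
apply: measurable_funB; last exact: measurable_block_sum.
by apply: measurableT_comp; [exact: measurable_W|exact: measurable_splice_r].
Qed.

Lemma frozen_dep v : dep (fun i => ~~ (c + m <= i < d - m)%N) (frozen v).
Proof.
move=> u u' uu'; rewrite /frozen /W.
have TE w : T a b w = T a c w + T c (d - m) w + T (d - m) b w.
  have <- : T a (d - m) w = T a c w + T c (d - m) w by apply: block_sum_cat; lia.
  by apply: block_sum_cat; lia.
have TJ w : T c (d - m) (splice J v w) = T c (d - m) w.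
  by apply: block_sum_dep => i; rewrite /splice /J => ?; case: ifP => //; lia.
rewrite !TE !TJ.
have -> : psi (splice J v u) = psi (splice J v u').
  by apply: dpsi => i; rewrite /splice /J => ?; case: ifP => //; lia.
have -> : T a c (splice J v u) = T a c (splice J v u').
  apply: block_sum_dep => i; rewrite /splice /J => ?; case: ifP => // ?.
  by apply: uu'; lia.
have -> : T (d - m) b (splice J v u) = T (d - m) b (splice J v u').
  apply: block_sum_dep => i; rewrite /splice /J => ?; case: ifP => // ?.
  by apply: uu'; lia.
set A := psi _; set B := T a c _; set C := T (d - m) b _.
by rewrite !(addrAC _ _ C) !addrA !addrK.
Qed.

(** The key estimate.  Given a sub-block whose concentration is [q], the
    expected oscillation of [W] around a quantity [A] which is determined
    outside the sub-block is linear in the local scale [s], so that only third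
    moments of the summands will be needed. *)
Lemma Ex_osc (e q : R) (G A s : seqsp R -> R) :
  0 < e -> conc c (d - m) e q ->
  measurable_fun setT G -> measurable_fun setT A -> measurable_fun setT s ->
  (forall u, 0 <= G u) -> (forall u, 0 <= s u) ->
  dep (predC J) G -> dep (predC J) A -> dep (predC J) s ->
  Int mu (fun u => G u * s u) ->
  E (fun u => G u * osc e (s u) (W u - A u)) <= 7 * q / e * E (fun u => G u * s u).
Proof.
move=> e0 cq mG mA ms G0 s0 dG dA ds IGs.
have mW := measurable_W.
rewrite -ExZ//.
apply: (proj2 (Ex_freeze mu_iid (J := J) _ _ _ _)).
- apply: measurable_funM => //; apply: measurable_osc => //.
  exact: measurable_funB.
- by move=> u; rewrite mulr_ge0// osc_ge0.
- exact: IntZ.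
move=> v.
pose l := 2 * (2 * e + s v); pose x := A v - (2 * e + s v).
pose S := [set u | x <= frozen v u + T c (d - m) u <= x + l].
have mS : measurable S.
  apply: measurable_itvE; apply: measurable_funD; last exact: measurable_block_sum.
  exact: measurable_frozen.
have l0 : 0 <= l by rewrite mulr_ge0// addr_ge0// mulr_ge0// ltW.
have := conc_cover x e0 cq (measurable_frozen v) (@frozen_dep v) l0.
rewrite -/S => muS.
have -> : (\int[mu]_u (G (splice J v u) *
      osc e (s (splice J v u)) (W (splice J v u) - A (splice J v u)))%:E =
    \int[mu]_u (G v * Num.min 1 (s v / e) * \1_S u)%:E)%E.
  apply: eq_integral => u _; rewrite !(dep_spliceN _ _ dG, dep_spliceN _ _ ds, dep_spliceN _ _ dA).
  rewrite /osc mulrA; congr (_ * _)%:E; rewrite indicE; congr (_%:R); congr nat_of_bool.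
  have -> : (u \in S) = (x <= W (splice J v u) <= x + l).
    apply/idP/idP; rewrite inE /S /= /frozen subrK//.
  rewrite ler_norml /x /l; lra.
under eq_integral do rewrite EFinM.
rewrite integralZl//; last exact: (Int_indic mu mS).
rewrite integral_indic// setIT -[X in (_ * X)%E]fineK; last exact: fin_num_measure.
rewrite -EFinM lee_fin.
set p := fine _ in muS *; set t := s v / e.
have t0 : 0 <= t by rewrite divr_ge0// ltW.
have p0 : 0 <= p by rewrite fine_ge0.
have le1 : l / e + 1 = 5 + 2 * t by rewrite /l /t; field; rewrite gt_eqF.
rewrite le1 in muS.
have -> : 7 * q / e * (G v * s v) = G v * (7 * q * t) by rewrite /t; ring.
rewrite -[X in X <= _]mulrA ler_wpM2l//.
have q0 : 0 <= q.
  have : 0 <= (5 + 2 * t) * q by exact: le_trans muS.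
  by rewrite pmulr_rge0// ltr_wpDr// mulr_ge0.
have [t1|t1] := leP 1 t.
  by rewrite mul1r (le_trans muS)// (mulrAC 7) ler_wpM2r//; lra.
rewrite (le_trans (ler_wpM2l t0 muS))// (_ : 7 * q * t = t * (7 * q)); last ring.
by rewrite ler_wpM2l// ler_wpM2r//; lra.
Qed.

End Freeze.

End MDependent.

(** * Local expansion around one summand *)

Section LocalExpansion.
Context (R : realType) (mu : probability (seqsp R) R) (nu : probability R R).
Hypothesis mu_iid : iid_law mu nu.
Variables (xi : nat -> seqsp R -> R) (m : nat).
Hypothesis xi_meas : forall j, measurable_fun setT (xi j).
Hypothesis xi_dep : forall j, dep (fun i => j <= i <= j + m)%N (xi j).
Hypothesis xi_int : forall j, Int mu (fun u => `|xi j u| ^+ 3).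
Hypothesis xi_mean : forall j, Ex mu (xi j) = 0.

Local Notation E := (Ex mu).

Lemma Int_xi j : Int mu (xi j).
Proof.
apply: (@Int_dom _ _ _ _ _ (fun u => 1 + `|xi j u| ^+ 3)) => //.
  by apply: IntD => //; exact: Int_cst.
by move=> u; exact: norm_le1_cube.
Qed.

Lemma Int_xi2 i j : Int mu (fun u => xi i u * xi j u).
Proof.
apply: (@Int_dom _ _ _ _ _ (fun u => 1 + 2^-1 * (`|xi i u| ^+ 3 + `|xi j u| ^+ 3))).
- exact: measurable_funM.
- by apply: IntD; [exact: Int_cst|apply: IntZ; exact: IntD].
- by move=> u; rewrite [2^-1 * _]mulrC; exact: mul_le1_cube.
Qed.

Lemma Int_xi3 i j k : Int mu (fun u => xi i u * xi j u * xi k u).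
Proof.
apply: (@Int_dom _ _ _ _ _
   (fun u => 3^-1 * (`|xi i u| ^+ 3 + `|xi j u| ^+ 3 + `|xi k u| ^+ 3))).
- by apply: measurable_funM => //; exact: measurable_funM.
- by apply: IntZ; apply: IntD => //; exact: IntD.
- by move=> u; rewrite [3^-1 * _]mulrC; exact: amgm3.
Qed.

Section Windows.
Variables (a b : nat).

(** Radii are counted in units of [m]: a term is independent of the terms
    outside its window of radius 1. *)
Definition win (r j i : nat) := ((j <= i + r * m) && (i <= j + r * m))%N.

Definition nbr (r j : nat) (u : seqsp R) : R :=
  \sum_(a <= i < b | win r j i) xi i u.

Definition nbra (r j : nat) (u : seqsp R) : R :=
  \sum_(a <= i < b | win r j i) `|xi i u|.

Lemma measurable_nbr r j : measurable_fun setT (nbr r j).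
Proof.
exact: measurable_sum_cond.
Qed.

Lemma measurable_nbra r j : measurable_fun setT (nbra r j).
Proof.
by apply: measurable_sum_cond => i; exact: measurableT_comp.
Qed.

Lemma nbra_ge0 r j u : 0 <= nbra r j u.
Proof. exact: sumr_ge0. Qed.

Lemma nbr_le_nbra r j u : `|nbr r j u| <= nbra r j u.
Proof. exact: ler_norm_sum. Qed.

Lemma nbra_le r s j u : (r <= s)%N -> nbra r j u <= nbra s j u.
Proof.
move=> rs; rewrite /nbra [X in _ <= X](bigID (win r j))/=.
rewrite (eq_bigl (fun i => win s j i && win r j i)); last first.
  move=> i; rewrite /win; apply/idP/idP => [|/andP[]//].
  have : (r * m <= s * m)%N by rewrite leq_mul2r rs orbT.
  by lia.
by rewrite lerDl sumr_ge0.
Qed.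

(** The coordinates entering the terms of the window [win r j]; the terms
    outside the next larger window do not involve them. *)
Definition zone (r j : nat) : pred nat :=
  fun k => (j <= k + r * m <= j + (2 * r).+1 * m)%N.

Lemma nbr_dep r j : dep (zone r j) (nbr r j).
Proof.
move=> v u vu; apply: eq_bigr => i /andP[w1 w2].
by apply: xi_dep => k Hk; apply: vu; rewrite /zone; lia.
Qed.

Lemma nbra_dep r j : dep (zone r j) (nbra r j).
Proof.
move=> v u vu; apply: eq_bigr => i /andP[w1 w2]; congr `|_|.
by apply: xi_dep => k Hk; apply: vu; rewrite /zone; lia.
Qed.

Lemma zone_sub r s j k : (r <= s)%N -> zone r j k -> zone s j k.
Proof.
move=> rs; have : (r * m <= s * m)%N by rewrite leq_mul2r rs orbT.
by rewrite /zone; lia.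
Qed.

Lemma win_sum r j (F : nat -> R) (K : R) : 0 <= K -> (forall i, F i <= K) ->
  \sum_(a <= i < b | win r j i) F i <= ((2 * r * m).+1)%:R * K.
Proof.
move=> K0 FK; apply: (@le_trans _ _ (\sum_(a <= i < b | win r j i) K)).
  by apply: ler_sum => i _.
rewrite -big_filter big_const_seq count_predT iter_addr_0 -[X in X <= _]mulr_natl ler_wpM2r//.
rewrite ler_nat.
have -> : (2 * r * m).+1 = size (iota (j - r * m) (2 * r * m).+1) by rewrite size_iota.
apply: uniq_leq_size; first by rewrite filter_uniq// iota_uniq.
move=> i; rewrite mem_filter mem_iota => /andP[/andP[w1 w2] _].
by lia.
Qed.

Lemma Int_nbra r j : Int mu (nbra r j).
Proof. by apply: Int_sum => i _; exact/Int_abs/Int_xi. Qed.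

(** The factor carried by the variation of the derivative in [expand_one]. *)
Definition weight (j : nat) (u : seqsp R) : R := `|xi j u| * nbra 2 j u.

Lemma weightE r j : (fun u => `|xi j u| * nbra r j u) = fun u =>
  \sum_(i <- [seq i <- index_iota a b | win r j i]) `|xi j u * xi i u|.
Proof.
by apply/funext => u; rewrite mulr_sumr big_filter; apply: eq_bigr => i _; rewrite normrM.
Qed.

Lemma measurable_weight j : measurable_fun setT (weight j).
Proof.
apply: measurable_funM; last exact: measurable_nbra.
exact: measurableT_comp.
Qed.

Lemma weight_ge0 j u : 0 <= weight j u.
Proof. by rewrite mulr_ge0// nbra_ge0. Qed.

Lemma Int_weight j : Int mu (weight j).
Proof.
rewrite /weight weightE.
by apply: Int_sum => i _; exact/Int_abs/Int_xi2.
Qed.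

Lemma weight_nbraE r j : (fun u => weight j u * nbra r j u) = fun u =>
  \sum_(i <- [seq i <- index_iota a b | win r j i])
  \sum_(k <- [seq i <- index_iota a b | win 2 j i]) `|xi j u * xi k u * xi i u|.
Proof.
apply/funext => u; rewrite /weight (congr1 (@^~ u) (weightE 2 j)).
rewrite [RHS]big_filter /nbra mulr_sumr; apply: eq_bigr => i _.
by rewrite mulr_suml; apply: eq_bigr => k _; rewrite -normrM.
Qed.

Lemma Int_weight_nbra r j : Int mu (fun u => weight j u * nbra r j u).
Proof.
rewrite weight_nbraE.
by apply: Int_sum => i _; apply: Int_sum => k _; exact/Int_abs/Int_xi3.
Qed.

Section Expand.
Variables (psi : seqsp R -> R) (Dpsi : pred nat).
Hypotheses (mpsi : measurable_fun setT psi) (dpsi : dep Dpsi psi).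

Let W u := psi u + block_sum xi a b u.

Lemma W_nbr_dep r j : (forall k, Dpsi k -> ~~ zone r j k) ->
  dep (predC (zone r j)) (fun u => W u - nbr r.+1 j u).
Proof.
move=> Dz v u vu.
have WE w : W w - nbr r.+1 j w = psi w + \sum_(a <= i < b | ~~ win r.+1 j i) xi i w.
  rewrite /W /block_sum (bigID (win r.+1 j))/= -/(nbr r.+1 j w).
  by rewrite addrCA [LHS]addrC addKr.
rewrite !WE; congr (_ + _).
  by apply: dpsi => k /Dz; exact: vu.
apply: eq_bigr => i; rewrite /win => wi.
by apply: xi_dep => k Hk; apply: vu; rewrite /= /zone; lia.
Qed.

Variables (f f1 : R -> R) (Cf C1 : R).
Hypotheses (df : forall t : R, is_derive t (1 : R) f (f1 t))
  (f_bd : forall t, `|f t| <= Cf) (f1_bd : forall t, `|f1 t| <= C1)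
  (f1_meas : measurable_fun setT f1).

(** Taking the window of radius 1 out of [W] leaves a variable independent of
    the centred [xi j], so only the increment of [f] over that window counts.
    To first order it is the window times a derivative, and taking out the
    window of radius 2 makes this derivative independent of both [xi j] and the
    window: the covariance factors out.  All that remains is the variation of
    [f1], bounded by [D], weighted by two factors which are local at [j].  The
    extra summand [psi] of [W] stands for what was frozen by conditioning. *)
Lemma expand_one (j : nat) (D : seqsp R -> R) (CD : R) : (a <= j < b)%N ->
  (forall k, Dpsi k -> ~~ zone 1 j k) ->
  measurable_fun setT D -> (forall u, 0 <= D u <= CD) ->
  (forall u t, `|t - (W u - nbr 2 j u)| <= 2 * nbra 2 j u ->
     `|f1 t - f1 (W u - nbr 2 j u)| <= D u) ->
  `|E (fun u => xi j u * f (W u)) -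
    E (fun u => xi j u * nbr 1 j u) * E (fun u => f1 (W u))| <=
  E (fun u => weight j u * D u) + E (weight j) * E D.
Proof.
move=> jab Dz mD Dbd fD.
have mW : measurable_fun setT W.
  by apply: measurable_funD => //; exact: measurable_block_sum.
have mf : measurable_fun setT f.
  apply: continuous_measurable_fun => t.
  by apply/differentiable_continuous/derivable1_diffP; case: (df t).
have mWn r : measurable_fun setT (fun u => W u - nbr r j u).
  by apply: measurable_funB => //; exact: measurable_nbr.
have If (g : seqsp R -> R) : measurable_fun setT g -> Int mu (fun u => f (g u)).
  by move=> mg; apply: (@Int_bounded _ _ _ _ _ Cf) => //; exact: measurableT_comp.
have If1 (g : seqsp R -> R) : measurable_fun setT g -> Int mu (fun u => f1 (g u)).
  by move=> mg; apply: (@Int_bounded _ _ _ _ _ C1) => //; exact: measurableT_comp.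
have ID : Int mu D.
  by apply: (@Int_bounded _ _ _ _ _ CD) => // u; have /andP[? ?] := Dbd u; rewrite ger0_norm.
have Iw := Int_weight j.
have CD0 : 0 <= CD by have /andP[d0 /(le_trans d0)] := Dbd point.
have IwD : Int mu (fun u => weight j u * D u).
  apply: (@Int_dom _ _ _ _ _ (fun u => CD * weight j u)) => //.
  - by apply: measurable_funM => //; exact: measurable_weight.
  - exact: IntZ.
  move=> u; have /andP[D0 DC] := Dbd u.
  rewrite ger0_norm; last by rewrite mulr_ge0 ?weight_ge0.
  by rewrite mulrC ler_wpM2r ?weight_ge0.
have Ixf (g : seqsp R -> R) : measurable_fun setT g -> Int mu (fun u => xi j u * f (g u)).
  move=> mg; apply: (@Int_dom _ _ _ _ _ (fun u => Cf * `|xi j u|)) => //.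
  - by apply: measurable_funM => //; exact: measurableT_comp.
  - by apply: IntZ; exact/Int_abs/Int_xi.
  - by move=> u; rewrite normrM mulrC ler_wpM2r.
have Inb : Int mu (fun u => xi j u * nbr 1 j u).
  apply: (@Int_dom _ _ _ _ _ (fun u => `|xi j u| * nbra 1 j u)) => //.
  - by apply: measurable_funM => //; exact: measurable_nbr.
  - by rewrite weightE; apply: Int_sum => i _; exact/Int_abs/Int_xi2.
  - by move=> u; rewrite normrM ler_wpM2l// nbr_le_nbra.
have xz k : (j <= k <= j + m)%N -> zone 0 j k by rewrite /zone; lia.
have z1 k : zone 1 j k = (j <= k + m <= j + 3 * m)%N by rewrite /zone mul1n.
(* the term in which [f] does not see the window vanishes *)
have E0 : E (fun u => xi j u * f (W u - nbr 1 j u)) = 0.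
  have [_ ->] : Int mu (fun u => xi j u * f (W u - nbr 1 j u)) /\
      E (fun u => xi j u * f (W u - nbr 1 j u)) =
      E (xi j) * E (fun u => f (W u - nbr 1 j u)).
    apply: (@dep_mul _ _ _ mu_iid (fun k => j <= k <= j + m)%N (predC (zone 0 j))).
    - by move=> k /xz /= ->.
    - exact: xi_dep.
    - move=> v u vu; congr f; apply: (W_nbr_dep (r := 0)) => // k /Dz.
      by apply: contra; exact: zone_sub.
    - exact: Int_xi.
    - exact: If.
  by rewrite xi_mean mul0r.
(* the second-order term factors *)
have [Iprod Eprod] : Int mu (fun u => (xi j u * nbr 1 j u) * f1 (W u - nbr 2 j u)) /\
   E (fun u => (xi j u * nbr 1 j u) * f1 (W u - nbr 2 j u)) =
   E (fun u => xi j u * nbr 1 j u) * E (fun u => f1 (W u - nbr 2 j u)).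
  apply: (@dep_mul _ _ _ mu_iid (zone 1 j) (predC (zone 1 j))) => //.
  - by move=> k /= ->.
  - move=> v u vu; congr (_ * _); last exact: nbr_dep.
    by apply: xi_dep => k Hk; apply: vu; rewrite z1; lia.
  - by move=> v u vu; congr f1; exact: W_nbr_dep.
  - exact: If1.
have -> : E (fun u => xi j u * f (W u)) - E (fun u => xi j u * nbr 1 j u) * E (fun u => f1 (W u)) =
   E (fun u => xi j u * (f (W u) - f (W u - nbr 1 j u)) - (xi j u * nbr 1 j u) * f1 (W u - nbr 2 j u)) +
   E (fun u => xi j u * nbr 1 j u) * E (fun u => f1 (W u - nbr 2 j u) - f1 (W u)).
  rewrite (ExB (If1 _ (mWn 2)) (If1 _ mW)) ExB//; last first.
    rewrite [X in Int _ X](_ : _ = fun u => xi j u * f (W u) - xi j u * f (W u - nbr 1 j u)).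
      by apply: IntB; exact: Ixf.
    by apply/funext => u; rewrite mulrBr.
  rewrite Eprod.
  have -> : E (fun u => xi j u * (f (W u) - f (W u - nbr 1 j u))) = E (fun u => xi j u * f (W u)).
    rewrite -[RHS]subr0 -E0 -ExB; [|exact: Ixf|exact: Ixf].
    by congr E; apply/funext => u; rewrite mulrBr.
  by rewrite mulrBr; move: (E _) (E _) (E _) (E _) => x y z t; ring.
apply: le_trans (ler_normD _ _) _; apply: lerD.
  apply: le_trans (Ex_abs _) _.
    apply: IntB => //.
    rewrite [X in Int _ X](_ : _ = fun u => xi j u * f (W u) - xi j u * f (W u - nbr 1 j u)).
      by apply: IntB; exact: Ixf.
    by apply/funext => u; rewrite mulrBr.
  apply: Ex_le => //.
    apply: Int_abs; apply: IntB => //.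
    rewrite [X in Int _ X](_ : _ = fun u => xi j u * f (W u) - xi j u * f (W u - nbr 1 j u)).
      by apply: IntB; exact: Ixf.
    by apply/funext => u; rewrite mulrBr.
  move=> u.
  rewrite -mulrA -mulrBr normrM /weight -mulrA ler_wpM2l//.
  have n1 := nbr_le_nbra 1 j u; have n2 := nbr_le_nbra 2 j u.
  have n12 := nbra_le j u (isT : 1 <= 2)%N.
  have := @mean_value _ f f1 (W u - nbr 1 j u) (W u) (f1 (W u - nbr 2 j u)) (D u) df.
  rewrite opprB [X in `|_ - X * _|]addrC subrK => mv.
  apply: (le_trans (mv _)).
    move=> t Ht; apply: fD.
    have : `|t - W u| <= `|nbr 1 j u|.
      move: Ht; rewrite ler_norml ge_min le_max => /andP[/orP[h1|h1] /orP[h2|h2]];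
      have := ler_norm (nbr 1 j u); have := ler_norm (- nbr 1 j u); rewrite normrN; lra.
    have -> : t - (W u - nbr 2 j u) = (t - W u) + nbr 2 j u by ring.
    move=> h; apply: le_trans (ler_normD _ _) _; lra.
  have /andP[D0 _] := Dbd u.
  rewrite addrC subrK ler_wpM2r//.
  exact: le_trans n1 _.
rewrite normrM; apply: ler_pM => //.
  apply: le_trans (Ex_abs Inb) _; apply: Ex_le => //; first exact: Int_abs.
  move=> u; rewrite normrM /weight ler_wpM2l//.
  by apply: le_trans (nbr_le_nbra _ _ _) _; exact: nbra_le.
apply: le_trans (Ex_abs _) _; first by apply: IntB; exact: If1.
apply: Ex_le => //; first by apply: Int_abs; apply: IntB; exact: If1.
move=> u; rewrite distrC; apply: fD.
have -> : W u - (W u - nbr 2 j u) = nbr 2 j u by ring.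
apply: le_trans (nbr_le_nbra _ _ _) _.
by have := nbra_ge0 2 j u; lra.
Qed.

End Expand.

Variable M : R.
Hypothesis M_ge1 : 1 <= M.
Hypothesis xi_mom : forall j, Ex mu (fun u => `|xi j u| ^+ 3) <= M.

Lemma Ex_abs_xi j : E (fun u => `|xi j u|) <= 2 * M.
Proof.
apply: (@le_trans _ _ (E (fun u => 1 + `|xi j u| ^+ 3))).
  apply: Ex_le; [exact/Int_abs/Int_xi|by apply: IntD => //; exact: Int_cst|].
  by move=> u; exact: norm_le1_cube.
rewrite ExD//; last exact: Int_cst.
by rewrite Ex_cst; move: (xi_mom j) M_ge1; move: (E _) => e; lra.
Qed.

Lemma Ex_abs_xi2 i j : E (fun u => `|xi i u * xi j u|) <= 2 * M.
Proof.
apply: (@le_trans _ _ (E (fun u => 1 + 2^-1 * (`|xi i u| ^+ 3 + `|xi j u| ^+ 3)))).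
  apply: Ex_le; [exact/Int_abs/Int_xi2| |].
    by apply: IntD; [exact: Int_cst|apply: IntZ; exact: IntD].
  by move=> u; rewrite [2^-1 * _]mulrC; exact: mul_le1_cube.
rewrite ExD ?ExZ ?ExD ?Ex_cst//; last 3 first.
- exact: IntD.
- exact: Int_cst.
- by apply: IntZ; exact: IntD.
by move: (xi_mom i) (xi_mom j) M_ge1; move: (E _) (E _) => e1 e2; lra.
Qed.

Lemma Ex_abs_xi3 i j k : E (fun u => `|xi i u * xi j u * xi k u|) <= M.
Proof.
have I2 : Int mu (fun u => `|xi i u| ^+ 3 + `|xi j u| ^+ 3) by exact: IntD.
have I3 : Int mu (fun u => `|xi i u| ^+ 3 + `|xi j u| ^+ 3 + `|xi k u| ^+ 3).
  exact: IntD.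
apply: (@le_trans _ _ (E (fun u =>
   3^-1 * (`|xi i u| ^+ 3 + `|xi j u| ^+ 3 + `|xi k u| ^+ 3)))).
  apply: Ex_le; [exact/Int_abs/Int_xi3|exact: IntZ|].
  by move=> u; rewrite [3^-1 * _]mulrC; exact: amgm3.
rewrite ExZ// ExD// ExD//.
by move: (xi_mom i) (xi_mom j) (xi_mom k); move: (E _) (E _) (E _) => e1 e2 e3; lra.
Qed.

Lemma Ex_nbra r j : E (nbra r j) <= ((2 * r * m).+1)%:R * (2 * M).
Proof.
have -> : nbra r j = fun u => \sum_(i <- [seq i <- index_iota a b | win r j i]) `|xi i u|.
  by apply/funext => u; rewrite big_filter.
rewrite Ex_sum; last by move=> i _; exact/Int_abs/Int_xi.
rewrite big_filter; apply: win_sum => [|i]; last exact: Ex_abs_xi.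
by move: M_ge1; lra.
Qed.

Lemma Ex_weight j : E (weight j) <= ((2 * 2 * m).+1)%:R * (2 * M).
Proof.
rewrite /weight weightE.
rewrite Ex_sum; last by move=> i _; exact/Int_abs/Int_xi2.
rewrite big_filter; apply: win_sum => [|i]; last exact: Ex_abs_xi2.
by move: M_ge1; lra.
Qed.

Lemma Ex_weight_nbra r j : E (fun u => weight j u * nbra r j u) <=
  ((2 * r * m).+1)%:R * (((2 * 2 * m).+1)%:R * M).
Proof.
rewrite weight_nbraE.
rewrite Ex_sum; last first.
  by move=> i _; apply: Int_sum => k _; exact/Int_abs/Int_xi3.
rewrite big_filter; apply: win_sum => [|i]; first by rewrite mulr_ge0//; move: M_ge1; lra.
rewrite Ex_sum; last by move=> k _; exact/Int_abs/Int_xi3.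
rewrite big_filter; apply: win_sum => [|k]; last exact: Ex_abs_xi3.
by move: M_ge1; lra.
Qed.

End Windows.

End LocalExpansion.

(** * A smoothed indicator and its primitive *)

Section TestFunctions.
Context (R : realType).
Implicit Types x y z e s t h : R.

Lemma mul_norm_incr x h :
  - h ^+ 2 <= (h + x) * `|h + x| - x * `|x| - 2 * h * `|x| <= h ^+ 2.
Proof.
have sq := sqr_ge0 (h + x); have sqh := sqr_ge0 h.
have [hx|hx] := ger0P (h + x); have [x0|x0] := ger0P x.
- by apply/andP; split; lra.
- have : 0 <= (h + x) * - x by rewrite mulr_ge0// oppr_ge0 ltW.
  have : 0 <= h * - x by rewrite mulr_ge0//; lra.
  by move=> *; apply/andP; split; lra.
- have : 0 <= - (h + x) * x by rewrite mulr_ge0// oppr_ge0 ltW.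
  have : 0 <= - h * x by rewrite mulr_ge0//; lra.
  by move=> *; apply/andP; split; lra.
- by apply/andP; split; lra.
Qed.

Lemma is_derive_mul_norm x :
  is_derive x (1 : R) (fun t : R => t * `|t|) (2 * `|x|).
Proof.
have lim : h^-1 *: (((fun t : R => t * `|t|) \o shift x) (h *: (1 : R)) - x * `|x|)
    @[h --> (0 : R)^'] --> 2 * `|x|.
  apply/cvgrPdist_le => e e0; near=> h.
  have h0 : h != 0 by near: h; exact: nbhs_dnbhs_neq.
  have he : `|h| <= e by near: h; apply: dnbhs0_le.
  rewrite /= /GRing.scale/= mulr1.
  have -> : 2 * `|x| - h^-1 * ((h + x) * `|h + x| - x * `|x|) =
     - h^-1 * ((h + x) * `|h + x| - x * `|x| - 2 * h * `|x|) by field.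
  rewrite normrM normrN normfV ler_pdivrMl ?normr_gt0//.
  apply: (@le_trans _ _ (`|h| * `|h|)); last by rewrite ler_wpM2l.
  rewrite -expr2 real_normK ?num_real// ler_norml.
  exact: mul_norm_incr.
apply: DeriveDef; first by apply/cvg_ex; exists (2 * `|x|).
exact: (cvg_lim _ lim).
Unshelve. all: by end_near. Qed.

(** A smoothed indicator of [-1, 1] with a bounded primitive.  The absolute values
    give one formula for all the affine pieces, and [x * |x|] differentiates to
    [2 * |x|]. *)
Definition tent x := (`|x + 2| - 2 * `|x| + `|x - 2|) / 4.
Definition tent_prim x :=
  ((x + 2) * `|x + 2| - 2 * (x * `|x|) + (x - 2) * `|x - 2|) / 8.

Lemma is_derive_affine (f f1 : R -> R) (k c : R) x :
  (forall t : R, is_derive t (1 : R) f (f1 t)) ->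
  is_derive x (1 : R) (fun t => f (k * t + c)) (k * f1 (k * x + c)).
Proof.
move=> df; rewrite mulrC.
have := @is_derive1_comp _ f (fun t : R => k * t + c) x (f1 (k * x + c)) k (df _).
apply.
apply: is_derive_eq => //.
by rewrite addr0 /GRing.scale /= mulr1.
Qed.

Lemma is_derive_tent_prim x : is_derive x (1 : R) tent_prim (tent x).
Proof.
have d (c : R) : is_derive x (1 : R) (fun t : R => (1 * t + c) * `|1 * t + c|) (1 * (2 * `|1 * x + c|)).
  exact: (is_derive_affine (f := fun t => t * `|t|) 1 c x is_derive_mul_norm).
have -> : tent_prim = fun t => 8^-1 *
   (((1 * t + 2) * `|1 * t + 2| - 2 * ((1 * t + 0) * `|1 * t + 0|)) +
   (1 * t + -2) * `|1 * t + -2|).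
  by apply/funext => t; rewrite /tent_prim !mul1r addr0 mulrC.
have d1 := d 2; have d2 := d 0; have d3 := d (-2).
apply: is_derive_eq.
rewrite /tent !mul1r addr0 /GRing.scale/=.
by field.
Qed.

Lemma tent_ge0 x : 0 <= tent x.
Proof.
rewrite divr_ge0//; have := ler_normD (x + 2) (x - 2).
have -> : x + 2 + (x - 2) = 2 * x by ring.
by rewrite normrM (ger0_norm (ler0n _ 2)); lra.
Qed.

Lemma tent_le1 x : tent x <= 1.
Proof.
have := ler_normD (x + 2) (- x); have := ler_normD (x - 2) (- x).
have -> : x + 2 - x = 2 by ring. have -> : x - 2 - x = - 2 by ring.
rewrite /tent !normrN (ger0_norm (ler0n _ 2)).
by have [] := ger0P (x + 2); have [] := ger0P x; have [] := ger0P (x - 2); lra.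
Qed.

Lemma tent_ge_half x : `|x| <= 1 -> 1 / 2 <= tent x.
Proof.
rewrite ler_norml /tent => /andP[x1 x2].
by have [] := ger0P (x + 2); have [] := ger0P x; have [] := ger0P (x - 2); lra.
Qed.

Lemma tent_lip x y : `|tent x - tent y| <= `|x - y|.
Proof.
have H c : `| `|x + c| - `|y + c| | <= `|x - y|.
  by rewrite (le_trans (ler_dist_dist _ _))// opprD addrACA subrr addr0.
have := H 2; have := H (- 2); have := H 0; rewrite !addr0 /tent.
rewrite !ler_norml; move: `|x + 2| `|y + 2| `|x - 2| `|y - 2| `|x| `|y| => *.
by lra.
Qed.

Lemma tent_out x : 2 <= `|x| -> tent x = 0.
Proof.
by rewrite /tent; have [] := ger0P (x + 2); have [] := ger0P x; have [] := ger0P (x - 2); lra.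
Qed.

Lemma tent_prim_le1 x : `|tent_prim x| <= 1.
Proof.
rewrite ler_norml /tent_prim.
by have [] := ger0P (x + 2); have [] := ger0P x; have [] := ger0P (x - 2); nra.
Qed.

(** The tent and the ramp are Lipschitz and constant off a bounded interval;
    after rescaling, their variation is bounded by [osc]. *)
Lemma osc_bound (h : R -> R) z e s t y : 0 < e -> 0 <= s ->
  (forall u v : R, `|h u - h v| <= `|u - v|) -> (forall u, 0 <= h u <= 1) ->
  (forall u, 2 <= u -> h u = h 2) -> (forall u, u <= -2 -> h u = h (-2)) ->
  `|t - y| <= s -> `|h ((t - z) / e) - h ((y - z) / e)| <= osc e s (y - z).
Proof.
move=> e0 s0 hl h01 hr hL tys.
rewrite /osc; have [yz|yz] := leP `|y - z| (2 * e + s).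
  rewrite mulr1 le_min; apply/andP; split.
    have := h01 ((t - z) / e); have := h01 ((y - z) / e).
    by rewrite ler_norml; lra.
  apply: le_trans (hl _ _) _.
  rewrite -mulrBl opprB addrA subrK normrM (gtr0_norm (x := e^-1)) ?invr_gt0//.
  by rewrite ler_wpM2r// invr_ge0 ltW.
rewrite mulr0 normr_le0 subr_eq0; apply/eqP.
move: tys; rewrite ler_norml => /andP[ty1 ty2].
have [yz0|yz0] := leP 0 (y - z).
  rewrite ger0_norm// in yz.
  by rewrite hr ?[RHS]hr// ler_pdivlMr//; lra.
rewrite ltr0_norm// in yz.
by rewrite hL ?[RHS]hL// ler_pdivrMr//; lra.
Qed.

End TestFunctions.

(** * One step of the concentration recursion *)

Section Concentration.
Context (R : realType) (mu : probability (seqsp R) R) (nu : probability R R).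
Hypothesis mu_iid : iid_law mu nu.
Variables (xi : nat -> seqsp R -> R) (m : nat) (M : R).
Hypothesis m_gt0 : (0 < m)%N.
Hypothesis M_ge1 : 1 <= M.
Hypothesis xi_meas : forall j, measurable_fun setT (xi j).
Hypothesis xi_dep : forall j, dep (fun i => j <= i <= j + m)%N (xi j).
Hypothesis xi_int : forall j, Int mu (fun u => `|xi j u| ^+ 3).
Hypothesis xi_mom : forall j, Ex mu (fun u => `|xi j u| ^+ 3) <= M.
Hypothesis xi_mean : forall j, Ex mu (xi j) = 0.

Local Notation E := (Ex mu).
Local Notation T := (block_sum xi).
Local Notation nbr := (nbr xi m).
Local Notation nbra := (nbra xi m).
Local Notation wgt := (weight xi m).

Let Ixi := Int_xi xi_meas xi_int.
Let Ixi2 := Int_xi2 xi_meas xi_int.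

Lemma Int_block_sum a b : Int mu (T a b).
Proof. by apply: Int_sum => i _; exact: Ixi. Qed.

Lemma block_sumME a b c d : (fun u => T a b u * T c d u) =
  fun u => \sum_(i <- index_iota a b) \sum_(j <- index_iota c d) xi i u * xi j u.
Proof.
by apply/funext => u; rewrite /block_sum mulr_suml; apply: eq_bigr => i _; rewrite mulr_sumr.
Qed.

Lemma Int_block_sumM a b c d : Int mu (fun u => T a b u * T c d u).
Proof.
rewrite block_sumME; apply: Int_sum => i _; apply: Int_sum => j _; exact: Ixi2.
Qed.

Lemma Ex_block_sum a b : E (T a b) = 0.
Proof.
rewrite [LHS]Ex_sum; last by move=> i _; exact: Ixi.
by rewrite big1.
Qed.

Lemma Ex_block_sum_sqr_le a b : E (fun u => T a b u * T a b u) <= (b - a)%:R ^+ 2 * (2 * M).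
Proof.
rewrite block_sumME Ex_sum; last by move=> i _; apply: Int_sum => j _; exact: Ixi2.
have H i j : E (fun u => xi i u * xi j u) <= 2 * M.
  apply: le_trans (Ex_abs_xi2 xi_meas xi_int M_ge1 xi_mom i j).
  by apply: Ex_le => [||u]; [exact: Ixi2|exact/Int_abs/Ixi2|exact: ler_norm].
apply: (@le_trans _ _ (\sum_(a <= i < b) \sum_(a <= j < b) (2 * M))).
  apply: ler_sum => i _; rewrite Ex_sum; last by move=> j _; exact: Ixi2.
  by apply: ler_sum => j _; exact: H.
by rewrite !sumr_const_nat -[X in X <= _]mulr_natl -[X in _ * X]mulr_natl mulrA expr2.
Qed.

Lemma Ex_block_sumM_far a b c d : (b + m <= c)%N || (d + m <= a)%N ->
  E (fun u => T a b u * T c d u) = 0.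
Proof.
move=> sep.
have [_ ->] : Int mu (fun u => T a b u * T c d u) /\
    E (fun u => T a b u * T c d u) = E (T a b) * E (T c d).
  apply: (@dep_mul _ _ _ mu_iid (fun i => a <= i < b + m)%N (fun i => c <= i < d + m)%N).
  - by move=> k; lia.
  - exact: block_sum_dep.
  - exact: block_sum_dep.
  - exact: Int_block_sum.
  - exact: Int_block_sum.
by rewrite Ex_block_sum mul0r.
Qed.

(** The pairwise covariances over the windows add up to the covariance with the
    whole sum, terms further apart being independent. *)
Lemma sum_cov_window a b a1 b1 : (a <= a1)%N -> (b1 <= b)%N ->
  \sum_(a1 <= j < b1) E (fun u => xi j u * nbr a b 1 j u) =
  E (fun u => T a1 b1 u * T a b u).
Proof.
move=> aa1 b1b.
have -> : (fun u => T a1 b1 u * T a b u) =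
    fun u => \sum_(j <- index_iota a1 b1) xi j u * T a b u.
  by apply/funext => u; rewrite mulr_suml.
have IxT j : Int mu (fun u => xi j u * T a b u).
  have -> : (fun u => xi j u * T a b u) =
     fun u => \sum_(i <- index_iota a b) xi j u * xi i u.
    by apply/funext => u; rewrite mulr_sumr.
  by apply: Int_sum => i _; exact: Ixi2.
have Ixn j : Int mu (fun u => xi j u * nbr a b 1 j u).
  have -> : (fun u => xi j u * nbr a b 1 j u) =
     fun u => \sum_(i <- index_iota a b | win m 1 j i) xi j u * xi i u.
    by apply/funext => u; rewrite mulr_sumr.
  by apply: Int_sum => i _; exact: Ixi2.
rewrite Ex_sum; last by move=> j _; exact: IxT.
apply: eq_bigr => j _.
apply/eqP; rewrite eq_sym -subr_eq0 -ExB//; apply/eqP.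
have -> : (fun u => xi j u * T a b u - xi j u * nbr a b 1 j u) =
    (fun u => xi j u * (T a b u - nbr a b 1 j u)).
  by apply/funext => u; rewrite mulrBr.
have [_ ->] : Int mu (fun u => xi j u * (T a b u - nbr a b 1 j u)) /\
    E (fun u => xi j u * (T a b u - nbr a b 1 j u)) =
    E (xi j) * E (fun u => T a b u - nbr a b 1 j u).
  apply: (@dep_mul _ _ _ mu_iid (fun k => j <= k <= j + m)%N (predC (zone m 0 j))).
  - by move=> k; rewrite /= /zone; lia.
  - exact: xi_dep.
  - move=> v u vu.
    have := @W_nbr_dep _ xi m xi_dep a b (fun=> 0) pred0 (fun _ _ _ => erefl) 0 j.
    have dz : forall k, pred0 k -> ~~ zone m 0 j k by [].
    by move=> /(_ dz v u vu); rewrite !add0r.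
  - exact: Ixi.
  - by apply: IntB; [exact: Int_block_sum|apply: Int_sum => i _; exact: Ixi].
by rewrite xi_mean mul0r.
Qed.

(** Besides the variance of the inner block only its products with the two
    adjacent blocks of length [m] contribute, and these are of order [m ^+ 2]
    up to a fraction of the variance. *)
Lemma sum_cov_window_ge a b a1 b1 :
  (a + m <= a1)%N -> (a1 <= b1)%N -> (b1 + m <= b)%N ->
  E (fun u => T a1 b1 u * T a1 b1 u) / 2 - 4 * (m%:R ^+ 2 * M) <=
  \sum_(a1 <= j < b1) E (fun u => xi j u * nbr a b 1 j u).
Proof.
move=> aa1 ab1 b1b; rewrite sum_cov_window; [|lia|lia].
have cross c d : (c <= d)%N -> (d - c = m)%N ->
    - (E (fun u => T a1 b1 u * T a1 b1 u) / 4) - 2 * (m%:R ^+ 2 * M) <=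
    E (fun u => T a1 b1 u * T c d u).
  move=> cd dcm.
  have H : E (fun u => - (4^-1 * (T a1 b1 u * T a1 b1 u) + T c d u * T c d u)) <=
      E (fun u => T a1 b1 u * T c d u).
    apply: Ex_le => [||u]; first by apply: IntN; apply: IntD; [apply: IntZ|]; exact: Int_block_sumM.
      exact: Int_block_sumM.
    have := sqr_ge0 (T a1 b1 u / 2 + T c d u); move: (T a1 b1 u) (T c d u) => x y; nra.
  apply: le_trans H.
  rewrite ExN; last by apply: IntD; [apply: IntZ|]; exact: Int_block_sumM.
  rewrite ExD; [|by apply: IntZ; exact: Int_block_sumM|exact: Int_block_sumM].
  rewrite ExZ; last exact: Int_block_sumM.
  have := Ex_block_sum_sqr_le c d; rewrite dcm.
  by move: (E _) (E _) (m%:R ^+ 2) => x y z; lra.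
have TE u : T a b u = T a (a1 - m) u + T (a1 - m) a1 u + T a1 b1 u + T b1 (b1 + m) u + T (b1 + m) b u.
  have -> : T a b u = T a (b1 + m) u + T (b1 + m) b u by apply: block_sum_cat; lia.
  have -> : T a (b1 + m) u = T a b1 u + T b1 (b1 + m) u by apply: block_sum_cat; lia.
  have -> : T a b1 u = T a a1 u + T a1 b1 u by apply: block_sum_cat; lia.
  by have -> : T a a1 u = T a (a1 - m) u + T (a1 - m) a1 u by apply: block_sum_cat; lia.
have -> : (fun u => T a1 b1 u * T a b u) = fun u =>
   T a1 b1 u * T a (a1 - m) u + T a1 b1 u * T (a1 - m) a1 u + T a1 b1 u * T a1 b1 u
   + T a1 b1 u * T b1 (b1 + m) u + T a1 b1 u * T (b1 + m) b u.
  by apply/funext => u; rewrite TE !mulrDr.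
have I := Int_block_sumM.
rewrite !ExD; do ?[by exact: I | by do ?[apply: IntD | exact: I]].
rewrite (Ex_block_sumM_far (c := a)); last lia.
rewrite (Ex_block_sumM_far (c := b1 + m)%N); last lia.
have := cross (a1 - m)%N a1; have := cross b1 (b1 + m)%N.
move=> /(_ ltac:(lia) ltac:(lia)) c1 /(_ ltac:(lia) ltac:(lia)) c2.
by move: c1 c2; move: (E _) (E _) (E _) (m%:R ^+ 2) => x y z t; lra.
Qed.

Section LocalOscillation.
Variables (a b c d : nat) (psi : seqsp R -> R) (j : nat) (e q z : R).
Hypotheses (ac : (a + m <= c)%N) (cd : (c + m <= d)%N) (db : (d <= b)%N).
Hypotheses (mpsi : measurable_fun setT psi)
  (dpsi : dep (fun i => ~~ (a + m <= i < b)%N) psi).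
Hypotheses (e0 : 0 < e) (cq : conc mu xi m c (d - m) e q).
Hypothesis zJ : forall k, zone m 2 j k -> ~~ (c <= k < d)%N.

Let W u := psi u + T a b u.
Let D u := osc e (2 * nbra a b 2 j u) (W u - nbr a b 2 j u - z).
Let J : pred nat := predC (fun i => c <= i < d)%N.

Let DE (G : seqsp R -> R) : (fun u => G u * D u) =
  fun u => G u * osc e (2 * nbra a b 2 j u) (W u - (nbr a b 2 j u + z)).
Proof.
apply/funext => u; congr (_ * osc _ _ _).
by move: (W u) (nbr _ _ _ _ u) => r1 r2; ring.
Qed.

Let dn : dep J (fun u => nbr a b 2 j u + z).
Proof.
have := @sub_dep R _ J _ _ zJ (@nbr_dep _ xi m xi_dep a b 2 j).
by move=> dn v u vu; congr (_ + _); exact: dn.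
Qed.

Let dna : dep J (fun u => 2 * nbra a b 2 j u).
Proof.
have := @sub_dep R _ J _ _ zJ (@nbra_dep _ xi m xi_dep a b 2 j).
by move=> dn' v u vu; congr (_ * _); exact: dn'.
Qed.

Let xJ : dep J (xi j).
Proof.
move=> v u vu; apply: xi_dep => k Hk; apply: vu; apply: zJ.
by rewrite /zone; lia.
Qed.

Let dw : dep J (wgt a b j).
Proof.
have dn' := @sub_dep R _ J _ _ zJ (@nbra_dep _ xi m xi_dep a b 2 j).
by move=> v u vu; congr (`|_| * _); [exact: xJ|exact: dn'].
Qed.

(** [D] compares [W] with [nbr + z], which is determined outside the sub-block
    from [c] to [d]: this is the situation of [Ex_osc]. *)
Lemma local_osc (G : seqsp R -> R) : measurable_fun setT G ->
  (forall u, 0 <= G u) -> dep J G ->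
  Int mu (fun u => G u * nbra a b 2 j u) ->
  E (fun u => G u * D u) <= 14 * q / e * E (fun u => G u * nbra a b 2 j u).
Proof.
move=> mG G0 dG IG; rewrite DE.
have E2 : (fun u => G u * (2 * nbra a b 2 j u)) =
   (fun u => 2 * (G u * nbra a b 2 j u)) by apply/funext => u; ring.
apply: le_trans (@Ex_osc _ _ _ mu_iid xi m xi_meas xi_dep a b c d
  psi ac cd db mpsi dpsi e q G _ _ e0 cq mG _ _ G0 _ dG dn dna _) _.
- apply: measurable_funD => //; exact: measurable_nbr.
- apply: measurable_funM => //; exact: measurable_nbra.
- by move=> u; rewrite mulr_ge0// nbra_ge0.
- by rewrite E2; exact: IntZ.
by rewrite E2 ExZ// mulrA; rewrite (_ : 7 * q / e * 2 = 14 * q / e)//; ring.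
Qed.

Let q0 : 0 <= q.
Proof.
apply: le_trans (cq (psi := fun=> 0) _ _ 0); first by rewrite fine_ge0.
  exact: measurable_cst.
by [].
Qed.

(** The error of [expand_one] for a test function at scale [e].  It is a third
    moment over a window, hence of order [m ^+ 2], times the concentration [q]
    of the sub-block per unit of length. *)
Lemma local_osc_err : E (fun u => wgt a b j u * D u) + E (wgt a b j) * E D <=
  (42 * m%:R * M) ^+ 2 * (q / e).
Proof.
have Iw := @Int_weight_nbra _ mu xi m xi_meas xi_int a b 2 j.
have o1 := local_osc (measurable_weight m xi_meas a b j) (weight_ge0 _ _ _ _ _) dw Iw.
have o2 : E D <= 14 * q / e * E (nbra a b 2 j).
  have G1 (F : seqsp R -> R) : (fun u => 1 * F u) = F.
    by apply/funext => u; rewrite mul1r.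
  have := local_osc (measurable_cst (1 : R)) (fun=> ler01) (fun _ _ _ => erefl).
  rewrite !G1; apply; exact: Int_nbra.
have l5 : (2 * 2 * m).+1%:R <= 5 * m%:R :> R := window_count R 2 m_gt0.
have e1 := @Ex_weight _ mu xi m xi_meas xi_int a b M M_ge1 xi_mom j.
have e2 := @Ex_nbra _ mu xi m xi_meas xi_int a b M M_ge1 xi_mom 2 j.
have e3 := @Ex_weight_nbra _ mu xi m xi_meas xi_int a b M M_ge1 xi_mom 2 j.
have w0 : 0 <= E (wgt a b j) by apply: Ex_ge0 => u; exact: weight_ge0.
have n0 : 0 <= E (nbra a b 2 j) by apply: Ex_ge0 => u; exact: nbra_ge0.
have D0 : 0 <= E D.
  by apply: Ex_ge0 => u; rewrite osc_ge0// mulr_ge0// nbra_ge0.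
have qe0 : 0 <= q / e by rewrite divr_ge0 ?(ltW e0).
have m0 : 0 <= m%:R :> R by [].
have kk0 : 0 <= (2 * 2 * m).+1%:R :> R by [].
rewrite -(mulrA 14) in o1; rewrite -(mulrA 14) in o2.
move: o1 o2 e1 e2 e3 w0 n0 D0 l5 qe0 m0 kk0 M_ge1.
move: (E (fun u => wgt a b j u * nbra a b 2 j u)) (E (fun u => wgt a b j u * D u))
  (E (wgt a b j)) (E D) (E (nbra a b 2 j)) => n wD w ED wn.
move: (q / e) ((2 * 2 * m).+1%:R) (m%:R) => r k x o1 o2 e1 e2 e3 w0 n0 D0 l5 r0 x0 k0 M1.
have M0 : 0 <= M by lra.
have xM : 0 <= x * M by exact: mulr_ge0.
have kM : k * (2 * M) <= 10 * (x * M).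
  apply: le_trans (ler_wpM2r _ l5) _; first by rewrite mulr_ge0.
  by rewrite le_eqVlt; apply/orP; left; apply/eqP; ring.
have h2 : w * ED <= (10 * (x * M)) * (14 * r * (10 * (x * M))).
  apply: ler_pM => //; first exact: le_trans kM.
  apply: le_trans o2 _; rewrite ler_wpM2l ?mulr_ge0//; exact: le_trans kM.
have h1 : wD <= 14 * r * (5 * x * (5 * x * M)).
  apply: le_trans o1 _; rewrite ler_wpM2l ?mulr_ge0//; apply: le_trans e3 _.
  by rewrite ler_pM ?mulr_ge0// ler_wpM2r.
apply: le_trans (lerD h1 h2) _.
have -> : 14 * r * (5 * x * (5 * x * M)) + 10 * (x * M) * (14 * r * (10 * (x * M))) =
  r * x ^+ 2 * (350 * M + 1400 * M ^+ 2) by ring.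
have -> : (42 * x * M) ^+ 2 * r = r * x ^+ 2 * (42 ^+ 2 * M ^+ 2) by ring.
by rewrite ler_wpM2l ?mulr_ge0 ?sqr_ge0//; nra.
Qed.

End LocalOscillation.

(** [expand_one] is applied to the primitive of the tent at scale [e]: its values
    are at most [e], while its derivative detects the interval with the factor
    [sum_cov_window_ge].  The errors only involve the sub-block to the right of
    the summation range. *)
Lemma conc_step a b a1 b1 (e q : R) :
  (a + 2 * m <= a1)%N -> (a1 <= b1)%N -> (b1 + 4 * m <= b)%N -> 0 < e ->
  conc mu xi m (b1 + 3 * m) (b - m) e q ->
  forall psi : seqsp R -> R, measurable_fun setT psi ->
    dep (fun i => ~~ (a + m <= i < b)%N) psi ->
  forall x : R,
  (E (fun u => T a1 b1 u * T a1 b1 u) / 2 - 4 * (m%:R ^+ 2 * M)) *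
    fine (mu [set u | x <= psi u + T a b u <= x + e]) / 2 <=
  e * E (fun u => `|T a1 b1 u|) + (b1 - a1)%:R * ((42 * m%:R * M) ^+ 2 * (q / e)).
Proof.
move=> aa1 ab1 b1b e0 cq psi mpsi dpsi x.
have aam : (a + m <= a1)%N by lia.
have bbm : (b1 + m <= b)%N by lia.
pose W u := psi u + T a b u.
have mW : measurable_fun setT W.
  by apply: measurable_funD => //; exact: measurable_block_sum.
(* the tent at scale [e] centred at the middle of the interval *)
pose z := x + e / 2.
pose f t := e * tent_prim ((t - z) / e); pose f1 t := tent ((t - z) / e).
have df (t : R) : is_derive t (1 : R) f (f1 t).
  have d1 := is_derive_affine e^-1 (- z / e) t (@is_derive_tent_prim R).
  have -> : f = fun t => e * tent_prim (e^-1 * t + - z / e).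
    by apply/funext => r; rewrite /f; congr (e * tent_prim _); ring.
  apply: is_derive_eq.
  rewrite /GRing.scale/= mulrA divff ?gt_eqF// mul1r /f1.
  by congr tent; ring.
have f_bd t : `|f t| <= e.
  rewrite normrM (gtr0_norm e0) -[X in _ <= X]mulr1 ler_wpM2l ?tent_prim_le1//.
  exact: ltW.
have f1_01 t : 0 <= f1 t <= 1 by rewrite tent_ge0 tent_le1.
have f1_bd t : `|f1 t| <= 1 by have /andP[? ?] := f1_01 t; rewrite ger0_norm.
have mf1 : measurable_fun setT f1.
  have -> : f1 = fun t => (`|(t - z) / e + 2| - 2 * `|(t - z) / e| + `|(t - z) / e - 2|) / 4.
    by [].
  have ml (c : R) : measurable_fun setT (fun t : R => `|(t - z) / e + c|).
    apply: measurableT_comp => //; apply: measurable_funD => //.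
    by apply: measurable_funM => //; exact: measurable_funB.
  apply: measurable_funM => //; apply: measurable_funD; last exact: ml.
  apply: measurable_funB; first exact: ml.
  apply: measurable_funM => //.
  by have := ml 0; under [X in measurable_fun _ X -> _]eq_fun do rewrite addr0.
have q0 : 0 <= q.
  apply: le_trans (cq (fun=> 0) _ _ 0); first by rewrite fine_ge0.
    exact: measurable_cst.
  by [].
have m2 : 0 <= m%:R ^+ 2 :> R by rewrite exprn_ge0.
have M0 : 0 <= M by move: M_ge1; lra.
pose K := (42 * m%:R * M) ^+ 2 * (q / e).
have K0 : 0 <= K.
  by rewrite mulr_ge0 ?sqr_ge0// divr_ge0// ltW.
pose p := fine (mu [set u | x <= W u <= x + e]).
have p0 : 0 <= p by rewrite fine_ge0.
pose V0 := E (fun u => T a1 b1 u * T a1 b1 u) / 2 - 4 * (m%:R ^+ 2 * M).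
rewrite -/p -/V0 -/K.
have rhs0 : 0 <= e * E (fun u => `|T a1 b1 u|) + (b1 - a1)%:R * K.
  apply: addr_ge0; first by apply: mulr_ge0; [exact: ltW|exact: Ex_ge0].
  by apply: mulr_ge0.
have [V00|V00] := leP V0 0.
  apply: le_trans rhs0.
  by rewrite pmulr_lle0 ?invr_gt0// mulr_le0_ge0.
pose D j u := osc e (2 * nbra a b 2 j u) (W u - nbr a b 2 j u - z).
have mD j : measurable_fun setT (D j).
  apply: measurable_osc.
    apply: measurable_funM => //; exact: measurable_nbra.
  apply: measurable_funB => //; apply: measurable_funB => //.
  exact: measurable_nbr.
have nb0 j u : 0 <= 2 * nbra a b 2 j u by rewrite mulr_ge0// nbra_ge0.
have err j : (a1 <= j < b1)%N ->
  `|E (fun u => xi j u * f (W u)) -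
    E (fun u => xi j u * nbr a b 1 j u) * E (fun u => f1 (W u))| <= K.
  move=> /andP[a1j jb1].
  apply: le_trans (@expand_one _ _ _ mu_iid xi m xi_meas xi_dep xi_int xi_mean a b
     psi _ mpsi dpsi f f1 e 1 df f_bd f1_bd mf1 j (D j) 1 _ _ _ _ _) _.
  - by lia.
  - by move=> k; rewrite /zone; lia.
  - exact: mD.
  - by move=> u; rewrite osc_ge0// osc_le1.
  - move=> u t tu; apply: osc_bound => //.
    + exact: tent_lip.
    + by move=> v; rewrite tent_ge0 tent_le1.
    + by move=> v v2; rewrite !tent_out// ger0_norm//; lra.
    + by move=> v v2; rewrite !tent_out// ler0_norm//; lra.
  apply: (@local_osc_err a b (j + 3 * m).+1 b psi) => //.
  - by lia.
  - by lia.
  - by apply: conc_widen cq => //; lia.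
  - by move=> k; rewrite /zone/=; lia.
have Ixf j : Int mu (fun u => xi j u * f (W u)).
  apply: (@Int_dom _ _ _ _ _ (fun u => e * `|xi j u|)) => //.
  - apply: measurable_funM => //; apply: measurableT_comp => //.
    apply: continuous_measurable_fun => t.
    by apply/differentiable_continuous/derivable1_diffP; case: (df t).
  - by apply: IntZ; exact/Int_abs/Ixi.
  - by move=> u; rewrite normrM mulrC ler_wpM2r.
have mf : measurable_fun setT f.
  apply: continuous_measurable_fun => t.
  by apply/differentiable_continuous/derivable1_diffP; case: (df t).
have If1 : Int mu (fun u => f1 (W u)).
  by apply: (@Int_bounded _ _ _ _ _ 1) => //; exact: measurableT_comp.
pose V := \sum_(a1 <= j < b1) E (fun u => xi j u * nbr a b 1 j u).
pose P1 := E (fun u => f1 (W u)).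
have sumE : V * P1 - E (fun u => T a1 b1 u * f (W u)) <= (b1 - a1)%:R * K.
  have -> : (fun u => T a1 b1 u * f (W u)) =
      fun u => \sum_(j <- index_iota a1 b1) xi j u * f (W u).
    by apply/funext => u; rewrite mulr_suml.
  rewrite Ex_sum; last by move=> j _; exact: Ixf.
  rewrite /V mulr_suml -sumrB mulr_natl -sumr_const_nat.
  apply: ler_sum_nat => j jab.
  by apply: le_trans (err j jab); rewrite distrC ler_norm.
have TfE : E (fun u => T a1 b1 u * f (W u)) <= e * E (fun u => `|T a1 b1 u|).
  have IT := Int_block_sum a1 b1.
  rewrite -ExZ; last exact: Int_abs.
  apply: Ex_le => [||u].
  - apply: (@Int_dom _ _ _ _ _ (fun u => e * `|T a1 b1 u|)).
    + apply: measurable_funM; first exact: measurable_block_sum.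
      exact: measurableT_comp.
    + by apply: IntZ; exact: Int_abs.
    + by move=> u; rewrite normrM mulrC ler_wpM2r.
  - by apply: IntZ; exact: Int_abs.
  - by apply: le_trans (ler_norm _) _; rewrite normrM mulrC ler_wpM2r.
have pP1 : p / 2 <= P1.
  have mS : measurable [set u | x <= W u <= x + e] by exact: measurable_itvE.
  rewrite /p -(Ex_indic _ mS) mulrC -ExZ; last exact: Int_indic.
  apply: Ex_le => // [|u]; first by apply: IntZ; exact: Int_indic.
  rewrite indicE; have [|_] := boolP (u \in _); last first.
    by rewrite mulr0; have /andP[] := f1_01 (W u).
  rewrite inE/= mulr1 => /andP[h1 h2]; rewrite -[2^-1]mul1r; apply: tent_ge_half.
  by rewrite ler_norml ler_pdivlMr// ler_pdivrMr// /z; lra.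
have VV0 : V0 <= V by exact: sum_cov_window_ge aam ab1 bbm.
have P10 : 0 <= P1 by apply: Ex_ge0 => u; have /andP[] := f1_01 (W u).
have : V0 * (p / 2) <= V * P1.
  apply: (@le_trans _ _ (V0 * P1)); first by rewrite ler_wpM2l// ltW.
  by rewrite ler_wpM2r.
rewrite mulrA => h; apply: le_trans h _.
by move: sumE TfE; move: (V * P1) => vp; lra.
Qed.

End Concentration.

(** * Concentration of block sums *)

Section FineProbability.
Context d (T : measurableType d) (R : realType) (P : probability T R).

Lemma fine_prob_le1 (A : set T) : measurable A -> fine (P A) <= 1.
Proof.
move=> mA; rewrite -[X in _ <= X]/(fine 1%E) fine_le ?fin_num_measure//.
exact: probability_le1.
Qed.

End FineProbability.

(** The width at which intervals are measured is [conc_width] times [m ^+ 2]. It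
    is large enough for the coefficient of the old bound in [conc_step] to be
    one half; [conc_const] makes the bound on short blocks exceed 1. *)
Definition conc_width (R : realType) (v M : R) : R := 32 * 42 ^+ 2 * M ^+ 2 / v.

Definition conc_const (R : realType) (v M : R) (n0 : nat) : R :=
  24 + 3 * n0%:R + 48 * M / v + 32 * conc_width v M / Num.sqrt v.

(** The real-variable content of the recursion: the bound [P] for a block of
    length [N] follows from the bound [q] for a sub-block of comparable length,
    with a gain of one half from the choice of the width. *)
Lemma conc_recursion (R : realType) (v M B2 P A D e q L1 N N1 m : R) :
  0 < v -> 1 <= M -> 1 <= m -> 0 < N -> 0 <= P -> A = 32 * 42 ^+ 2 * M ^+ 2 / v ->
  32 * A / Num.sqrt v <= D -> e = A * m ^+ 2 -> q <= 2 * D * (m ^+ 2 / Num.sqrt N) ->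
  0 <= N1 -> N <= 4 * N1 -> v * N1 <= B2 -> 16 * m ^+ 2 * M <= B2 ->
  L1 <= Num.sqrt B2 ->
  (B2 / 2 - 4 * (m ^+ 2 * M)) * P / 2 <= e * L1 + N1 * ((42 * m * M) ^+ 2 * (q / e)) ->
  P <= D * (m ^+ 2 / Num.sqrt N).
Proof.
move=> v0 M1 m1 N0 P0 AE DA eE qD N10 NN1 vB B16 L1B H.
have A0 : 0 < A by rewrite AE divr_gt0// mulr_gt0 ?exprn_gt0//; lra.
have m0 : 0 < m by lra.
have e0 : 0 < e by rewrite eE mulr_gt0// exprn_gt0.
have N1p : 0 < N1 by lra.
have B20 : 0 < B2 by apply: lt_le_trans vB; rewrite mulr_gt0.
set B := Num.sqrt B2 in L1B.
have B0 : 0 < B by rewrite sqrtr_gt0.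
have BE : B2 = B ^+ 2 by rewrite sqr_sqrtr// ltW.
have sN0 : 0 < Num.sqrt N by rewrite sqrtr_gt0.
have sv0 : 0 < Num.sqrt v by rewrite sqrtr_gt0.
(* the two terms of the recursion *)
have t1 : B2 / 8 * P <= e * B + N1 * ((42 * m * M) ^+ 2 * (q / e)).
  apply: (@le_trans _ _ ((B2 / 2 - 4 * (m ^+ 2 * M)) * P / 2)).
    have -> : (B2 / 2 - 4 * (m ^+ 2 * M)) * P / 2 = (B2 / 4 - 2 * (m ^+ 2 * M)) * P.
      by field.
    by rewrite ler_wpM2r//; lra.
  by apply: le_trans H _; rewrite lerD2r ler_wpM2l// ltW.
have t2 : N1 * ((42 * m * M) ^+ 2 * (q / e)) <= B2 / 8 * (D / 2 * (m ^+ 2 / Num.sqrt N)).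
  have -> : N1 * ((42 * m * M) ^+ 2 * (q / e)) = (v * N1) / 32 * q.
    by rewrite eE AE; field; rewrite !gt_eqF//=; lra.
  apply: (@le_trans _ _ (v * N1 / 32 * (2 * D * (m ^+ 2 / Num.sqrt N)))).
    by rewrite ler_wpM2l// divr_ge0// mulr_ge0// ltW.
  have -> : B2 / 8 * (D / 2 * (m ^+ 2 / Num.sqrt N)) = B2 / 32 * (2 * D * (m ^+ 2 / Num.sqrt N)).
    by field; rewrite gt_eqF.
  rewrite ler_wpM2r//; last by rewrite ler_pM2r// invr_gt0.
  have D0 : 0 <= D by apply: le_trans DA; rewrite divr_ge0 ?mulr_ge0 ?(ltW A0) ?(ltW sv0).
  by rewrite mulr_ge0// ?divr_ge0 ?mulr_ge0 ?sqr_ge0// ltW.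
have NB : Num.sqrt N * Num.sqrt v <= 2 * B.
  rewrite -sqrtrM ?(ltW N0)// -(@ler_pXn2r _ 2)// ?nnegrE ?mulr_ge0 ?sqrtr_ge0//.
  rewrite exprMn -BE sqr_sqrtr ?mulr_ge0 ?(ltW N0) ?(ltW v0)//.
  by apply: (@le_trans _ _ (4 * (v * N1))); [nra|lra].
have t3 : e * B <= B2 / 8 * (D / 2 * (m ^+ 2 / Num.sqrt N)).
  have -> : B2 / 8 * (D / 2 * (m ^+ 2 / Num.sqrt N)) = (m ^+ 2 * B) * (B * D / (16 * Num.sqrt N)).
    by rewrite BE; field; rewrite gt_eqF.
  have -> : e * B = (m ^+ 2 * B) * A by rewrite eE; ring.
  rewrite ler_wpM2l ?mulr_ge0 ?(ltW m0) ?(ltW B0)//.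
  rewrite ler_pdivlMr ?mulr_gt0//.
  apply: (@le_trans _ _ (B * (32 * A / Num.sqrt v))); last by rewrite ler_wpM2l// ltW.
  have -> : B * (32 * A / Num.sqrt v) = 16 * A * (2 * B / Num.sqrt v) by ring.
  have -> : A * (16 * Num.sqrt N) = 16 * A * Num.sqrt N by ring.
  by rewrite ler_wpM2l ?mulr_ge0 ?(ltW A0)// ler_pdivlMr.
have : B2 / 8 * P <= B2 / 8 * (D * (m ^+ 2 / Num.sqrt N)) by lra.
by rewrite ler_pM2l// divr_gt0.
Qed.

(** The first half of a block, of length [N1], provides the variance in
    [conc_step]; the rest, of length [N'], is the sub-block for the induction,
    up to margins of a few [m]. *)
Lemma sub_block (a m N n n0 : nat) : (0 < m)%N -> (24 * m < N)%N ->
  (3 * n0 <= N)%N -> (N <= n)%N ->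
  let N1 := (N %/ 2)%N in let b1 := (a + 2 * m + N1)%N in
  let N' := (N - N1 - 6 * m)%N in
  [/\ (N <= 3 * N1)%N, (n0 <= N1 <= n)%N, (N' < N)%N, (0 < N' <= n)%N &
      (N <= 4 * N')%N] /\
  [/\ (b1 + 3 * m + N' = a + N - m)%N, (b1 - (a + 2 * m) = N1)%N,
      (a + 2 * m <= b1)%N & (b1 + 4 * m <= a + N)%N].
Proof.
move=> m0 mN nN Nn /=; have : (N <= 2 * (N %/ 2) + 1)%N /\ (2 * (N %/ 2) <= N)%N by lia.
by move: (N %/ 2)%N => N1 ?; split; split; lia.
Qed.

Section ConcentrationBound.
Context (R : realType) (mu : probability (seqsp R) R) (nu : probability R R).
Hypothesis mu_iid : iid_law mu nu.
Variables (xi : nat -> seqsp R -> R) (m : nat) (M : R).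
Hypothesis m_gt0 : (0 < m)%N.
Hypothesis M_ge1 : 1 <= M.
Hypothesis xi_meas : forall j, measurable_fun setT (xi j).
Hypothesis xi_dep : forall j, dep (fun i => j <= i <= j + m)%N (xi j).
Hypothesis xi_int : forall j, Int mu (fun u => `|xi j u| ^+ 3).
Hypothesis xi_mom : forall j, Ex mu (fun u => `|xi j u| ^+ 3) <= M.
Hypothesis xi_mean : forall j, Ex mu (xi j) = 0.

Variables (v : R) (n0 n : nat).
Hypothesis v_gt0 : 0 < v.
Hypothesis xi_var : forall a N, (n0 <= N <= n)%N ->
  v * N%:R <= Ex mu (fun u => block_sum xi a (a + N) u * block_sum xi a (a + N) u).

Local Notation E := (Ex mu).
Local Notation T := (block_sum xi).
Local Notation D := (conc_const v M n0).
Local Notation A := (conc_width v M).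

(** Cauchy-Schwarz, by optimising [s] in [2 |t| <= s + t ^+ 2 / s]. *)
Lemma Ex_abs_block_sum a b : E (fun u => `|T a b u|) <=
  Num.sqrt (E (fun u => T a b u * T a b u)).
Proof.
have IT := Int_block_sum xi_meas xi_int a b; have ITT := Int_block_sumM xi_meas xi_int a b a b.
set B2 := E (fun u => T a b u * T a b u); have B20 : 0 <= B2 by apply: Ex_ge0 => u; rewrite -expr2 sqr_ge0.
have H (s : R) : 0 < s -> E (fun u => `|T a b u|) <= (s + B2 / s) / 2.
  move=> s0; have -> : (s + B2 / s) / 2 = E (fun u => s / 2 + (2 * s)^-1 * (T a b u * T a b u)).
    rewrite ExD; [|exact: Int_cst|exact: IntZ].
    rewrite Ex_cst ExZ//.
    by rewrite -/B2; field; rewrite gt_eqF.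
  apply: Ex_le => [||u]; [exact: Int_abs|by apply: IntD; [exact: Int_cst|exact: IntZ]|].
  rewrite -expr2 -real_normK ?num_real//; move: `|T a b u| => t.
  rewrite -subr_ge0; have -> : s / 2 + (2 * s)^-1 * t ^+ 2 - t = (s - t) ^+ 2 / (2 * s).
    by field; rewrite gt_eqF.
  by rewrite divr_ge0 ?sqr_ge0// mulr_ge0// ltW.
have [B2p|] := ltP 0 B2.
  have s0 : 0 < Num.sqrt B2 by rewrite sqrtr_gt0.
  apply: le_trans (H _ s0) _; rewrite -{2}(sqr_sqrtr B20) expr2 mulfK ?gt_eqF//.
  by lra.
move=> B2n; have B2E : B2 = 0 by apply/eqP; rewrite eq_le B2n.
rewrite B2E sqrtr0; apply/ler_addgt0Pr => x x0; rewrite add0r.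
by apply: le_trans (H x x0) _; rewrite B2E mul0r addr0; lra.
Qed.

Lemma conc_width_gt0 : 0 < A.
Proof.
have M0 : 0 < M by apply: lt_le_trans M_ge1.
by rewrite /conc_width divr_gt0// mulr_gt0 ?exprn_gt0// mulr_gt0 ?exprn_gt0.
Qed.

(** Strong induction on the length.  A short block is covered by the size of the
    constant; on a long one [conc_step] turns the bound for half of the block
    into a bound with half the constant plus a term of the right order. *)
Theorem concentration N a : (0 < N <= n)%N ->
  conc mu xi m a (a + N) (A * m%:R ^+ 2) (D * (m%:R ^+ 2 / Num.sqrt N%:R)).
Proof.
elim/ltn_ind: N a => N IH a /andP[N0 Nn].
have A0 := conc_width_gt0; have M1 := M_ge1; have v0 := v_gt0.
have m1 : 1 <= m%:R :> R by rewrite ler1n.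
have m20 : 0 < m%:R ^+ 2 :> R by rewrite exprn_gt0// ltr0n.
have NR0 : 0 < N%:R :> R by rewrite ltr0n.
have sN0 : 0 < Num.sqrt N%:R :> R by rewrite sqrtr_gt0.
have sv0 : 0 < Num.sqrt v by rewrite sqrtr_gt0.
have Mv0 : 0 <= 48 * M / v by rewrite divr_ge0 ?(ltW v_gt0)// mulr_ge0//; lra.
have Av0 : 0 <= 32 * A / Num.sqrt v by rewrite divr_ge0 ?(ltW sv0)// mulr_ge0// ltW.
have n0R : 0 <= n0%:R :> R by [].
have DE : D = 24 + 3 * n0%:R + 48 * M / v + 32 * A / Num.sqrt v by [].
have D1 : 24 <= D by lra.
have DA : 32 * A / Num.sqrt v <= D by lra.
have D2 : 24 + 3 * n0%:R + 48 * M / v <= D ^+ 2.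
  apply: (@le_trans _ _ D); first by lra.
  by rewrite -[X in X <= _]expr1 ler_weXn2l//; lra.
move=> psi mpsi dpsi x.
(* a bound above 1 is trivial; this covers all the lengths not large against
   [m] and [n0] *)
have [triv|] := leP 1 (D * (m%:R ^+ 2 / Num.sqrt N%:R)).
  apply: le_trans triv; apply: fine_prob_le1.
  by apply: measurable_itvE; apply: measurable_funD => //; exact: measurable_block_sum.
rewrite mulrA ltr_pdivrMr// mul1r => big.
have bigN : D ^+ 2 * m%:R ^+ 2 < N%:R.
  have : (D * m%:R ^+ 2) ^+ 2 < N%:R.
    rewrite -(@sqr_sqrtr _ N%:R)// ltr_pXn2r// ?nnegrE ?sqrtr_ge0//.
    by rewrite mulr_ge0 ?(ltW m20)//; lra.
  apply: le_lt_trans; rewrite exprMn ler_wpM2l ?sqr_ge0//.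
  by rewrite -[X in X <= _]mul1r [X in _ <= X]expr2 ler_wpM2r ?(ltW m20)// expr_ge1.
have bigN' : (24 + 3 * n0%:R + 48 * M / v) * m%:R ^+ 2 < N%:R.
  by apply: le_lt_trans bigN; rewrite ler_wpM2r// ltW.
have mm2 : m%:R <= m%:R ^+ 2 :> R by rewrite -[X in X <= _]expr1 ler_weXn2l.
have m24 : (24 * m < N)%N.
  rewrite -(ltr_nat R) natrM; apply: le_lt_trans bigN'; nra.
have n03 : (3 * n0 <= N)%N.
  by rewrite -(ler_nat R) natrM; apply: le_trans (ltW bigN'); nra.
have vN : 48 * M * m%:R ^+ 2 <= v * N%:R.
  rewrite [v * _]mulrC -ler_pdivrMr//; apply: le_trans (ltW bigN').
  have -> : (48 * M * m%:R ^+ 2) / v = 48 * M / v * m%:R ^+ 2 by ring.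
  by rewrite ler_wpM2r ?(ltW m20)//; lra.
pose N1 := (N %/ 2)%N.
pose b1 := (a + 2 * m + N1)%N.
pose N' := (N - N1 - 6 * m)%N.
have [[N13 N1n N'lt N'0 N'4] [bE dN1 le2 le3]] :=
  @sub_block a m N n n0 m_gt0 m24 n03 Nn.
have cq := IH N' N'lt (b1 + 3 * m)%N N'0.
rewrite bE in cq.
have b1E : (b1 = a + 2 * m + N1)%N by [].
have le1 : (a + 2 * m <= a + 2 * m)%N by [].
have e0 : 0 < A * m%:R ^+ 2 by rewrite mulr_gt0.
have H := @conc_step R mu nu mu_iid xi m M m_gt0 M_ge1 xi_meas xi_dep xi_int xi_mom
  xi_mean a (a + N) (a + 2 * m) b1 _ _ le1 le2 le3 e0 cq psi mpsi dpsi x.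
rewrite dN1 in H.
rewrite -mulrA; apply: (conc_recursion v_gt0 M_ge1 m1 NR0 _ (erefl _) _ (erefl _) _ _ _ _ _ _ H).
- by rewrite fine_ge0.
- exact: DA.
- have D0 : 0 <= D by lra.
  rewrite -mulrA [X in _ <= X](_ : _ = D * (m%:R ^+ 2 * (2 / Num.sqrt N%:R))); last by ring.
  rewrite ler_wpM2l// ler_wpM2l ?(ltW m20)//.
  have sN'0 : 0 < Num.sqrt N'%:R :> R by rewrite sqrtr_gt0 ltr0n; case/andP: N'0.
  rewrite ler_pdivlMr// mulrC ler_pdivrMr//.
  rewrite -(@ler_pXn2r _ 2)// ?nnegrE ?mulr_ge0 ?sqrtr_ge0//.
  rewrite exprMn !sqr_sqrtr// -natrX -natrM ler_nat.
  exact: N'4.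
- by [].
- rewrite -natrM ler_nat; apply: leq_trans N13 _.
  by rewrite leq_mul2r orbT.
- by rewrite b1E; exact: xi_var.
- apply: (@le_trans _ _ (v * N1%:R)); last by rewrite b1E; exact: xi_var.
  have : (N%:R <= 3 * N1%:R :> R) by rewrite -natrM ler_nat.
  by move=> h; nra.
- exact: Ex_abs_block_sum.
Qed.

End ConcentrationBound.

(** * The standard normal density *)

Section Gaussian.
Context (R : realType).
Implicit Types x y z t : R.
Local Notation leb := (@lebesgue_measure R).

Definition gpdf x : R := normal_pdf 0 1 x.

Lemma gpdfE x : gpdf x = normal_peak 1 * expR (- (x ^+ 2 / 2)).
Proof.
by rewrite /gpdf normal_pdfE ?oner_eq0// /normal_fun subr0 expr1n mulNr.
Qed.

Lemma gpdf_gt0 x : 0 < gpdf x.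
Proof. by rewrite gpdfE mulr_gt0 ?expR_gt0// normal_peak_gt0 ?oner_eq0. Qed.

Lemma gpdf_ge0 x : 0 <= gpdf x.
Proof. exact/ltW/gpdf_gt0. Qed.

Lemma gpdfN x : gpdf (- x) = gpdf x.
Proof. by rewrite !gpdfE sqrrN. Qed.

Lemma gpdf_le1 x : gpdf x <= 1.
Proof.
apply: le_trans (normal_pdf_ub _ _ (oner_neq0 _)) _.
have p1 : 1 <= 1 ^+ 2 * pi *+ 2 :> R.
  by rewrite expr1n mul1r mulr2n; have := pi_ge2 R; lra.
have p0 : 0 <= 1 ^+ 2 * pi *+ 2 :> R by apply: le_trans p1.
have s1 : 1 <= Num.sqrt (1 ^+ 2 * pi *+ 2) :> R by rewrite -[X in X <= _]sqrtr1 ler_sqrt.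
by rewrite /normal_peak invf_le1//; exact: lt_le_trans s1.
Qed.

Lemma gpdf_anti x y : 0 <= x -> x <= y -> gpdf y <= gpdf x.
Proof.
move=> x0 xy; rewrite !gpdfE ler_wpM2l ?normal_peak_ge0// ler_expR lerN2.
by rewrite ler_pM2r// ler_sqr// nnegrE// (le_trans x0).
Qed.

Lemma is_derive_gpdf x : is_derive x (1 : R) gpdf (- x * gpdf x).
Proof.
have -> : gpdf = fun x => normal_peak 1 * expR (- 2^-1 * (x * x)).
  by apply/funext => t; rewrite gpdfE; congr (_ * expR _); rewrite expr2; ring.
apply: is_derive_eq.
by rewrite /GRing.scale/=; field.
Qed.

Lemma integrable_gpdf : leb.-integrable setT (EFin \o gpdf).
Proof. exact: integrable_normal_pdf. Qed.

Lemma continuous_gpdf : continuous gpdf.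
Proof.
move=> x; apply/differentiable_continuous/derivable1_diffP.
by case: (is_derive_gpdf x).
Qed.

Lemma cvg_gpdf : gpdf x @[x --> +oo] --> (0 : R).
Proof.
have -> : gpdf = fun x => normal_peak 1 * expR (- (x ^+ 2 / 2)).
  by apply/funext => t; exact: gpdfE.
rewrite -(mulr0 (normal_peak 1)); apply: cvgMr.
apply: (cvg_comp (fun x : R => x ^+ 2 / 2) (fun x => expR (- x))); last exact: cvgr_expR.
apply: gt0_cvgMly => //; exact: cvgr_expr2.
Qed.

Definition upper_tail x : R := \int[leb]_(t in `[x, +oo[) gpdf t.

Lemma gpdf_int_sub (A : set R) : measurable A -> leb.-integrable A (EFin \o gpdf).
Proof.
move=> mA; apply: integrableS integrable_gpdf => //.
Qed.

(** [t * gpdf t] is minus the derivative of [gpdf]. *)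
Lemma integral_mul_gpdf x : 0 <= x ->
  (\int[leb]_(t in `[x, +oo[) (t * gpdf t)%:E = (gpdf x)%:E)%E.
Proof.
move=> x0.
have dF (t : R) : is_derive t (1 : R) (fun t => - gpdf t) (t * gpdf t).
  have d := is_derive_gpdf t; apply: is_derive_eq.
  by rewrite mulNr opprK.
rewrite (@ge0_continuous_FTC2y _ _ (fun t => - gpdf t) x 0).
- by rewrite sub0e -EFinN opprK.
- by move=> t xt; rewrite mulr_ge0 ?gpdf_ge0// (le_trans x0).
- apply: continuous_subspaceT => t; apply: cvgM; first exact: cvg_id.
  exact: continuous_gpdf.
- by rewrite -oppr0; apply: cvgN; exact: cvg_gpdf.
- by move=> t _; case: (dF t).
- apply: cvg_at_right_filter; apply: cvgN; exact: continuous_gpdf.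
- by move=> t _; rewrite derive1E; case: (dF t).
Qed.

Lemma upper_tail_mul x : 0 <= x -> x * upper_tail x <= gpdf x.
Proof.
move=> x0; rewrite /upper_tail -RintegralZl//; last exact: gpdf_int_sub.
have -> : gpdf x = \int[leb]_(t in `[x, +oo[) (t * gpdf t).
  by rewrite /Rintegral integral_mul_gpdf.
apply: le_Rintegral => //.
- apply: (@eq_integrable _ _ _ leb _ _ (fun t => x%:E * (EFin \o gpdf) t)%E) => //.
  by apply: integrableZl => //; exact: gpdf_int_sub.
- apply/integrableP; split.
    apply/measurable_EFinP; apply: measurable_funTS; apply: measurable_funM => //.
    exact: measurable_normal_pdf.
  apply: le_lt_trans (ltry (gpdf x)); rewrite -(integral_mul_gpdf x0) le_eqVlt.
  apply/orP; left; apply/eqP; apply: eq_integral => t.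
  rewrite inE/= in_itv/= andbT => xt.
  by rewrite ger0_norm// mulr_ge0 ?gpdf_ge0// (le_trans x0).
- move=> t; rewrite /= in_itv/= andbT => xt.
  by rewrite ler_wpM2r// gpdf_ge0.
Qed.

Lemma upper_tail_le1 x : upper_tail x <= 1.
Proof.
have -> : 1 = \int[leb]_t gpdf t by rewrite /Rintegral integral_normal_pdf.
rewrite /Rintegral fine_le//.
- by apply: integrable_fin_num => //; exact: gpdf_int_sub.
- by apply: integrable_fin_num => //; exact: integrable_gpdf.
apply: ge0_subset_integral => //.
- by apply/measurable_EFinP; exact: measurable_normal_pdf.
- by move=> t _; rewrite lee_fin gpdf_ge0.
Qed.

Lemma upper_tail_ge0 x : 0 <= upper_tail x.
Proof. by apply: Rintegral_ge0 => t _; rewrite gpdf_ge0. Qed.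

Definition stein_const : R := 1 + (gpdf 1)^-1.

(** Beyond 1 this is the classical bound of the tail by density over abscissa;
    before 1 the density is bounded below by its value at 1. *)
Lemma upper_tail_const x : 0 <= x -> upper_tail x <= stein_const * gpdf x.
Proof.
move=> x0; have g1 := gpdf_gt0 1; have gx := gpdf_gt0 x.
have [x1|x1] := leP x 1.
  apply: le_trans (upper_tail_le1 x) _; rewrite mulrDl mul1r.
  apply: (@le_trans _ _ ((gpdf 1)^-1 * gpdf x)); last by rewrite lerDr ltW.
  by rewrite mulrC ler_pdivlMr// mul1r gpdf_anti.
apply: (@le_trans _ _ (x * upper_tail x)).
  by rewrite ler_peMl ?upper_tail_ge0// ltW.
apply: le_trans (upper_tail_mul x0) _.
by rewrite -[X in X <= _]mul1r ler_wpM2r ?(ltW gx)// lerDl invr_ge0 ltW.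
Qed.

Lemma lower_tail x : \int[leb]_(t in `]-oo, - x]) gpdf t = upper_tail x.
Proof.
rewrite /upper_tail /Rintegral ge0_integration_by_substitutionNy//.
- by congr fine; apply: eq_integral => t _; rewrite /= gpdfN.
- by apply: continuous_subspaceT; exact: continuous_gpdf.
- by move=> t _; rewrite gpdf_ge0.
Qed.

End Gaussian.

(** * Stein's equation *)

Section SteinSolution.
Context (R : realType).
Local Notation leb := (@lebesgue_measure R).
Variable h : R -> R.
Hypotheses (h_cont : continuous h) (h01 : forall x, 0 <= h x <= 1).
Implicit Types x y z t : R.

Definition gmean : R := \int[leb]_t (h t * gpdf t).

Let mh : measurable_fun setT h.
Proof. exact: continuous_measurable_fun. Qed.

Let mg : measurable_fun setT (@gpdf R).
Proof. exact: measurable_normal_pdf. Qed.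

Lemma dominated_gpdf (k : R -> R) (A : set R) : measurable A ->
  measurable_fun setT k ->
  (forall t, `|k t| <= gpdf t) -> leb.-integrable A (EFin \o k).
Proof.
move=> mA mk kg; apply: (@le_integrable _ _ _ leb A mA (EFin \o k) (EFin \o @gpdf R)) => //; last exact: gpdf_int_sub.
  by apply/measurable_EFinP; exact: measurable_funTS.
by move=> t _ /=; rewrite lee_fin (ger0_norm (gpdf_ge0 _)).
Qed.

Lemma le_gpdf_Rintegral (k : R -> R) (A : set R) : measurable A ->
  measurable_fun setT k -> (forall t, `|k t| <= gpdf t) ->
  `|\int[leb]_(t in A) k t| <= \int[leb]_(t in A) gpdf t.
Proof.
move=> mA mk kg; have Ik := dominated_gpdf mA mk kg.
apply: (@le_trans _ _ (\int[leb]_(t in A) `|k t|)).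
  exact: le_normr_Rintegral.
apply: le_Rintegral => //; last exact: gpdf_int_sub.
apply: dominated_gpdf => //; first exact: measurableT_comp.
by move=> t; rewrite normr_id.
Qed.

Lemma total_gpdf : \int[leb]_t gpdf t = 1 :> R.
Proof. by rewrite /Rintegral integral_normal_pdf. Qed.

Let hg_le t : `|h t * gpdf t| <= gpdf t.
Proof.
have /andP[h0 h1] := h01 t.
by rewrite ger0_norm ?mulr_ge0 ?gpdf_ge0// ler_piMl ?gpdf_ge0.
Qed.

Let mhg : measurable_fun setT (fun t => h t * gpdf t).
Proof. exact: measurable_funM. Qed.

Lemma gmean01 : 0 <= gmean <= 1.
Proof.
apply/andP; split.
  by apply: Rintegral_ge0 => t _; have /andP[? ?] := h01 t; rewrite mulr_ge0 ?gpdf_ge0.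
apply: le_trans (ler_norm _) _; rewrite -total_gpdf.
exact: le_gpdf_Rintegral.
Qed.

Let k t := (h t - gmean) * gpdf t.

Let mk : measurable_fun setT k.
Proof. by apply: measurable_funM => //; exact: measurable_funB. Qed.

Let k_le t : `|k t| <= gpdf t.
Proof.
rewrite normrM (ger0_norm (gpdf_ge0 _)) ler_piMl ?gpdf_ge0//.
by have := h01 t; have := gmean01; rewrite ler_norml; lra.
Qed.

Let total_k : \int[leb]_t k t = 0.
Proof.
have -> : k = fun t => h t * gpdf t - gmean * gpdf t.
  by apply/funext => t; rewrite /k mulrBl.
rewrite RintegralB//.
- by rewrite RintegralZl//; [rewrite total_gpdf mulr1 subrr|exact: integrable_gpdf].
- exact: dominated_gpdf.
- apply: dominated_gpdf => //; first exact: measurable_funM.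
  move=> t; have /andP[g0 g1] := gmean01.
  by rewrite ger0_norm ?mulr_ge0 ?gpdf_ge0// ler_piMl ?gpdf_ge0.
Qed.

Let K x := \int[leb]_(t in `]-oo, x]) k t.

(* the total mass of [k] vanishes, so the integral may be taken from either
   side, whichever is the lighter tail *)
Let K_le x : `|K x| <= upper_tail `|x|.
Proof.
have [x0|x0] := leP x 0.
  rewrite (ler0_norm x0) -lower_tail opprK; exact: le_gpdf_Rintegral.
rewrite (gtr0_norm x0).
have IkT : leb.-integrable `]-oo, +oo[ (EFin \o k) by exact: dominated_gpdf.
have -> : K x = - \int[leb]_(t in `]x, +oo[) k t.
  rewrite -(Rintegral_itvB (a := -oo%O) (b := +oo%O))//.
  by rewrite set_itvNyy total_k sub0r opprK.
rewrite normrN; apply: le_trans (le_gpdf_Rintegral _ _ _) _ => //.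
by rewrite Rintegral_itv_obnd_cbnd//; exact: gpdf_int_sub.
Qed.

Let k_cont : continuous k.
Proof.
move=> t; apply: cvgM; last exact: continuous_gpdf.
by apply: cvgB; [exact: h_cont|exact: cvg_cst].
Qed.

Let K_derive x : is_derive x (1 : R) K (k x).
Proof.
have [] := @continuous_FTC1 _ k -oo%O x (x + 1) _ _ _ _.
- by rewrite ltrDl.
- exact: dominated_gpdf.
- by rewrite ltNyr.
- exact: k_cont.
by move=> d1 d2; apply: DeriveDef => //; rewrite -derive1E.
Qed.

(** The bounded solution [f] of Stein's equation [f' x - x * f x = h x - gmean];
    the equation is built into the formula for its derivative. *)
Definition stein_sol x := \int[leb]_(t in `]-oo, x]) ((h t - gmean) * gpdf t) / gpdf x.
Definition stein_sol1 x := x * stein_sol x + (h x - gmean).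

Lemma is_derive_stein_sol x : is_derive x (1 : R) stein_sol (stein_sol1 x).
Proof.
have gx := gpdf_gt0 x; have gx0 : gpdf x != 0 by rewrite gt_eqF.
have dK := K_derive x; have dg := is_derive_gpdf x.
have dV := is_deriveV gx0 dg.
have -> : stein_sol = K * (fun y => (gpdf y)^-1) by [].
apply: is_derive_eq.
rewrite /stein_sol1 /stein_sol -/(K x) /k /GRing.scale/=.
by field.
Qed.

Lemma stein_sol_bd x : `|stein_sol x| <= stein_const R.
Proof.
have gx := gpdf_gt0 x.
rewrite normrM normfV (gtr0_norm gx) ler_pdivrMr//.
apply: le_trans (K_le x) _; apply: le_trans (upper_tail_const (normr_ge0 x)) _.
by rewrite ler_wpM2l// ?addr_ge0 ?invr_ge0 ?gpdf_ge0//; case: (ger0P x) => _; rewrite ?gpdfN.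
Qed.

Lemma stein_sol_mul_bd x : `|x * stein_sol x| <= 1.
Proof.
have gx := gpdf_gt0 x.
rewrite normrM normrM normfV (gtr0_norm gx) mulrA ler_pdivrMr// mul1r.
apply: (@le_trans _ _ (`|x| * upper_tail `|x|)); first by rewrite ler_wpM2l// K_le.
apply: le_trans (upper_tail_mul (normr_ge0 x)) _.
by case: (ger0P x) => _; rewrite ?gpdfN.
Qed.

Lemma stein_sol1_bd x : `|stein_sol1 x| <= 2.
Proof.
have := stein_sol_mul_bd x; have := h01 x; have := gmean01.
by rewrite /stein_sol1 !ler_norml; move: (x * _) => y; lra.
Qed.

Lemma stein_const_ge1 : 1 <= stein_const R.
Proof. by rewrite lerDl invr_ge0 gpdf_ge0. Qed.

(** The modulus of continuity of [x * stein_sol x]; the minimum with the trivial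
    bound 2 keeps later moment requirements at order three. *)
Lemma stein_sol1_var x y : `|stein_sol1 x - stein_sol1 y| <=
  `|h x - h y| + 2 * Num.min 1 (`|x - y| * (stein_const R + `|y|)).
Proof.
have -> : stein_sol1 x - stein_sol1 y =
   (h x - h y) + (x * stein_sol x - y * stein_sol y) by rewrite /stein_sol1; ring.
apply: le_trans (ler_normD _ _) _; rewrite lerD2l.
have [|_] := leP 1 (`|x - y| * (stein_const R + `|y|)).
  move=> _; apply: le_trans (ler_normB _ _) _.
  by have := stein_sol_mul_bd x; have := stein_sol_mul_bd y; lra.
have -> : x * stein_sol x - y * stein_sol y =
   (x - y) * stein_sol x + y * (stein_sol x - stein_sol y) by ring.
apply: le_trans (ler_normD _ _) _.
rewrite (normrM (x - y)) (normrM y).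
have mv : `|stein_sol x - stein_sol y| <= `|x - y| * 2.
  have := @mean_value _ stein_sol stein_sol1 y x 0 2 is_derive_stein_sol.
  by rewrite mulr0 subr0; apply => t _; rewrite subr0 stein_sol1_bd.
have h1 : `|x - y| * `|stein_sol x| <= `|x - y| * stein_const R.
  by rewrite ler_wpM2l// stein_sol_bd.
have h2 : `|y| * `|stein_sol x - stein_sol y| <= `|y| * (`|x - y| * 2).
  by rewrite ler_wpM2l.
have c0 : 0 <= `|x - y| * stein_const R.
  by rewrite mulr_ge0//; have := stein_const_ge1; lra.
by rewrite mulrDr; move: h1 h2 c0; nra.
Qed.

Lemma measurable_stein_sol1 : measurable_fun setT stein_sol1.
Proof.
apply: measurable_funD; last exact: measurable_funB.
apply: measurable_funM => //; apply: continuous_measurable_fun => t.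
by apply/differentiable_continuous/derivable1_diffP; case: (is_derive_stein_sol t).
Qed.

End SteinSolution.

(** * Ramps and the normal distribution function *)

Section Ramp.
Context (R : realType).
Local Notation leb := (@lebesgue_measure R).
Implicit Types x y z t e : R.

(** A Lipschitz step from 1 down to 0 over the unit interval, in one formula. *)
Definition ramp x := (1 - `|x| + `|x - 1|) / 2.

Lemma ramp01 x : 0 <= ramp x <= 1.
Proof.
by rewrite /ramp; have [] := ger0P x; have [] := ger0P (x - 1); lra.
Qed.

Lemma ramp_left x : x <= 0 -> ramp x = 1.
Proof.
by rewrite /ramp; have [] := ger0P x; have [] := ger0P (x - 1); lra.
Qed.

Lemma ramp_right x : 1 <= x -> ramp x = 0.
Proof.
by rewrite /ramp; have [] := ger0P x; have [] := ger0P (x - 1); lra.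
Qed.

Lemma ramp_lip x y : `|ramp x - ramp y| <= `|x - y|.
Proof.
have H c : `| `|x + c| - `|y + c| | <= `|x - y|.
  by rewrite (le_trans (ler_dist_dist _ _))// opprD addrACA subrr addr0.
have := H (- 1); have := H 0; rewrite !addr0 /ramp.
rewrite !ler_norml; move: `|x - 1| `|y - 1| `|x| `|y| => *.
by lra.
Qed.

Definition ramp_at z e x := ramp ((x - z) / e).

Lemma ramp_at01 z e x : 0 <= ramp_at z e x <= 1.
Proof. exact: ramp01. Qed.

Lemma continuous_ramp_at z e : continuous (ramp_at z e).
Proof.
have cf : continuous (fun x : R => (x - z) / e).
  move=> x; apply: cvgM; last exact: cvg_cst.
  by apply: cvgB; [exact: cvg_id|exact: cvg_cst].
move=> x; apply: cvgM; last exact: cvg_cst.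
apply: cvgD.
  apply: cvgB; first exact: cvg_cst.
  by apply: cvg_norm; exact: cf.
apply: cvg_norm; apply: cvgB; last exact: cvg_cst.
exact: cf.
Qed.

Lemma ramp_at_osc z e s t y : 0 < e -> 0 <= s -> `|t - y| <= s ->
  `|ramp_at z e t - ramp_at z e y| <= osc e s (y - z).
Proof.
move=> e0 s0 ty; apply: osc_bound => //.
- exact: ramp_lip.
- exact: ramp01.
- by move=> u u2; rewrite !ramp_right//; lra.
- by move=> u u2; rewrite !ramp_left//; lra.
Qed.

Lemma PhiE x : Phi x = \int[leb]_(t in `]-oo, x]) gpdf t.
Proof. by []. Qed.

Lemma Phi01 x : 0 <= Phi x <= 1.
Proof.
rewrite PhiE; apply/andP; split; first by apply: Rintegral_ge0 => t _; exact: gpdf_ge0.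
by have := lower_tail (- x); rewrite opprK => ->; exact: upper_tail_le1.
Qed.

Lemma Phi_lip x e : 0 <= e -> Phi (x + e) <= Phi x + e.
Proof.
move=> e0; rewrite -lerBlDl !PhiE Rintegral_itvB//; last 2 first.
- exact: gpdf_int_sub.
- by rewrite bnd_simp lerDl.
apply: (@le_trans _ _ (\int[leb]_(t in `]x, (x + e)]) (1 : R))).
  apply: le_Rintegral => //.
  - exact: gpdf_int_sub.
  - apply: measurable_bounded_integrable => //.
      by rewrite /= lebesgue_measure_itv/=; case: ifP => _; rewrite ?ltry// -EFinD ltry.
    exact: bounded_cst.
  - by move=> t _; exact: gpdf_le1.
have mE : leb `]x, (x + e)]%classic = e%:E.
  rewrite lebesgue_measure_itv/= lte_fin ltrDl.
  have [_|e_le0] := ltP 0 e; first by rewrite -EFinB addrAC subrr add0r.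
  by congr (_%:E); apply/eqP; rewrite eq_le e0 e_le0.
by rewrite -[X in _ <= X]/(fine e%:E) -mE Rintegral_cst// mul1r; exact: lexx.
Qed.

Lemma integrable_gpdf_patch (z : R) :
  leb.-integrable setT (EFin \o ((@gpdf R) \_ `]-oo, z])).
Proof.
apply: dominated_gpdf => //.
  apply/(measurable_restrictT _ _).1 => //; apply: measurable_funTS.
  exact: measurable_normal_pdf.
move=> t; rewrite patchE; case: ifP => _; rewrite ?normr0 ?gpdf_ge0//.
by rewrite (ger0_norm (gpdf_ge0 t)).
Qed.

Lemma gmean_ramp_le z e : 0 < e -> gmean (ramp_at z e) <= Phi (z + e).
Proof.
move=> e0; rewrite PhiE [X in _ <= X]Rintegral_mkcond /gmean.
have mr : measurable_fun setT (ramp_at z e).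
  by apply: continuous_measurable_fun; exact: continuous_ramp_at.
apply: le_Rintegral => //.
- apply: dominated_gpdf => //.
    by apply: measurable_funM => //; exact: measurable_normal_pdf.
  move=> t; have /andP[h0 h1] := ramp_at01 z e t.
  by rewrite normrM (ger0_norm h0) (ger0_norm (gpdf_ge0 t)) ler_piMl ?gpdf_ge0.
- exact: integrable_gpdf_patch.
move=> t _; rewrite patchE; case: ifPn => [_|].
  by have /andP[_ h1] := ramp_at01 z e t; rewrite ler_piMl ?gpdf_ge0.
rewrite notin_setE/= in_itv/= => /negP; rewrite -ltNge => tz.
by rewrite /ramp_at ramp_right ?mul0r// ler_pdivlMr//; lra.
Qed.

Lemma gmean_ramp_ge z e : 0 < e -> Phi z <= gmean (ramp_at z e).
Proof.
move=> e0; rewrite PhiE Rintegral_mkcond /gmean.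
have mr : measurable_fun setT (ramp_at z e).
  by apply: continuous_measurable_fun; exact: continuous_ramp_at.
apply: le_Rintegral => //.
- exact: integrable_gpdf_patch.
- apply: dominated_gpdf => //.
    by apply: measurable_funM => //; exact: measurable_normal_pdf.
  move=> t; have /andP[h0 h1] := ramp_at01 z e t.
  by rewrite normrM (ger0_norm h0) (ger0_norm (gpdf_ge0 t)) ler_piMl ?gpdf_ge0.
move=> t _; rewrite patchE; case: ifPn => [|_].
  rewrite inE/= in_itv/= => tz.
  by rewrite /ramp_at ramp_left ?mul1r// ler_pdivrMr// mul0r; lra.
by have /andP[h0 _] := ramp_at01 z e t; rewrite mulr_ge0 ?gpdf_ge0.
Qed.

End Ramp.

(** * The Berry-Esseen bound for m-dependent summands *)

Lemma min1_mul (R : realType) (a b : R) : 0 <= a -> 0 <= b ->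
  Num.min 1 (a * b) <= (a + b) / 2.
Proof.
move=> a0 b0; have ab0 : 0 <= a * b by exact: mulr_ge0.
have sq : a * b <= ((a + b) / 2) ^+ 2.
  by rewrite -subr_ge0 (_ : _ - _ = ((a - b) / 2) ^+ 2) ?sqr_ge0//; field.
have h0 : 0 <= (a + b) / 2 by rewrite divr_ge0// addr_ge0.
rewrite -(@ler_pXn2r _ 2)// ?nnegrE ?le_min ?ler01//; apply: le_trans sq.
by have [ab1|ab1] := leP 1 (a * b); rewrite ?expr1n// expr2; nra.
Qed.

(** The arithmetic of [drift_err], each expectation being a variable: [w], [n2],
    [n3] stand for local moments over windows of [k] or [l] terms and [fr] for
    the mean size of the sum away from the window. *)
Lemma drift_arith (R : realType) (B M C Y wD wn3 wn2 ED w n3 n2 fr k l x : R) :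
  0 < B -> 1 <= M -> 1 <= C ->
  wD <= B^-1 * (2 * (C + 2) * wn3 + 2 / B * (wn2 * fr)) ->
  ED <= B^-1 * (2 * (C + 2) * n3 + 2 / B * (n2 * fr)) ->
  0 <= fr -> fr <= Y * B -> k <= 5 * x -> l <= 7 * x -> 0 <= x ->
  w <= k * (2 * M) -> n2 <= k * (2 * M) -> n3 <= l * (2 * M) ->
  wn2 <= k * (k * M) -> wn3 <= l * (k * M) ->
  0 <= w -> 0 <= ED -> 0 <= n2 -> 0 <= wn2 -> 0 <= k -> 0 <= l ->
  wD + w * ED <= B^-1 * (x ^+ 2 * M ^+ 2 * (350 * (C + 2) + 250 * Y)).
Proof.
move=> B0 M1 C1 e1 e2 f0 fY l5 l7 x0 c0 c2 c3 d2 d3 p0 p1 p2 p3 k0 l0.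
have M0 : 0 <= M by lra.
have Bi : 0 <= B^-1 by rewrite invr_ge0 ltW.
have Y0 : 0 <= Y by rewrite -(pmulr_lge0 _ B0); exact: le_trans fY.
have xM : 0 <= x * M by exact: mulr_ge0.
have kM : k * M <= 5 * (x * M) by rewrite mulrA ler_wpM2r.
have lM : l * M <= 7 * (x * M) by rewrite mulrA ler_wpM2r.
have frB : fr / B <= Y by rewrite ler_pdivrMr.
have frB0 : 0 <= fr / B by rewrite divr_ge0// ltW.
have kk : k * (k * M) <= 25 * (x * (x * M)).
  have -> : 25 * (x * (x * M)) = (5 * x) * (5 * (x * M)) by ring.
  by rewrite ler_pM ?mulr_ge0.
have lk : l * (k * M) <= 35 * (x * (x * M)).
  have -> : 35 * (x * (x * M)) = (7 * x) * (5 * (x * M)) by ring.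
  by rewrite ler_pM ?mulr_ge0.
have h1 : 2 / B * (wn2 * fr) <= 2 * (25 * (x * (x * M))) * Y.
  have -> : 2 / B * (wn2 * fr) = 2 * wn2 * (fr / B) by ring.
  by rewrite ler_pM ?mulr_ge0// ler_wpM2l//; exact: le_trans d2 kk.
have h2 : 2 / B * (n2 * fr) <= 2 * (10 * (x * M)) * Y.
  have -> : 2 / B * (n2 * fr) = 2 * n2 * (fr / B) by ring.
  by rewrite ler_pM ?mulr_ge0// ler_wpM2l//; lra.
have C2 : 0 <= 2 * (C + 2) by lra.
have g1 : wD <= B^-1 * (2 * (C + 2) * (35 * (x * (x * M))) + 2 * (25 * (x * (x * M))) * Y).
  apply: le_trans e1 _; rewrite ler_wpM2l// lerD// ler_wpM2l//; exact: le_trans d3 lk.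
have g2 : ED <= B^-1 * (2 * (C + 2) * (14 * (x * M)) + 2 * (10 * (x * M)) * Y).
  by apply: le_trans e2 _; rewrite ler_wpM2l// lerD// ler_wpM2l//; lra.
have g3 : w * ED <= (10 * (x * M)) * (B^-1 * (2 * (C + 2) * (14 * (x * M)) + 2 * (10 * (x * M)) * Y)).
  by rewrite ler_pM//; lra.
apply: le_trans (lerD g1 g3) _.
have -> : B^-1 * (2 * (C + 2) * (35 * (x * (x * M))) + 2 * (25 * (x * (x * M))) * Y) +
  10 * (x * M) * (B^-1 * (2 * (C + 2) * (14 * (x * M)) + 2 * (10 * (x * M)) * Y)) =
  B^-1 * (x ^+ 2 * (M * (70 * (C + 2) + 50 * Y) + M ^+ 2 * (280 * (C + 2) + 200 * Y))) by ring.
rewrite ler_wpM2l// -mulrA ler_wpM2l ?sqr_ge0//.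
have MM : M <= M ^+ 2 by rewrite -[X in X <= _]expr1 ler_weXn2l.
have c70 : 0 <= 70 * (C + 2) + 50 * Y by lra.
have := ler_wpM2r c70 MM; lra.
Qed.

Section BerryEsseen.
Context (R : realType) (mu : probability (seqsp R) R) (nu : probability R R).
Hypothesis mu_iid : iid_law mu nu.
Variables (xi : nat -> seqsp R -> R) (m : nat) (M : R).
Hypothesis m_gt0 : (0 < m)%N.
Hypothesis M_ge1 : 1 <= M.
Hypothesis xi_meas : forall j, measurable_fun setT (xi j).
Hypothesis xi_dep : forall j, dep (fun i => j <= i <= j + m)%N (xi j).
Hypothesis xi_int : forall j, Int mu (fun u => `|xi j u| ^+ 3).
Hypothesis xi_mom : forall j, Ex mu (fun u => `|xi j u| ^+ 3) <= M.
Hypothesis xi_mean : forall j, Ex mu (xi j) = 0.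

Variables (v : R) (n0 n : nat).
Hypothesis v_gt0 : 0 < v.
Hypothesis xi_var : forall a N, (n0 <= N <= n)%N ->
  v * N%:R <= Ex mu (fun u => block_sum xi a (a + N) u * block_sum xi a (a + N) u).

Local Notation E := (Ex mu).
Local Notation T := (block_sum xi).
Local Notation nbr := (nbr xi m 0 n).
Local Notation nbra := (nbra xi m 0 n).
Local Notation wgt := (weight xi m 0 n).
Local Notation D := (conc_const v M n0).
Local Notation A := (conc_width v M).
Local Notation Cst := (stein_const R).

Let e : R := A * m%:R ^+ 2.
Let q : R := 2 * (D * (m%:R ^+ 2 / Num.sqrt n%:R)).

Lemma conc_le (mm a b : nat) (w q1 q2 : R) : q1 <= q2 ->
  conc mu xi mm a b w q1 -> conc mu xi mm a b w q2.
Proof. by move=> q12 H psi mp dp x; apply: le_trans q12; exact: H. Qed.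

Lemma conc_const_ge0 : 0 <= D.
Proof.
have A0 := conc_width_gt0 M_ge1 v_gt0.
have M0 : 0 <= M by apply: le_trans M_ge1.
have h1 : 0 <= 48 * M / v by rewrite divr_ge0 ?mulr_ge0// ltW.
have h2 : 0 <= 32 * A / Num.sqrt v.
  by rewrite divr_ge0 ?sqrtr_ge0// mulr_ge0// ltW.
have h3 : 0 <= n0%:R :> R by [].
by rewrite /conc_const; lra.
Qed.

(** At least one side of the window around [j] is a block of length at least a
    quarter of the whole. *)
Lemma conc_beside j : (20 * m <= n)%N -> (j < n)%N -> exists c d,
  [/\ (m <= c)%N, (c + m <= d)%N, (d <= n)%N, conc mu xi m c (d - m) e q &
      forall k, zone m 2 j k -> ~~ (c <= k < d)%N].
Proof.
move=> mn jn; have D0 := conc_const_ge0.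
have key c N : (n <= 4 * N)%N -> (N <= n)%N -> conc mu xi m c (c + N) e q.
  move=> n4N Nn.
  have N0 : (0 < N <= n)%N by rewrite Nn andbT; move: m_gt0; lia.
  refine (conc_le _ (concentration mu_iid m_gt0 M_ge1 xi_meas xi_dep xi_int xi_mom
    xi_mean v_gt0 xi_var N0)).
  have n0' : (0 < n)%N by lia.
  rewrite /q [X in _ <= X]mulrCA; apply: ler_wpM2l => //.
  rewrite [X in _ <= X]mulrCA; apply: ler_wpM2l; first exact: exprn_ge0.
  have sN0 : 0 < Num.sqrt N%:R :> R by rewrite sqrtr_gt0 ltr0n; case/andP: N0.
  have sn0 : 0 < Num.sqrt n%:R :> R by rewrite sqrtr_gt0 ltr0n.
  rewrite ler_pdivlMr// mulrC ler_pdivrMr//.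
  rewrite -(@ler_pXn2r _ 2)// ?nnegrE ?mulr_ge0 ?sqrtr_ge0//.
  by rewrite exprMn !sqr_sqrtr// -natrX -natrM ler_nat.
(* [j] lies in one half; the block is taken in the other *)
have [jh|jh] := leqP (n %/ 2) j.
  exists m, (j - 2 * m)%N; split; try lia; last by move=> k; rewrite /zone; lia.
  have -> : (j - 2 * m - m = m + (j - 4 * m))%N by lia.
  by apply: key; lia.
exists (j + 3 * m).+1, n; split; try lia; last by move=> k; rewrite /zone; lia.
have -> : (n - m = (j + 3 * m).+1 + (n - m - (j + 3 * m).+1))%N by lia.
by apply: key; lia.
Qed.

Let psi0 : seqsp R -> R := fun=> 0.
Let S u := psi0 u + T 0 n u.

Let dpsi0 (I : pred nat) : dep I psi0. Proof. by []. Qed.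

Lemma osc_err j z : (20 * m <= n)%N -> (j < n)%N ->
  E (fun u => wgt j u * osc e (2 * nbra 2 j u) (S u - nbr 2 j u - z)) +
  E (wgt j) * E (fun u => osc e (2 * nbra 2 j u) (S u - nbr 2 j u - z)) <=
  (42 * m%:R * M) ^+ 2 * (q / e).
Proof.
move=> mn jn; have [c [d [mc cd dn cq zJ]]] := conc_beside mn jn.
have e0 : 0 < e.
  by rewrite mulr_gt0 ?(conc_width_gt0 M_ge1 v_gt0)// exprn_gt0// ltr0n.
have mp0 : measurable_fun setT psi0 by exact: measurable_cst.
exact: (@local_osc_err _ _ _ mu_iid xi m M m_gt0 M_ge1 xi_meas xi_dep xi_int xi_mom
  0 n c d psi0 j e q z mc cd dn mp0 (@dpsi0 _) e0 cq zJ).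
Qed.

Variable B : R.
Hypothesis B_gt0 : 0 < B.

(** The part of the variation of Stein's solution coming from [x * stein_sol x].
    The minimum with 1 bounds the product of [s / B] with the local part of
    [y / B] by their mean; the product itself would cost fourth moments. *)
Definition drift (s y : R) : R := Num.min 1 (s / B * (Cst + `|y / B|)).

Lemma drift_ge0 s y : 0 <= s -> 0 <= drift s y.
Proof.
move=> s0; rewrite le_min ler01 mulr_ge0 ?divr_ge0 ?(ltW B_gt0)//.
by rewrite addr_ge0//; have := stein_const_ge1 R; lra.
Qed.

Lemma drift_le1 s y : drift s y <= 1.
Proof. by rewrite ge_min lexx. Qed.

(** Only the far part of [y], which is independent of the window, remains as a
    factor. *)
Lemma drift_split s y y' r : 0 <= s -> `|y - y'| <= r ->
  drift s y <= B^-1 * (Cst * s + s * `|y'| / B + (s + r) / 2).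
Proof.
move=> s0 yr.
have r0 : 0 <= r by apply: le_trans yr.
have B0 := B_gt0; have Bi : 0 < B^-1 by rewrite invr_gt0.
have C1 := stein_const_ge1 R.
pose a := s / B; pose b := r / B.
have a0 : 0 <= a by rewrite divr_ge0// ltW.
have b0 : 0 <= b by rewrite divr_ge0// ltW.
have yB : `|y / B| <= `|y'| / B + b.
  rewrite normrM (gtr0_norm Bi) -mulrDl ler_wpM2r ?(ltW Bi)//.
  have -> : y = y' + (y - y') by ring.
  by apply: le_trans (ler_normD _ _) _; rewrite lerD2l.
have -> : B^-1 * (Cst * s + s * `|y'| / B + (s + r) / 2) =
    a * (Cst + `|y'| / B) + (a + b) / 2 by rewrite /a /b; ring.
have t0 : 0 <= `|y'| / B by rewrite divr_ge0// ltW.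
move: yB t0 a0 b0 C1; rewrite /drift -/a; move: (`|y / B|) (`|y'| / B) => p t yB t0 a0 b0 C1.
have st : 0 <= a * (Cst + t) by rewrite mulr_ge0//; lra.
have := min1_mul a0 b0; have [ab|ab] := leP 1 (a * b) => mab.
  by rewrite ge_min; apply/orP; left; lra.
rewrite ge_min; apply/orP; right.
apply: (@le_trans _ _ (a * (Cst + (t + b)))); first by rewrite ler_wpM2l// lerD2l.
by rewrite addrA [X in X <= _]mulrDr lerD2l.
Qed.

Variable Y : R.
Hypothesis Y_bd : forall j, E (fun u => `|S u - nbr 3 j u|) <= Y * B.

Let mS : measurable_fun setT S.
Proof. by apply: measurable_funD => //; [exact: measurable_cst|exact: measurable_block_sum]. Qed.

Let IS : Int mu S.
Proof. by apply: IntD; [exact: Int_cst|exact: Int_block_sum xi_meas xi_int 0 n]. Qed.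

Let Inbr r j : Int mu (nbr r j).
Proof. by apply: Int_sum => i _; exact: Int_xi. Qed.

Let D2 j u := drift (2 * nbra 2 j u) (S u - nbr 2 j u).

Let mD2 j : measurable_fun setT (D2 j).
Proof.
apply: measurable_minr => //; apply: measurable_funM.
  apply: measurable_funM => //; apply: measurable_funM => //.
  exact: measurable_nbra.
apply: measurable_funD => //; apply: measurableT_comp => //.
apply: measurable_funM => //; apply: measurable_funB => //.
exact: measurable_nbr.
Qed.

Let far j u := `|S u - nbr 3 j u|.

Let Ifar j : Int mu (far j).
Proof. by apply: Int_abs; exact: IntB. Qed.

Let far_dep j : dep (predC (zone m 2 j)) (far j).
Proof.
move=> w u wu; congr `|_|.
by apply: (@W_nbr_dep _ xi m xi_dep 0 n psi0 pred0 (@dpsi0 _) 2 j _ w u wu).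
Qed.

Let wn_dep j : dep (zone m 2 j) (fun u => wgt j u * nbra 2 j u).
Proof.
have d2 := @nbra_dep _ xi m xi_dep 0 n 2 j.
have d0 : dep (zone m 2 j) (xi j).
  by move=> w u wu; apply: xi_dep => k Hk; apply: wu; rewrite /zone; lia.
by move=> w u wu; rewrite /weight (d2 w u wu) (d0 w u wu).
Qed.

Let wn_far j : Int mu (fun u => (wgt j u * nbra 2 j u) * far j u) /\
  E (fun u => (wgt j u * nbra 2 j u) * far j u) =
  E (fun u => wgt j u * nbra 2 j u) * E (far j).
Proof.
apply: (@dep_mul _ _ _ mu_iid (zone m 2 j) (predC (zone m 2 j))) => //.
- by move=> k /= ->.
- exact: Int_weight_nbra.
Qed.

Let n_far j : Int mu (fun u => nbra 2 j u * far j u) /\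
  E (fun u => nbra 2 j u * far j u) = E (nbra 2 j) * E (far j).
Proof.
apply: (@dep_mul _ _ _ mu_iid (zone m 2 j) (predC (zone m 2 j))) => //.
- by move=> k /= ->.
- exact: nbra_dep.
- exact: Int_nbra.
Qed.

Let D2_le j u : D2 j u <= B^-1 * (2 * (Cst + 2) * nbra 3 j u + 2 / B * (nbra 2 j u * far j u)).
Proof.
have n0' := nbra_ge0 xi m 0 n 2 j u.
have n23 := @nbra_le _ xi m 0 n 2 3 j u isT.
apply: le_trans (@drift_split _ _ (S u - nbr 3 j u) (2 * nbra 3 j u) _ _) _.
- by rewrite mulr_ge0.
- have -> : S u - nbr 2 j u - (S u - nbr 3 j u) = nbr 3 j u - nbr 2 j u.
    by move: (S u) => su; ring.
  apply: le_trans (ler_normB _ _) _.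
  have := nbr_le_nbra xi m 0 n 3 j u; have := nbr_le_nbra xi m 0 n 2 j u; lra.
rewrite ler_wpM2l ?invr_ge0 ?(ltW B_gt0)//.
rewrite -/(far j u); have C1 := stein_const_ge1 R.
have -> : 2 * nbra 2 j u * far j u / B = 2 / B * (nbra 2 j u * far j u) by ring.
rewrite [X in X <= _]addrAC lerD2r.
move: (nbra 2 j u) (nbra 3 j u) n0' n23 => x y x0 xy; nra.
Qed.

(** The far part of the sum factors out with mean at most [Y * B], so one factor
    [B^-1] is gained over the trivial bound. *)
Lemma drift_err j : E (fun u => wgt j u * D2 j u) + E (wgt j) * E (D2 j) <=
  B^-1 * (m%:R ^+ 2 * M ^+ 2 * (350 * (Cst + 2) + 250 * Y)).
Proof.
have C1 := stein_const_ge1 R; have M1 := M_ge1; have B0 := B_gt0.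
have Bi : 0 <= B^-1 by rewrite invr_ge0 ltW.
have Iw := @Int_weight _ mu xi m xi_meas xi_int 0 n j.
have Iwn r := @Int_weight_nbra _ mu xi m xi_meas xi_int 0 n r j.
have In r := @Int_nbra _ mu xi m xi_meas xi_int 0 n r j.
have [Iwf Ewf] := wn_far j; have [Inf Enf] := n_far j.
have D2_01 u : 0 <= D2 j u <= 1.
  by rewrite drift_ge0 ?drift_le1// mulr_ge0// nbra_ge0.
have ID2 : Int mu (D2 j).
  by apply: (@Int_bounded _ _ _ _ _ 1) => // u; have /andP[? ?] := D2_01 u; rewrite ger0_norm.
have w0 u := weight_ge0 xi m 0 n j u.
have IwD : Int mu (fun u => wgt j u * D2 j u).
  apply: (@Int_dom _ _ _ _ _ (wgt j)) => //.
    by apply: measurable_funM => //; exact: measurable_weight.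
  move=> u; have /andP[D0 D1] := D2_01 u.
  by rewrite normrM (ger0_norm (w0 u)) (ger0_norm D0) ler_piMr.
have e1 : E (fun u => wgt j u * D2 j u) <=
    B^-1 * (2 * (Cst + 2) * E (fun u => wgt j u * nbra 3 j u) +
            2 / B * (E (fun u => wgt j u * nbra 2 j u) * E (far j))).
  rewrite -Ewf -!ExZ// -ExD; [|exact: IntZ|exact: IntZ].
  rewrite -ExZ; last by apply: IntD; exact: IntZ.
  apply: Ex_le => // [|u]; first by apply: IntZ; apply: IntD; exact: IntZ.
  apply: (@le_trans _ _ (wgt j u * (B^-1 * (2 * (Cst + 2) * nbra 3 j u + 2 / B * (nbra 2 j u * far j u))))).
    by rewrite ler_wpM2l// D2_le.
  by rewrite le_eqVlt; apply/orP; left; apply/eqP; move: (wgt j u) (far j u) => x y; ring.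
have e2 : E (D2 j) <=
    B^-1 * (2 * (Cst + 2) * E (nbra 3 j) + 2 / B * (E (nbra 2 j) * E (far j))).
  rewrite -Enf -!ExZ// -ExD; [|exact: IntZ|exact: IntZ].
  rewrite -ExZ; last by apply: IntD; exact: IntZ.
  apply: Ex_le => [||u]; [exact: ID2| |exact: D2_le].
  by apply: IntZ; apply: IntD; exact: IntZ.
have f0 : 0 <= E (far j) by apply: Ex_ge0 => u; exact: normr_ge0.
have fY := Y_bd j; rewrite -/(far j) in fY.
have l5 : (2 * 2 * m).+1%:R <= 5 * m%:R :> R := window_count R 2 m_gt0.
have l7 : (2 * 3 * m).+1%:R <= 7 * m%:R :> R := window_count R 3 m_gt0.
have m0 : 0 <= m%:R :> R by [].
have c0 := @Ex_weight _ mu xi m xi_meas xi_int 0 n M M_ge1 xi_mom j.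
have c2 := @Ex_nbra _ mu xi m xi_meas xi_int 0 n M M_ge1 xi_mom 2 j.
have c3 := @Ex_nbra _ mu xi m xi_meas xi_int 0 n M M_ge1 xi_mom 3 j.
have d2 := @Ex_weight_nbra _ mu xi m xi_meas xi_int 0 n M M_ge1 xi_mom 2 j.
have d3 := @Ex_weight_nbra _ mu xi m xi_meas xi_int 0 n M M_ge1 xi_mom 3 j.
have p0 : 0 <= E (wgt j) by apply: Ex_ge0.
have p1 : 0 <= E (D2 j) by apply: Ex_ge0 => u; have /andP[] := D2_01 u.
have p2 : 0 <= E (nbra 2 j) by apply: Ex_ge0 => u; exact: nbra_ge0.
have p3 : 0 <= E (fun u => wgt j u * nbra 2 j u).
  by apply: Ex_ge0 => u; rewrite mulr_ge0// nbra_ge0.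
have k5 : 0 <= (2 * 2 * m).+1%:R :> R by [].
have k7 : 0 <= (2 * 3 * m).+1%:R :> R by [].
move: e1 e2 f0 fY l5 l7 m0 c0 c2 c3 d2 d3 p0 p1 p2 p3 k5 k7; rewrite -/D2.
move: (E (fun u => wgt j u * D2 j u)) (E (fun u => wgt j u * nbra 3 j u))
  (E (fun u => wgt j u * nbra 2 j u)) (E (D2 j)) (E (wgt j)) (E (nbra 3 j)) (E (nbra 2 j))
  (E (far j)) ((2 * 2 * m).+1%:R) ((2 * 3 * m).+1%:R) (m%:R)
  => wD wn3 wn2 ED w n3 n2 fr k l x e1 e2 f0 fY l5 l7 x0 c0 c2 c3 d2 d3 p0 p1 p2 p3 k0 l0.
exact: (drift_arith B0 M1 C1 e1 e2 f0 fY l5 l7 x0 c0 c2 c3 d2 d3 p0 p1 p2 p3 k0 l0).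
Qed.

Hypothesis n20 : (20 * m <= n)%N.

Let e_gt0 : 0 < e.
Proof.
by rewrite mulr_gt0 ?(conc_width_gt0 M_ge1 v_gt0)// exprn_gt0// ltr0n.
Qed.

Let Err : R := B^-1 * ((42 * m%:R * M) ^+ 2 * (q / e) +
  2 * (B^-1 * (m%:R ^+ 2 * M ^+ 2 * (350 * (Cst + 2) + 250 * Y)))).

(** The variation of the derivative of Stein's solution has two sources: the ramp,
    which only varies in an interval of length of order [e], and the drift. *)
Lemma drift_lip (z t y s : R) : 0 <= s -> `|t - y| <= s ->
  `|stein_sol1 (ramp_at z (e / B)) (t / B) - stein_sol1 (ramp_at z (e / B)) (y / B)| <=
  osc e s (y - z * B) + 2 * drift s y.
Proof.
move=> s0 ty; have B0 := B_gt0; have Bi : 0 < B^-1 by rewrite invr_gt0.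
have B1 : B != 0 by rewrite gt_eqF.
have e1 : e != 0 by rewrite gt_eqF.
have h01 := ramp_at01 z (e / B); have hc := @continuous_ramp_at R z (e / B).
apply: le_trans (stein_sol1_var hc h01 _ _) _.
have rE x : ramp_at z (e / B) (x / B) = ramp_at (z * B) e x.
  by rewrite /ramp_at; congr ramp; field; rewrite e1 B1.
rewrite !rE; apply: lerD; first exact: ramp_at_osc.
rewrite ler_wpM2l// /drift.
have C1 := stein_const_ge1 R.
have c0 : 0 <= Cst + `|y / B| by rewrite addr_ge0//; lra.
have tyB : `|t / B - y / B| <= s / B.
  by rewrite -mulrBl normrM (gtr0_norm Bi) ler_wpM2r// ltW.
have := ler_wpM2r c0 tyB.
move: (`|t / B - y / B| * _) (s / B * _) => a b ab.
by rewrite le_min !ge_min lexx ab orbT.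
Qed.

Lemma stein_expand z j : (j < n)%N ->
  `|E (fun u => xi j u * stein_sol (ramp_at z (e / B)) (S u / B)) -
    E (fun u => xi j u * nbr 1 j u) *
    E (fun u => stein_sol1 (ramp_at z (e / B)) (S u / B) / B)| <= Err.
Proof.
move=> jn; have B0 := B_gt0; have Bi : 0 < B^-1 by rewrite invr_gt0.
have h01 := ramp_at01 z (e / B); have hc := @continuous_ramp_at R z (e / B).
pose h := ramp_at z (e / B); rewrite -/h.
pose f t := stein_sol h (t / B); pose f1 t := stein_sol1 h (t / B) / B.
have df (t : R) : is_derive t (1 : R) f (f1 t).
  have d1 := is_derive_affine B^-1 0 t (is_derive_stein_sol hc h01).
  have -> : f = fun t => stein_sol h (B^-1 * t + 0).
    by apply/funext => r; rewrite /f addr0 mulrC.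
  by have -> : f1 t = B^-1 * stein_sol1 h (B^-1 * t + 0); [rewrite /f1 addr0 mulrC [t / B]mulrC|exact: d1].
have f_bd t : `|f t| <= Cst by exact: stein_sol_bd.
have f1_bd t : `|f1 t| <= 2 / B.
  by rewrite normrM (gtr0_norm Bi) ler_wpM2r ?(ltW Bi)// stein_sol1_bd.
have mf1 : measurable_fun setT f1.
  apply: measurable_funM => //.
  apply: measurableT_comp; first exact: measurable_stein_sol1.
  by apply: measurable_funM.
pose o u := osc e (2 * nbra 2 j u) (S u - nbr 2 j u - z * B).
pose Dj u := B^-1 * (o u + 2 * D2 j u).
have nb0 u : 0 <= 2 * nbra 2 j u by rewrite mulr_ge0// nbra_ge0.
have mo : measurable_fun setT o.
  apply: measurable_osc.
    apply: measurable_funM => //; exact: measurable_nbra.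
  apply: measurable_funB => //; apply: measurable_funB => //.
  exact: measurable_nbr.
have mD : measurable_fun setT Dj.
  by apply: measurable_funM => //; apply: measurable_funD => //; exact: measurable_funM.
have o01 u : 0 <= o u <= 1 by rewrite osc_ge0// osc_le1.
have D01 u : 0 <= D2 j u <= 1 by rewrite drift_ge0 ?drift_le1.
have Dj3 u : 0 <= Dj u <= 3 / B.
  have /andP[? ?] := o01 u; have /andP[? ?] := D01 u.
  have o3 : 0 <= o u + 2 * D2 j u by lra.
  rewrite /Dj mulr_ge0 ?(ltW Bi)//= [X in X <= _]mulrC ler_wpM2r ?(ltW Bi)//.
  by lra.
have mp0 : measurable_fun setT psi0 by exact: measurable_cst.
have key := @expand_one _ _ _ mu_iid xi m xi_meas xi_dep xi_int xi_mean 0 n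
     psi0 pred0 mp0 (@dpsi0 _) f f1 Cst (2 / B) df f_bd f1_bd mf1 j Dj (3 / B).
apply: le_trans (key _ _ _ _ _) _.
- by [].
- by [].
- exact: mD.
- exact: Dj3.
- move=> u t tu; rewrite /f1 -mulrBl normrM (gtr0_norm Bi) mulrC.
  rewrite /Dj ler_wpM2l ?(ltW Bi)//; exact: drift_lip.
have Io : Int mu o.
  by apply: (@Int_bounded _ _ _ _ _ 1) => // u; have /andP[? ?] := o01 u; rewrite ger0_norm.
have ID2 : Int mu (D2 j).
  by apply: (@Int_bounded _ _ _ _ _ 1) => // u; have /andP[? ?] := D01 u; rewrite ger0_norm.
have Iw := @Int_weight _ mu xi m xi_meas xi_int 0 n j.
have w0 u := weight_ge0 xi m 0 n j u.
have mw := measurable_weight m xi_meas 0 n j.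
have Iwf (F : seqsp R -> R) : measurable_fun setT F -> (forall u, 0 <= F u <= 1) ->
    Int mu (fun u => wgt j u * F u).
  move=> mF F01; apply: (@Int_dom _ _ _ _ _ (wgt j)) => //.
    exact: measurable_funM.
  move=> u; have /andP[F0 F1] := F01 u.
  by rewrite normrM (ger0_norm (w0 u)) (ger0_norm F0) ler_piMr.
have Iwo := Iwf o mo o01; have IwD := Iwf (D2 j) (mD2 j) D01.
have e1 : E (fun u => wgt j u * Dj u) =
    B^-1 * (E (fun u => wgt j u * o u) + 2 * E (fun u => wgt j u * D2 j u)).
  rewrite -ExZ// -ExD; [|exact: Iwo|exact: IntZ].
  rewrite -ExZ; last by apply: IntD => //; exact: IntZ.
  by congr (Ex mu _); apply/funext => u; rewrite /Dj; move: (wgt j u) => x; ring.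
have e2 : E Dj = B^-1 * (E o + 2 * E (D2 j)).
  by rewrite -ExZ// -ExD//; [rewrite -ExZ//; apply: IntD => //; exact: IntZ|exact: IntZ].
rewrite e1 e2 /Err.
have := osc_err (z * B) n20 jn; have := drift_err j.
rewrite -/(D2 j) -/o.
move: (E (fun u => wgt j u * o u)) (E (fun u => wgt j u * D2 j u)) (E (wgt j))
  (E o) (E (D2 j)) (B^-1 * _) ((42 * m%:R * M) ^+ 2 * _) => x1 x2 w x3 x4 y1 y2 l1 l2.
have -> : B^-1 * (x1 + 2 * x2) + w * (B^-1 * (x3 + 2 * x4)) =
   B^-1 * ((x1 + w * x3) + 2 * (x2 + w * x4)) by ring.
by rewrite ler_wpM2l ?(ltW Bi)//; lra.
Qed.

Let s2 : R := E (fun u => T 0 n u * T 0 n u).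

(** Summing the expansions turns Stein's equation into a comparison of [S / B]
    with the normal law, the first error being the mismatch of variances. *)
Lemma stein_smooth z :
  `|E (fun u => ramp_at z (e / B) (S u / B)) - gmean (ramp_at z (e / B))| <=
  2 * `|s2 / B ^+ 2 - 1| + n%:R / B * Err.
Proof.
have B0 := B_gt0; have Bi : 0 < B^-1 by rewrite invr_gt0.
have B1 : B != 0 by rewrite gt_eqF.
have h01 := ramp_at01 z (e / B); have hc := @continuous_ramp_at R z (e / B).
pose h := ramp_at z (e / B); rewrite -/h.
pose f t := stein_sol h (t / B); pose f1 t := stein_sol1 h (t / B) / B.
have mf : measurable_fun setT (fun u => f (S u)).
  apply: measurableT_comp; last exact: mS.
  apply: (@measurableT_comp _ _ _ _ _ _ (stein_sol h)); last exact: measurable_funM.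
  apply: continuous_measurable_fun => t.
  by apply/differentiable_continuous/derivable1_diffP; case: (is_derive_stein_sol hc h01 t).
have mf1 : measurable_fun setT (fun u => f1 (S u)).
  apply: measurable_funM => //.
  apply: measurableT_comp; first exact: measurable_stein_sol1.
  by apply: measurable_funM.
have mh : measurable_fun setT (fun u => h (S u / B)).
  apply: measurableT_comp; last by apply: measurable_funM.
  by apply: continuous_measurable_fun; exact: hc.
have Ih : Int mu (fun u => h (S u / B)).
  by apply: (@Int_bounded _ _ _ _ _ 1) => // u; have /andP[? ?] := h01 (S u / B); rewrite ger0_norm.
have If1 : Int mu (fun u => f1 (S u)).
  apply: (@Int_bounded _ _ _ _ _ (2 / B)) => // u.
  by rewrite normrM (gtr0_norm Bi) ler_wpM2r ?(ltW Bi)// stein_sol1_bd.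
have Ixf j : Int mu (fun u => xi j u * f (S u)).
  apply: (@Int_dom _ _ _ _ _ (fun u => Cst * `|xi j u|)) => //.
  - exact: measurable_funM.
  - by apply/IntZ/Int_abs; exact: Int_xi.
  - by move=> u; rewrite normrM mulrC ler_wpM2r//; exact: stein_sol_bd.
have SfE : (fun u => S u * f (S u)) = fun u => \sum_(0 <= j < n) xi j u * f (S u).
  by apply/funext => u; rewrite -mulr_suml /S /psi0 add0r.
have ISf : Int mu (fun u => S u * f (S u)).
  by rewrite SfE; apply: Int_sum => j _; exact: Ixf.
have ESf : E (fun u => S u * f (S u)) = \sum_(0 <= j < n) E (fun u => xi j u * f (S u)).
  by rewrite SfE; apply: Ex_sum => j _; exact: Ixf.
have cov : \sum_(0 <= j < n) E (fun u => xi j u * nbr 1 j u) = s2.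
  by rewrite (sum_cov_window mu_iid m_gt0 M_ge1 xi_meas xi_dep xi_int xi_mean).
have dif : `|E (fun u => S u * f (S u)) - s2 * E (fun u => f1 (S u))| <= n%:R * Err.
  rewrite ESf -cov mulr_suml -sumrB.
  apply: le_trans (ler_norm_sum _ _ _) _.
  apply: (@le_trans _ _ (\sum_(0 <= j < n) Err)).
    by apply: ler_sum_nat => j /andP[_ jn]; exact: stein_expand.
  by rewrite sumr_const_nat subn0 mulr_natl.
have eq : (fun u => h (S u / B)) =
   fun u => (B * f1 (S u) - B^-1 * (S u * f (S u))) + gmean h.
  by apply/funext => u; rewrite /f1 /f /stein_sol1; move: (stein_sol h _) => y; field.
have Eh : E (fun u => h (S u / B)) =
    B * E (fun u => f1 (S u)) - B^-1 * E (fun u => S u * f (S u)) + gmean h.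
  rewrite eq ExD; [|by apply: IntB; exact: IntZ|exact: Int_cst].
  by rewrite Ex_cst ExB ?ExZ//; exact: IntZ.
have f1B : `|E (fun u => f1 (S u))| <= 2 / B.
  apply: le_trans (Ex_abs If1) _; rewrite -[X in _ <= X](Ex_cst mu).
  apply: Ex_le => [||u]; [exact: Int_abs|exact: Int_cst|].
  by rewrite normrM (gtr0_norm Bi) ler_wpM2r ?(ltW Bi)// stein_sol1_bd.
rewrite Eh addrK; move: dif f1B.
move: (E (fun u => f1 (S u))) (E (fun u => S u * f (S u))) s2 => x y s dif xB.
have -> : B * x - B^-1 * y = - ((s / B ^+ 2 - 1) * (B * x) + B^-1 * (y - s * x)).
  by field.
rewrite normrN; apply: le_trans (ler_normD _ _) _; apply: lerD.
  rewrite normrM mulrC ler_wpM2r// normrM (gtr0_norm B0).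
  by rewrite mulrC -ler_pdivlMr.
rewrite normrM (gtr0_norm Bi) [n%:R / B]mulrC -mulrA ler_wpM2l//.
exact: ltW.
Qed.

(** The indicator lies between two ramps of width [e / B], and the normal law
    charges the gap between them with at most [e / B]. *)
Lemma stein_prob x :
  `|fine (mu [set u | S u < x * B]) - Phi x| <=
  2 * `|s2 / B ^+ 2 - 1| + n%:R / B * Err + e / B.
Proof.
have B0 := B_gt0; have eB : 0 < e / B by rewrite divr_gt0.
have mA : measurable [set u | S u < x * B].
  have -> : [set u | S u < x * B] = setT `&` S @^-1` `]-oo, x * B[%classic.
    by rewrite setTI; apply/seteqP; split=> u /=; rewrite in_itv.
  by apply: mS => //; exact: measurable_itv.
have AE u : (u \in [set u | S u < x * B]) = (S u < x * B) by apply/idP/idP; rewrite inE.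
have mh z : measurable_fun setT (fun u => ramp_at z (e / B) (S u / B)).
  apply: measurableT_comp; last by apply: measurable_funM.
  by apply: continuous_measurable_fun; exact: continuous_ramp_at.
have Ih z : Int mu (fun u => ramp_at z (e / B) (S u / B)).
  apply: (@Int_bounded _ _ _ _ _ 1) => // u.
  by have /andP[? ?] := ramp_at01 z (e / B) (S u / B); rewrite ger0_norm.
have up : fine (mu [set u | S u < x * B]) <= E (fun u => ramp_at x (e / B) (S u / B)).
  rewrite -Ex_indic//; apply: Ex_le => [||u]; [exact: Int_indic|exact: Ih|].
  have /andP[h0 h1] := ramp_at01 x (e / B) (S u / B).
  rewrite indicE AE; have [Sx|_] := ltP (S u) (x * B); last by [].
  rewrite /ramp_at ramp_left ?lexx// pmulr_lle0 ?invr_gt0//.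
  by rewrite subr_le0 ler_pdivrMr// ltW.
have lo : E (fun u => ramp_at (x - e / B) (e / B) (S u / B)) <=
    fine (mu [set u | S u < x * B]).
  rewrite -Ex_indic//; apply: Ex_le => [||u]; [exact: Ih|exact: Int_indic|].
  have /andP[h0 h1] := ramp_at01 (x - e / B) (e / B) (S u / B).
  rewrite indicE AE; have [_|Sx] := ltP (S u) (x * B); first by [].
  rewrite /ramp_at ramp_right// ler_pdivlMr// mul1r.
  have : x <= S u / B by rewrite ler_pdivlMr.
  by lra.
have gU := gmean_ramp_le x eB; have gL := gmean_ramp_ge (x - e / B) eB.
have p1 := Phi_lip x (ltW eB); have p2 := Phi_lip (x - e / B) (ltW eB).
rewrite subrK in p2.
have s1 := stein_smooth x; have s3 := stein_smooth (x - e / B).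
move: up lo gU gL p1 p2 s1 s3.
move: (Ex mu _) (Ex mu _) (fine _) (gmean _) (gmean _) (Phi x) (Phi _) (Phi _)
  (2 * `|_| + n%:R / B * Err) => a1 a2 p g1 g2 f1 f2 f3 r.
by move: (e / B) => t; rewrite !ler_norml; lra.
Qed.

End BerryEsseen.

Section BerryEsseenConst.
Context (R : realType).
Implicit Types v M : R.

Let be_mid v M : R := 2 + 14 * M / Num.sqrt v.

Definition be_const v M (n0 : nat) : R :=
  20 + (42 * M) ^+ 2 * (2 * conc_const v M n0 / conc_width v M) / v +
  2 * M ^+ 2 * (350 * (stein_const R + 2) + 250 * be_mid v M) / (v * Num.sqrt v) +
  conc_width v M / Num.sqrt v.

(** With [B] at least of order [w], the square root of the number of terms, every
    error of [stein_prob] is of order [x ^+ 2 / w], [x] being the window. *)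
Lemma be_arith v M D A K B sv w x : 0 < v -> 0 < sv -> sv ^+ 2 = v -> 0 < w ->
  sv * w <= B -> 0 <= D -> 0 < A -> 0 <= K -> 0 < x -> 0 <= M ->
  w ^+ 2 / B * (B^-1 * ((42 * x * M) ^+ 2 * (2 * (D * (x ^+ 2 / w)) / (A * x ^+ 2)) +
    2 * (B^-1 * (x ^+ 2 * M ^+ 2 * K)))) + A * x ^+ 2 / B <=
  ((42 * M) ^+ 2 * (2 * D / A) / v + 2 * M ^+ 2 * K / (v * sv) + A / sv) * (x ^+ 2 / w).
Proof.
move=> v0 s0 sE w0 swB D0 A0 K0 x0 M0.
have B0 : 0 < B by apply: lt_le_trans swB; exact: mulr_gt0.
have Bi : 0 < B^-1 by rewrite invr_gt0.
have iB : B^-1 <= (sv * w)^-1 by rewrite lef_pV2// posrE mulr_gt0.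
have i2 : B^-1 ^+ 2 <= (sv * w)^-1 ^+ 2 by rewrite ler_pXn2r// nnegrE ?ltW// invr_gt0 mulr_gt0.
have i3 : B^-1 ^+ 3 <= (sv * w)^-1 ^+ 3 by rewrite ler_pXn2r// nnegrE ?ltW// invr_gt0 mulr_gt0.
have h1 : w ^+ 2 * (42 * x * M) ^+ 2 * (2 * (D * (x ^+ 2 / w)) / (A * x ^+ 2)) * B^-1 ^+ 2 <=
   w ^+ 2 * (42 * x * M) ^+ 2 * (2 * (D * (x ^+ 2 / w)) / (A * x ^+ 2)) * (sv * w)^-1 ^+ 2.
  by apply: ler_wpM2l => //; rewrite ?(sqr_ge0, mulr_ge0, invr_ge0)// ltW.
have h2 : 2 * w ^+ 2 * (x ^+ 2 * M ^+ 2 * K) * B^-1 ^+ 3 <=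
   2 * w ^+ 2 * (x ^+ 2 * M ^+ 2 * K) * (sv * w)^-1 ^+ 3.
  by apply: ler_wpM2l => //; rewrite ?(sqr_ge0, mulr_ge0)// ltW.
have h3 : A * x ^+ 2 * B^-1 <= A * x ^+ 2 * (sv * w)^-1.
  by apply: ler_wpM2l => //; rewrite mulr_ge0 ?(ltW A0) ?sqr_ge0.
have -> : w ^+ 2 / B * (B^-1 * ((42 * x * M) ^+ 2 * (2 * (D * (x ^+ 2 / w)) / (A * x ^+ 2)) +
    2 * (B^-1 * (x ^+ 2 * M ^+ 2 * K)))) + A * x ^+ 2 / B =
  w ^+ 2 * (42 * x * M) ^+ 2 * (2 * (D * (x ^+ 2 / w)) / (A * x ^+ 2)) * B^-1 ^+ 2 +
  2 * w ^+ 2 * (x ^+ 2 * M ^+ 2 * K) * B^-1 ^+ 3 + A * x ^+ 2 * B^-1 by ring.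
apply: le_trans (lerD (lerD h1 h2) h3) _.
rewrite le_eqVlt; apply/orP; left; apply/eqP; rewrite -sE; field.
by rewrite !gt_eqF.
Qed.

End BerryEsseenConst.

(** The Berry-Esseen bound for sums over windows of length [m]. The normalisation
    [B] need not be the standard deviation: sums obtained by truncation are
    compared with the normal law at the scale of the original ones. *)
Theorem berry_esseen (R : realType) (mu : probability (seqsp R) R) (nu : probability R R)
  (xi : nat -> seqsp R -> R) (m : nat) (M v : R) (n0 n : nat) (B x : R) :
  iid_law mu nu -> (0 < m)%N -> 1 <= M ->
  (forall j, measurable_fun setT (xi j)) ->
  (forall j, dep (fun i => j <= i <= j + m)%N (xi j)) ->
  (forall j, Int mu (fun u => `|xi j u| ^+ 3)) ->
  (forall j, Ex mu (fun u => `|xi j u| ^+ 3) <= M) ->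
  (forall j, Ex mu (xi j) = 0) ->
  0 < v ->
  (forall a N, (n0 <= N <= n)%N ->
     v * N%:R <= Ex mu (fun u => block_sum xi a (a + N) u * block_sum xi a (a + N) u)) ->
  (0 < n)%N -> 0 < B -> v * n%:R <= B ^+ 2 ->
  `|fine (mu [set u | block_sum xi 0 n u < x * B]) - Phi x| <=
  2 * `|Ex mu (fun u => block_sum xi 0 n u * block_sum xi 0 n u) / B ^+ 2 - 1| +
  be_const v M n0 * (m%:R ^+ 2 / Num.sqrt n%:R).
Proof.
move=> mu_iid m0 M1 xi_meas xi_dep xi_int xi_mom xi_mean v0 xi_var n_gt0 B0 vB.
pose s2 := Ex mu (fun u => block_sum xi 0 n u * block_sum xi 0 n u); rewrite -/s2.
pose w : R := Num.sqrt n%:R; pose sv := Num.sqrt v; rewrite -/w.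
have w0 : 0 < w by rewrite sqrtr_gt0 ltr0n.
have sv0 : 0 < sv by rewrite sqrtr_gt0.
have w2 : w ^+ 2 = n%:R by rewrite sqr_sqrtr.
have sv2 : sv ^+ 2 = v by rewrite sqr_sqrtr// ltW.
have x0 : 0 < m%:R :> R by rewrite ltr0n.
have r0 : 0 <= m%:R ^+ 2 / w by rewrite divr_ge0 ?sqr_ge0// ltW.
have A0 := conc_width_gt0 M1 v0; have D0 := conc_const_ge0 M1 n0 v0.
have C1 := stein_const_ge1 R.
have M0 : 0 <= M by lra.
pose Y : R := 2 + 14 * M / sv.
have Y0 : 0 <= Y by rewrite addr_ge0// divr_ge0 ?mulr_ge0// ltW.
pose K : R := 350 * (stein_const R + 2) + 250 * Y.
have K0 : 0 <= K by rewrite /K; lra.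
have swB : sv * w <= B.
  rewrite -(@ler_pXn2r _ 2) ?nnegrE ?(ltW B0) ?mulr_ge0 ?(ltW sv0) ?(ltW w0)//.
  by rewrite exprMn sv2 w2.
pose C2 := (42 * M) ^+ 2 * (2 * conc_const v M n0 / conc_width v M) / v +
   2 * M ^+ 2 * K / (v * sv) + conc_width v M / sv.
have C20 : 0 <= C2.
  rewrite /C2 !addr_ge0 ?divr_ge0 ?mulr_ge0 ?sqr_ge0 ?(ltW A0) ?(ltW sv0) ?(ltW v0)//.
  by rewrite invr_ge0 ltW.
have CE : be_const v M n0 = 20 + C2 by rewrite /be_const /C2 /K /Y; ring.
have lhs1 : `|fine (mu [set u | block_sum xi 0 n u < x * B]) - Phi x| <= 1.
  have mA : measurable [set u | block_sum xi 0 n u < x * B].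
    have -> : [set u | block_sum xi 0 n u < x * B] = setT `&` block_sum xi 0 n @^-1` `]-oo, x * B[%classic.
      by rewrite setTI; apply/seteqP; split=> u /=; rewrite in_itv.
    by apply: (measurable_block_sum xi_meas 0 n) => //; exact: measurable_itv.
  have p1 := fine_prob_le1 mu mA.
  have p0 : 0 <= fine (mu [set u | block_sum xi 0 n u < x * B]) by rewrite fine_ge0.
  have := Phi01 x; move: (fine _) p0 p1 => p; rewrite ler_norml; lra.
have rhs0 : 0 <= 2 * `|s2 / B ^+ 2 - 1| by rewrite mulr_ge0.
(* unless the bound is below 1 there is nothing to prove; otherwise [n] is large
   against [m], and the second moment of the sum is at most [2 * B ^+ 2] *)
have [big|small] := leP 1 ((20 + C2) * (m%:R ^+ 2 / w)).
  by apply: le_trans lhs1 _; rewrite CE; lra.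
have [far|near] := leP 1 (2 * `|s2 / B ^+ 2 - 1|).
  by apply: le_trans lhs1 _; apply: le_trans far _; rewrite lerDl CE mulr_ge0//; lra.
have mw : 20 * m%:R ^+ 2 <= w.
  have := ltW small; rewrite mulrDl.
  have : 0 <= C2 * (m%:R ^+ 2 / w) by rewrite mulr_ge0.
  move: (C2 * _) => t t0 h; have : 20 * (m%:R ^+ 2 / w) <= 1 by lra.
  by rewrite mulrA ler_pdivrMr// mul1r.
have m1 : 1 <= m%:R :> R by rewrite ler1n.
have mm : m%:R <= m%:R ^+ 2 :> R by rewrite expr2 ler_peMl// ltW.
have m20 : (20 * m <= n)%N.
  rewrite -(ler_nat R) natrM -w2; apply: (@le_trans _ _ w); first by lra.
  by rewrite expr2 ler_peMl ?(ltW w0)//; lra.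
have s2B : s2 <= 2 * B ^+ 2.
  have B2 : 0 < B ^+ 2 by rewrite exprn_gt0.
  rewrite -ler_pdivrMr//; move: near; move: (s2 / _) => t.
  by have [] := ger0P (t - 1); lra.
have Ybd j : Ex mu (fun u => `|0 + block_sum xi 0 n u - nbr xi m 0 n 3 j u|) <= Y * B.
  have Inb : Int mu (nbra xi m 0 n 3 j) := @Int_nbra _ mu xi m xi_meas xi_int 0 n 3 j.
  have IT := Int_block_sum xi_meas xi_int 0 n.
  have Inr : Int mu (nbr xi m 0 n 3 j).
    by apply: Int_sum => i _; exact: Int_xi.
  apply: (@le_trans _ _ (Ex mu (fun u => `|block_sum xi 0 n u| + nbra xi m 0 n 3 j u))).
    apply: Ex_le => [||u].
    - by apply: Int_abs; apply: IntB => //; apply: IntD => //; exact: Int_cst.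
    - by apply: IntD => //; exact: Int_abs.
    - rewrite add0r; apply: le_trans (ler_normB _ _) _.
      by rewrite lerD2l; exact: nbr_le_nbra.
  rewrite ExD//; last exact: Int_abs.
  have eT := Ex_abs_block_sum xi_meas xi_int 0 n; rewrite -/s2 in eT.
  have eN := @Ex_nbra _ mu xi m xi_meas xi_int 0 n M M1 xi_mom 3 j.
  have l7 : (2 * 3 * m).+1%:R <= 7 * m%:R :> R := window_count R 3 m0.
  have sB : Num.sqrt s2 <= 2 * B.
    rewrite -[X in _ <= X](@gtr0_norm _ (2 * B)) ?mulr_gt0// -sqrtr_sqr.
    by apply: ler_wsqrtr; apply: le_trans s2B _; rewrite exprMn; have := sqr_ge0 B; lra.
  have mB : 14 * m%:R * M <= 14 * M / sv * B.
    have -> : 14 * M / sv * B = 14 * M * (B / sv) by ring.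
    rewrite mulrAC ler_wpM2l ?mulr_ge0// ler_pdivlMr// mulrC.
    apply: le_trans swB; rewrite ler_wpM2l ?(ltW sv0)//; lra.
  have kM : (2 * 3 * m).+1%:R * (2 * M) <= 7 * m%:R * (2 * M) by rewrite ler_wpM2r// mulr_ge0.
  by rewrite /Y mulrDl; apply: lerD; [exact: le_trans sB|apply: le_trans mB; apply: le_trans eN _; lra].
have key := stein_prob mu_iid m0 M1 xi_meas xi_dep xi_int xi_mom xi_mean v0 xi_var B0 Ybd m20 x.
have setE : [set u | 0 + block_sum xi 0 n u < x * B] = [set u | block_sum xi 0 n u < x * B].
  by apply/seteqP; split=> u /=; rewrite add0r.
rewrite setE -/s2 -/w -/sv -/Y -/K in key; rewrite -w2 in key.
apply: le_trans key _; rewrite -addrA lerD2l.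
have ba := be_arith v0 sv0 sv2 w0 swB D0 A0 K0 x0 M0.
apply: le_trans ba _; by rewrite -/C2 CE ler_wpM2r// lerDr.
Qed.

(** * Stationary functionals of an independent sequence *)

(** Interpolation between moments in additive form: the level [l] is optimised
    after taking expectations, which replaces Holder's inequality. *)
Lemma sqr_le_cube (R : realType) (l x : R) : 0 < l -> x ^+ 2 <= l ^+ 2 + `|x| ^+ 3 / l.
Proof.
move=> l0; rewrite -real_normK ?num_real//; move: (normr_ge0 x); move: `|x| => a a0.
rewrite -subr_ge0; have -> : l ^+ 2 + a ^+ 3 / l - a ^+ 2 = (l ^+ 3 + a ^+ 2 * (a - l)) / l.
  by field; rewrite gt_eqF.
rewrite divr_ge0 ?(ltW l0)//; have [al|la] := leP l a.
  by apply: addr_ge0; rewrite ?exprn_ge0 ?mulr_ge0 ?sqr_ge0 ?subr_ge0 ?(ltW l0).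
have -> : l ^+ 3 + a ^+ 2 * (a - l) = a ^+ 3 + l * (l ^+ 2 - a ^+ 2) by ring.
apply: addr_ge0; first exact: exprn_ge0.
by rewrite mulr_ge0 ?(ltW l0)// subr_ge0 ler_pXn2r ?nnegrE ?(ltW l0)// ltW.
Qed.

Lemma mul_le_weight (R : realType) (l x y : R) : 0 < l ->
  `|x * y| <= x ^+ 2 / l + l * y ^+ 2.
Proof.
move=> l0; rewrite normrM -[x ^+ 2]real_normK ?num_real// -[y ^+ 2]real_normK ?num_real//.
move: (normr_ge0 x) (normr_ge0 y); move: `|x| `|y| => a b a0 b0.
rewrite -subr_ge0.
have -> : a ^+ 2 / l + l * b ^+ 2 - a * b = ((a - l * b) ^+ 2 + l * (a * b)) / l.
  by field; rewrite gt_eqF.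
by rewrite divr_ge0 ?(ltW l0)// addr_ge0 ?sqr_ge0 ?mulr_ge0// ltW.
Qed.

Lemma cube_add (R : realType) (x y : R) :
  `|x + y| ^+ 3 <= 4 * `|x| ^+ 3 + 4 * `|y| ^+ 3.
Proof.
have xy := ler_normD x y.
apply: (@le_trans _ _ ((`|x| + `|y|) ^+ 3)).
  by rewrite ler_pXn2r ?nnegrE ?addr_ge0.
move: (normr_ge0 x) (normr_ge0 y); move: `|x| `|y| => a b a0 b0.
rewrite -subr_ge0.
have -> : 4 * a ^+ 3 + 4 * b ^+ 3 - (a + b) ^+ 3 = 3 * ((a + b) * (a - b) ^+ 2) by ring.
by rewrite mulr_ge0// mulr_ge0 ?sqr_ge0 ?addr_ge0.
Qed.

Lemma sqr_sum_le (R : realType) (I : Type) (r : seq I) (x : I -> R) :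
  (\sum_(i <- r) x i) ^+ 2 <= (size r)%:R * \sum_(i <- r) x i ^+ 2.
Proof.
elim: r => [|i r IH]; first by rewrite !big_nil expr0n/= mulr0.
rewrite !big_cons/= -natr1.
have Q0 : 0 <= \sum_(j <- r) x j ^+ 2 by apply: sumr_ge0 => j _; exact: sqr_ge0.
have [r0|r0] := posnP (size r).
  by rewrite (size0nil r0)/= !big_nil !addr0 add0r mul1r.
move: IH Q0; move: (\sum_(j <- r) _ ^+ 2) (\sum_(j <- r) _) (x i) => Q S y IH Q0.
have n0 : 0 < (size r)%:R :> R by rewrite ltr0n.
have h0 := sqr_ge0 (S - (size r)%:R * y).
have h1 : 2 * (S * y) * (size r)%:R <= (Q + (size r)%:R * y ^+ 2) * (size r)%:R.
  by move: IH h0; move: ((size r)%:R) => n IH h0; nra.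
move: h1; rewrite ler_pM2r// => h1; move: IH h1.
by rewrite !expr2; move: ((size r)%:R) => n IH h1; nra.
Qed.

Section Image.
Context d (T : measurableType d) (R : realType) (P : probability T R)
  (mu : probability (seqsp R) R) (nu : probability R R).
Hypothesis mu_iid : iid_law mu nu.

Lemma iid_image (X : T -> seqsp R) : measurable_fun setT X ->
  (forall n B, (forall i, measurable (B i)) ->
     P (X @^-1` cyl n B) = (\prod_(i < n) nu (B i))%E) ->
  has_law P mu X.
Proof.
move=> mX PX; split=> // A mA.
pose phi : {mfun T >-> seqsp R} := HB.pack X (isMeasurableFun.Build _ _ _ _ X mX).
pose m2 : {measure set seqsp R -> \bar R} := distribution P phi.
have := @iid_law_unique _ mu m2; rewrite /m2; apply => //.
- by apply: le_lt_trans (probability_le1 _ _) _ => //; rewrite ltry.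
- by move=> n B mB; exact: etrans (mu_iid n mB) (esym (PX n B mB)).
Qed.

End Image.

Section Shift.
Context (R : realType) (mu : probability (seqsp R) R) (nu : probability R R).
Hypothesis mu_iid : iid_law mu nu.

Definition shift j (u : seqsp R) : seqsp R := fun i => u (i + j)%N.

Lemma shift_shift i j u : shift i (shift j u) = shift (i + j) u.
Proof. by apply/funext => k; rewrite /shift addnA. Qed.

Lemma measurable_shift j : measurable_fun setT (shift j).
Proof. by apply: measurable_to_seq => i; exact: measurable_coord. Qed.

Lemma shift_law j : has_law mu mu (shift j).
Proof.
apply: (iid_image mu_iid) => [|n B mB]; first exact: measurable_shift.
pose B' i := if (i < j)%N then setT else B (i - j)%N.
have mB' i : measurable (B' i) by rewrite /B'; case: ifP.
have BE i : B' (i + j)%N = B i by rewrite /B' ltnNge leq_addl addnK.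
have -> : shift j @^-1` cyl n B = cyl (j + n) B'.
  apply/seteqP; split=> u /=.
    move=> Bu i ijn; rewrite /B'; case: ltnP => // ji.
    by have := Bu (i - j)%N; rewrite /shift subnK//; apply; lia.
  by move=> Bu i i_n; have := Bu (i + j)%N; rewrite BE; apply; lia.
rewrite mu_iid// -!(big_mkord xpredT (fun i => nu (_ i))) (@big_cat_nat _ _ _ j)//= ?leq_addr//.
rewrite big_nat_cond big1 => [|i /andP[/andP[_ ij] _]]; last first.
  by rewrite /B' ij; exact: probability_setT.
rewrite mul1e -{1}[j]add0n big_addn addKn; apply: eq_big_nat => i _.
by rewrite BE.
Qed.

Lemma dep_shift (I : pred nat) S (f : seqsp R -> S) j : dep I f ->
  dep (fun i => (j <= i)%N && I (i - j)%N) (f \o shift j).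
Proof.
move=> fI v u vu; apply: fI => i Ii; rewrite /shift; apply: vu.
by rewrite leq_addl addnK.
Qed.

Lemma Int_shift (f : seqsp R -> R) j : Int mu f -> Int mu (f \o shift j).
Proof.
by move=> If; apply/(has_law_Int (shift_law j) (Int_measurable If)).
Qed.

Lemma Ex_shift (f : seqsp R -> R) j : Int mu f -> Ex mu (f \o shift j) = Ex mu f.
Proof.
move=> If; apply/esym/(has_law_Ex (shift_law j)); first exact: Int_measurable If.
exact: Int_shift.
Qed.

End Shift.

(** If [S < x * B] then [S' < x * B + 1], unless [S] and [S'] differ by at least
    1. *)
Lemma prob_le_shift (R : realType) (mu : probability (seqsp R) R)
    (S S' : seqsp R -> R) (B x : R) :
  measurable_fun setT S -> measurable_fun setT S' ->
  Int mu (fun u => (S u - S' u) ^+ 2) -> 0 < B ->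
  fine (mu [set u | S u < x * B]) <=
  fine (mu [set u | S' u < (x + B^-1) * B]) + Ex mu (fun u => (S u - S' u) ^+ 2).
Proof.
move=> mS mS' Id B0.
have mlt (f : seqsp R -> R) y : measurable_fun setT f -> measurable [set u | f u < y].
  move=> mf; have -> : [set u | f u < y] = setT `&` f @^-1` `]-oo, y[%classic.
    by rewrite setTI; apply/seteqP; split=> u /=; rewrite in_itv.
  by apply: mf => //; exact: measurable_itv.
have ltE (f : seqsp R -> R) y u : (u \in [set u | f u < y]) = (f u < y).
  by apply/idP/idP; rewrite inE.
rewrite -(Ex_indic mu (mlt S _ mS)) -(Ex_indic mu (mlt S' _ mS')).
have II (f : seqsp R -> R) y : measurable_fun setT f -> Int mu (\1_[set u | f u < y]).
  by move=> mf; apply: Int_indic; exact: mlt.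
rewrite -ExD//; last exact: II.
apply: Ex_le => [||u]; [exact: II|by apply: IntD => //; exact: II|].
rewrite !indicE !ltE mulrDl mulVf ?gt_eqF//.
have [S1|_] := ltP (S u) (x * B); last by rewrite addr_ge0 ?sqr_ge0.
have [_|S2] := ltP (S' u) (x * B + 1); first by rewrite lerDl sqr_ge0.
rewrite add0r; have : 1 <= S' u - S u by lra.
by move=> ab; rewrite -sqrrN opprB expr_ge1//; lra.
Qed.

(** A shift by 1 of the sums moves the normal distribution function by at most
    [B^-1]. *)
Lemma prob_transfer (R : realType) (mu : probability (seqsp R) R)
    (S S' : seqsp R -> R) (B r : R) :
  measurable_fun setT S -> measurable_fun setT S' ->
  Int mu (fun u => (S u - S' u) ^+ 2) -> 0 < B ->
  (forall x, `|fine (mu [set u | S' u < x * B]) - Phi x| <= r) -> forall x,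
  `|fine (mu [set u | S u < x * B]) - Phi x| <=
  r + B^-1 + Ex mu (fun u => (S u - S' u) ^+ 2).
Proof.
move=> mS mS' Id B0 H x; have Bi : 0 <= B^-1 by rewrite invr_ge0 ltW.
have h1 := prob_le_shift x mS mS' Id B0.
have sw : (fun u => (S' u - S u) ^+ 2) = fun u => (S u - S' u) ^+ 2.
  by apply/funext => u; rewrite -sqrrN opprB.
have Id' : Int mu (fun u => (S' u - S u) ^+ 2) by rewrite sw.
have h2 := prob_le_shift (x - B^-1) mS' mS Id' B0; rewrite sw subrK in h2.
have h3 := H (x + B^-1); have h4 := H (x - B^-1).
have p1 := Phi_lip x Bi; have p2 := Phi_lip (x - B^-1) Bi; rewrite subrK in p2.
move: h1 h2 h3 h4 p1 p2 Bi.
move: (fine (mu [set u | S u < x * B])) (fine (mu [set u | S' u < (x + B^-1) * B]))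
  (fine (mu [set u | S' u < (x - B^-1) * B])) (Ex mu _) (Phi x) (Phi (x + B^-1))
  (Phi (x - B^-1)) (B^-1) => a b c e p q t i.
by rewrite !ler_norml; lra.
Qed.

Section SecondMoments.
Context d (T : measurableType d) (R : realType) (P : probability T R).
Variables S S' : T -> R.
Hypothesis IS : Int P (fun u => S u ^+ 2).
Hypothesis IS' : Int P (fun u => S' u ^+ 2).
Hypothesis Id : Int P (fun u => (S u - S' u) ^+ 2).

Lemma Ex_sqr_half :
  Ex P (fun u => S u ^+ 2) / 2 - Ex P (fun u => (S u - S' u) ^+ 2) <=
  Ex P (fun u => S' u ^+ 2).
Proof.
rewrite [_ / 2]mulrC -ExZ// -ExB//; last exact: IntZ.
apply: Ex_le => // [|u]; first by apply: IntB => //; exact: IntZ.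
have := sqr_ge0 (S u - 2 * S' u); move: (S u) (S' u) => a b.
by rewrite !expr2; lra.
Qed.

Lemma Ex_sqr_dist l : 0 < l ->
  `|Ex P (fun u => S' u ^+ 2) - Ex P (fun u => S u ^+ 2)| <=
  2 * l * Ex P (fun u => S u ^+ 2) + (2 / l + 1) * Ex P (fun u => (S u - S' u) ^+ 2).
Proof.
move=> l0; rewrite -ExB//.
have Isub : Int P (fun u => S' u ^+ 2 - S u ^+ 2) by exact: IntB.
apply: le_trans (Ex_abs Isub) _; rewrite -!ExZ// -ExD; [|exact: IntZ..].
apply: Ex_le => [||u]; [exact: Int_abs|by apply: IntD; exact: IntZ|].
have := mul_le_weight (S u - S' u) (S u) l0.
have -> : S' u ^+ 2 - S u ^+ 2 = (S u - S' u) ^+ 2 - 2 * ((S u - S' u) * S u) by ring.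
have := sqr_ge0 (S u - S' u).
move: ((S u - S' u) ^+ 2) ((S u - S' u) * S u) (S u ^+ 2) => x y w x0 h.
apply: le_trans (ler_normB _ _) _; rewrite (ger0_norm x0) normrM ger0_norm//.
have -> : 2 * l * w + (2 / l + 1) * x = x + 2 * (x / l + l * w) by ring.
by rewrite lerD2l ler_wpM2l.
Qed.

End SecondMoments.

(** A window of logarithmic length makes a geometric truncation error
    polynomially small. *)
Lemma log_window (R : realType) (s : R) : 0 < s < 1 -> exists a : R, 0 < a /\
  forall n, (2 <= n)%N -> exists m, [/\ (0 < m)%N, s ^+ m * n%:R ^+ 2 <= 1 &
    m%:R <= a * ln n%:R].
Proof.
move=> s01; have /andP[s0 _] := s01.
have ls : 0 < - ln s by rewrite oppr_gt0 ln_lt0.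
have l2 : 0 < ln 2 :> R by rewrite ln_gt0// ltr1n.
have il2 : 0 < (ln 2)^-1 :> R by rewrite invr_gt0.
exists (2 / - ln s + (ln 2)^-1); split; first by rewrite addr_gt0 ?divr_gt0.
move=> n n2; have n0 : 0 < n%:R :> R by rewrite ltr0n; lia.
have lnn : ln 2 <= ln n%:R :> R by rewrite ler_ln ?posrE// ler_nat.
have ln0 : 0 < ln n%:R :> R by exact: lt_le_trans lnn.
pose y : R := 2 * ln n%:R / - ln s.
have y0 : 0 <= y by rewrite divr_ge0 ?mulr_ge0// ltW.
have /andP[t1 t2] := truncn_itv y0.
exists (Num.truncn y).+1; split=> //.
  rewrite -ler_ln ?posrE ?mulr_gt0 ?exprn_gt0// ln1 lnM ?posrE ?exprn_gt0//.
  rewrite !lnXn// -[ln s *+ _]mulr_natl -[ln n%:R *+ 2]mulr_natl.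
  have : 2 * ln n%:R < (Num.truncn y).+1%:R * - ln s by rewrite -ltr_pdivrMr.
  by rewrite mulrN; move: (_ * ln s) => t; lra.
rewrite -natr1 mulrDl; apply: lerD; first by apply: le_trans t1 _; rewrite /y mulrAC.
by rewrite ler_pdivlMl// mulr1.
Qed.

Lemma dist_ratio (R : realType) (a b : R) : 0 < b -> `|a / b - 1| = `|a - b| / b.
Proof.
by move=> b0; rewrite -[1](@divff _ b) ?gt_eqF// -mulrBl normrM normfV (gtr0_norm b0).
Qed.

Lemma half_arith (R : realType) (x1 x2 x3 N c c' l : R) : x2 <= c' ->
  l / 2 * N <= x3 -> c <= l / 8 * N -> c' <= c -> x3 / 2 - x2 <= x1 -> l / 8 * N <= x1.
Proof. by lra. Qed.

(** With [d] the squared distance of the sums and [ds] the difference of their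
    second moments, [l = w^-1] in [Ex_sqr_dist] gives a relative error of order
    [w^-1] on the variance, as [d] is of order [w ^- 4]. *)
Lemma tail_arith (R : realType) (l C1 w B2 B d ds bc m : R) :
  0 < l -> 0 <= C1 -> 1 <= w -> l / 2 * w ^+ 2 <= B2 -> B ^+ 2 = B2 -> 0 < B ->
  0 <= d -> d <= C1 / w ^+ 4 ->
  ds <= 2 * w^-1 * B2 + (2 / w^-1 + 1) * d ->
  2 * (ds / B2) + bc * (m / w) + B^-1 + d <=
  (4 + 12 * C1 / l + Num.sqrt (2 / l) + C1) / w + bc * (m / w).
Proof.
move=> l0 C0 w1 lB BB B0 d0 dC dsB.
have w0 : 0 < w by lra.
have iw1 : w^-1 <= 1 by rewrite invf_le1.
have iw0 : 0 < w^-1 by rewrite invr_gt0.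
have B20 : 0 < B2 by rewrite -BB exprn_gt0.
have iB : B2^-1 <= (l / 2 * w ^+ 2)^-1.
  by rewrite lef_pV2// posrE// mulr_gt0 ?divr_gt0 ?exprn_gt0.
have iB1 : B^-1 <= Num.sqrt (2 / l) / w.
  rewrite -(@ler_pXn2r _ 2) ?nnegrE ?divr_ge0 ?sqrtr_ge0 ?invr_ge0 ?(ltW B0) ?(ltW w0)//.
  rewrite exprVn BB expr_div_n sqr_sqrtr ?divr_ge0 ?(ltW l0)//.
  by apply: le_trans iB _; rewrite invfM invf_div.
have iw4 : w^-1 ^+ 4 <= w^-1.
  by rewrite -[X in _ <= X]expr1 ler_wiXn2l// ltW.
have iw5 : w^-1 ^+ 5 <= w^-1.
  by rewrite -[X in _ <= X]expr1 ler_wiXn2l// ltW.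
have dC1 : d <= C1 / w.
  by apply: le_trans dC _; rewrite ler_wpM2l// -exprVn.
have h : ds / B2 <= 2 / w + 6 * C1 / l / w.
  apply: (@le_trans _ _ ((2 * w^-1 * B2 + 3 * w * (C1 / w ^+ 4)) / B2)).
    rewrite ler_wpM2r ?invr_ge0 ?(ltW B20)//; apply: le_trans dsB _; rewrite lerD2l.
    by apply: ler_pM => //; rewrite invrK ?addr_ge0 ?mulr_ge0//; lra.
  rewrite mulrDl mulfK ?gt_eqF// lerD2l.
  have c0 : 0 <= 3 * w * (C1 / w ^+ 4).
    by rewrite mulr_ge0 ?divr_ge0 ?exprn_ge0// ?mulr_ge0// ltW.
  apply: le_trans (ler_wpM2l c0 iB) _.
  have -> : 3 * w * (C1 / w ^+ 4) / (l / 2 * w ^+ 2) = 6 * C1 / l * w^-1 ^+ 5.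
    by field; rewrite !gt_eqF.
  by rewrite ler_wpM2l// divr_ge0 ?mulr_ge0// ltW.
have -> : (4 + 12 * C1 / l + Num.sqrt (2 / l) + C1) / w =
   2 * (2 / w + 6 * C1 / l / w) + Num.sqrt (2 / l) / w + C1 / w by ring.
by move: h iB1 dC1; lra.
Qed.

Section Functional.
Context (R : realType) (mu : probability (seqsp R) R) (nu : probability R R).
Hypothesis mu_iid : iid_law mu nu.
Variables (z : seqsp R -> R) (zm : nat -> seqsp R -> R) (s K : R).
Hypothesis s01 : 0 < s < 1.
Hypothesis z_meas : measurable_fun setT z.
Hypothesis z_int : Int mu (fun u => `|z u| ^+ 3).
Hypothesis z_mean : Ex mu z = 0.
Hypothesis zm_meas : forall m, measurable_fun setT (zm m).
Hypothesis zm_dep : forall m, dep (fun i => i <= m)%N (zm m).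
Hypothesis dz_int : forall m, Int mu (fun u => `|z u - zm m u| ^+ 3).
Hypothesis dz_le : forall m, Ex mu (fun u => `|z u - zm m u| ^+ 3) <= K * s ^+ (3 * m).

Local Notation E := (Ex mu).

Definition shifted j := z \o shift (R := R) j.
Local Notation T := (block_sum shifted).

Lemma measurable_shifted j : measurable_fun setT (shifted j).
Proof. by apply: measurableT_comp => //; exact: measurable_shift. Qed.

Lemma shifted_int j : Int mu (fun u => `|shifted j u| ^+ 3).
Proof. exact: (Int_shift mu_iid j z_int). Qed.

Lemma shifted0 : shifted 0 = z.
Proof. by apply/funext => u; congr z; apply/funext => i; rewrite /shift addn0. Qed.

Let Iz : Int mu z.
Proof. by have := Int_xi measurable_shifted shifted_int 0; rewrite shifted0. Qed.

Lemma shifted_mean j : E (shifted j) = 0.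
Proof. by rewrite (Ex_shift mu_iid). Qed.

Lemma block_sum_shift a b j u : T (a + j) (b + j) u = T a b (shift j u).
Proof.
rewrite /block_sum big_addn addnK.
by apply: eq_bigr => i _; rewrite /shifted/= shift_shift.
Qed.

Definition sum_var n := E (fun u => T 0 n u * T 0 n u).

Lemma sum_var_shift a N : E (fun u => T a (a + N) u * T a (a + N) u) = sum_var N.
Proof.
have := Ex_shift mu_iid a (Int_block_sumM measurable_shifted shifted_int 0 N 0 N).
rewrite /sum_var => <-; congr Ex; apply/funext => u /=.
by rewrite -!block_sum_shift !add0n addnC.
Qed.

Let Idz m : Int mu (fun u => z u - zm m u).
Proof.
apply: (@Int_dom _ _ _ _ _ (fun u => 1 + `|z u - zm m u| ^+ 3)) => //.
- exact: measurable_funB.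
- by apply: IntD; [exact: Int_cst|exact: dz_int].
- by move=> u; exact: norm_le1_cube.
Qed.
Let s0 : 0 < s. Proof. by case/andP: s01. Qed.

Let K0 : 0 <= K.
Proof.
have := dz_le 0; rewrite muln0 expr0 mulr1; apply: le_trans.
by apply: Ex_ge0 => u; rewrite exprn_ge0.
Qed.

Let Idz2 m : Int mu (fun u => (z u - zm m u) ^+ 2).
Proof.
apply: (@Int_dom _ _ _ _ _ (fun u => 1 + `|z u - zm m u| ^+ 3)) => //.
- by apply: measurable_funX; exact: measurable_funB.
- by apply: IntD; [exact: Int_cst|exact: dz_int].
- by move=> u; rewrite ger0_norm ?sqr_ge0//; exact: sqr_le1_cube.
Qed.

(** At the level [s ^+ m] both terms of [sqr_le_cube] are of order
    [s ^+ (2 * m)]. *)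
Lemma dz_sq m : E (fun u => (z u - zm m u) ^+ 2) <= (1 + K) * s ^+ (2 * m).
Proof.
pose l := s ^+ m; have l0 : 0 < l by rewrite exprn_gt0.
apply: (@le_trans _ _ (E (fun u => l ^+ 2 + l^-1 * `|z u - zm m u| ^+ 3))).
  apply: Ex_le => // [|u]; first by apply: IntD; [exact: Int_cst|exact: IntZ].
  by rewrite mulrC; exact: sqr_le_cube.
rewrite ExD; [|exact: Int_cst|exact: IntZ].
rewrite Ex_cst ExZ//; have := dz_le m; move: (E _) => x xK.
have -> : (1 + K) * s ^+ (2 * m) = l ^+ 2 + l^-1 * (K * s ^+ (3 * m)).
  rewrite /l ![(_ * m)%N]mulnC !exprM; field.
  by rewrite expf_neq0// gt_eqF.
by rewrite lerD2l ler_wpM2l// invr_ge0 ltW.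
Qed.

Definition acov k := E (fun u => z u * shifted k u).

Let F := E (fun u => z u ^+ 2).

Let Iz2 : Int mu (fun u => z u ^+ 2).
Proof. by have := Int_xi2 measurable_shifted shifted_int 0 0; rewrite shifted0. Qed.

Let Izm m : Int mu (zm m).
Proof.
have -> : zm m = fun u => z u - (z u - zm m u) by apply/funext => u; ring.
exact: IntB.
Qed.

(** [zm k] only sees the first [k + 1] coordinates, which do not enter the
    observation shifted by [k + 1]; only [z - zm k] can be correlated with it. *)
Lemma acov_le k : `|acov k.+1| <= (1 + K + F) * s ^+ k.
Proof.
pose y := shifted k.+1.
have Iy : Int mu y := Int_xi measurable_shifted shifted_int k.+1.
have Iy2 : Int mu (fun u => y u ^+ 2) := Int_xi2 measurable_shifted shifted_int k.+1 k.+1.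
have [Izy Ezy] : Int mu (fun u => zm k u * y u) /\ E (fun u => zm k u * y u) = E (zm k) * E y.
  have dz : dep predT z by move=> v u vu; congr z; apply/funext => i; exact: vu.
  have dy := dep_shift (j := k.+1) dz.
  refine (dep_mul mu_iid _ (@zm_dep k) dy (Izm k) Iy) => i ik; rewrite andbT.
  by rewrite ltnNge ik.
have Idy : Int mu (fun u => (z u - zm k u) * y u).
  have -> : (fun u => (z u - zm k u) * y u) = fun u => z u * y u - zm k u * y u.
    by apply/funext => u; ring.
  apply: IntB => //.
  by have := Int_xi2 measurable_shifted shifted_int 0 k.+1; rewrite shifted0.
have -> : acov k.+1 = E (fun u => (z u - zm k u) * y u).
  have -> : acov k.+1 = E (fun u => (z u - zm k u) * y u + zm k u * y u).
    by congr Ex; apply/funext => u; rewrite -/(y u); ring.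
  by rewrite ExD// Ezy shifted_mean mulr0 addr0.
pose l := s ^+ k; have l0 : 0 < l by rewrite exprn_gt0.
apply: le_trans (Ex_abs Idy) _.
apply: (@le_trans _ _ (E (fun u => l^-1 * (z u - zm k u) ^+ 2 + l * y u ^+ 2))).
  apply: Ex_le => [||u]; [exact: Int_abs|by apply: IntD; exact: IntZ|].
  rewrite [l^-1 * _]mulrC; exact: mul_le_weight.
rewrite ExD; [|exact: IntZ|exact: IntZ].
rewrite !ExZ//.
have -> : E (fun u => y u ^+ 2) = F by rewrite /F -(Ex_shift mu_iid k.+1 Iz2).
rewrite mulrDl [F * _]mulrC lerD2r ler_pdivrMl//.
apply: le_trans (dz_sq k) _.
by rewrite mulrCA -exprD addnn mul2n.
Qed.

Let incr n := acov 0 + 2 * series (fun k => acov k.+1) n.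

(** By stationarity, adding the term 0 to a sum of terms 1 to [n] adds the
    covariances at lags 0 to [n]. *)
Lemma sum_varS n : sum_var n.+1 = sum_var n + incr n.
Proof.
have Io a b := Int_block_sumM measurable_shifted shifted_int a b a b.
have Izt j : Int mu (fun u => z u * shifted j u).
  by have := Int_xi2 measurable_shifted shifted_int 0 j; rewrite shifted0.
have ztE : (fun u => z u * T 1 n.+1 u) = fun u => \sum_(1 <= j < n.+1) z u * shifted j u.
  by apply/funext => u; rewrite /block_sum mulr_sumr.
have Ezt : E (fun u => z u * T 1 n.+1 u) = series (fun k => acov k.+1) n.
  by rewrite ztE Ex_sum//= /series/= big_add1.
have IzT : Int mu (fun u => z u * T 1 n.+1 u) by rewrite ztE; apply: Int_sum.
have -> : sum_var n.+1 = E (fun u => (z u * shifted 0 u + 2 * (z u * T 1 n.+1 u)) +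
    T 1 (1 + n) u * T 1 (1 + n) u).
  congr Ex; apply/funext => u; have -> : T 0 n.+1 u = z u + T 1 n.+1 u.
    by rewrite /block_sum big_ltn// shifted0.
  by rewrite shifted0 add1n; move: (T 1 _ u) (z u) => x y; ring.
rewrite ExD//; [|by apply: IntD => //; exact: IntZ].
rewrite ExD//; [|exact: IntZ].
by rewrite ExZ// Ezt sum_var_shift addrC.
Qed.

(** The autocovariances are summable, so the increments of [sum_var] converge,
    and so do their Cesaro means. *)
Lemma cvg_sum_var : exists l : R, 0 <= l /\ sum_var n / n%:R @[n --> \oo] --> l.
Proof.
have /andP[_ s1] := s01; have s_ge0 := ltW s0.
have F0 : 0 <= F by apply: Ex_ge0 => u; exact: sqr_ge0.
have cvg_cov : cvgn (series (fun k => acov k.+1)).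
  apply: normed_cvg; apply: (@series_le_cvg _ _ (geometric (1 + K + F) s)).
  - by move=> n; exact: normr_ge0.
  - by move=> n /=; rewrite mulr_ge0 ?exprn_ge0 ?addr_ge0.
  - by move=> n /=; exact: acov_le.
  - by apply: is_cvg_geometric_series; rewrite ger0_norm.
pose l := acov 0 + 2 * limn (series (fun k => acov k.+1)).
have ci : incr n @[n --> \oo] --> l.
  by apply: cvgD; [exact: cvg_cst|apply: cvgM => //; exact: cvg_cst].
have vE n : series incr n = sum_var n.
  elim: n => [|n IH]; last by rewrite /series/= big_nat_recr//= sum_varS -IH.
  rewrite /series/= big_geq// -[LHS](Ex_cst mu); congr Ex; apply/funext => u.
  by rewrite /block_sum big_geq// mul0r.
have cv : sum_var n / n%:R @[n --> \oo] --> l.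
  rewrite -cvg_shiftS; have := cesaro ci; rewrite /arithmetic_mean/=.
  by under eq_fun do rewrite vE mulrC.
exists l; split=> //; rewrite -(cvg_lim _ cv)//; apply: limr_ge.
  by apply/cvg_ex; exists l.
near=> n; rewrite divr_ge0//; apply: Ex_ge0 => u; exact: sqr_ge0.
Unshelve. all: by end_near.
Qed.

(** The truncated observations are centred again, as the expansions need
    centred summands. *)
Definition truncated m j := (fun u => zm m u - E (zm m)) \o shift (R := R) j.

Let mtr m j : measurable_fun setT (truncated m j).
Proof.
apply: (@measurableT_comp _ _ _ _ _ _ (fun u => zm m u - E (zm m))).
  exact: measurable_funB.
exact: measurable_shift.
Qed.

Let Itr m : Int mu (fun u => zm m u - E (zm m)).
Proof. by apply: IntB => //; exact: Int_cst. Qed.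

Lemma truncated_dep m j : dep (fun i => j <= i <= j + m)%N (truncated m j).
Proof.
have d0 : dep (fun i => i <= m)%N (fun u => zm m u - E (zm m)).
  by move=> v u vu; rewrite (@zm_dep m v u vu).
by apply: sub_dep (dep_shift (j := j) d0) => i; lia.
Qed.

Lemma truncated_mean m j : E (truncated m j) = 0.
Proof.
by rewrite (Ex_shift mu_iid)// ExB ?Ex_cst ?subrr//; exact: Int_cst.
Qed.

Let E_zm m : E (zm m) = - E (fun u => z u - zm m u).
Proof. by rewrite ExB// z_mean sub0r opprK. Qed.

Let dz_le_K m : E (fun u => `|z u - zm m u| ^+ 3) <= K.
Proof.
apply: le_trans (dz_le m) _; rewrite ler_piMr// exprn_ile1 ?ltW//.
by case/andP: s01.
Qed.

Lemma E_zm_le m : `|E (zm m)| <= 1 + K.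
Proof.
rewrite E_zm normrN; apply: le_trans (Ex_abs _) _ => //.
apply: (@le_trans _ _ (E (fun u => 1 + `|z u - zm m u| ^+ 3))).
  apply: Ex_le => [||u]; [exact: Int_abs| |exact: norm_le1_cube].
  by apply: IntD => //; exact: Int_cst.
by rewrite ExD// ?Ex_cst ?lerD2l//; exact: Int_cst.
Qed.

Let A := E (fun u => `|z u| ^+ 3).

Let mom : R := 16 * (A + K) + 4 * (1 + K) ^+ 3 + 1.

Let trunc_mom0 m : Int mu (fun u => `|zm m u - E (zm m)| ^+ 3) /\
  E (fun u => `|zm m u - E (zm m)| ^+ 3) <= mom.
Proof.
have Ib : Int mu (fun u => (16 * `|z u| ^+ 3 + 16 * `|z u - zm m u| ^+ 3) + 4 * (1 + K) ^+ 3).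
  by apply: IntD; [apply: IntD; exact: IntZ|exact: Int_cst].
have bd u : `|zm m u - E (zm m)| ^+ 3 <=
    (16 * `|z u| ^+ 3 + 16 * `|z u - zm m u| ^+ 3) + 4 * (1 + K) ^+ 3.
  have h1 := cube_add (zm m u) (- E (zm m)); rewrite normrN in h1.
  have := cube_add (z u) (- (z u - zm m u)); rewrite normrN.
  have -> : z u + - (z u - zm m u) = zm m u by ring.
  have h3 : `|E (zm m)| ^+ 3 <= (1 + K) ^+ 3.
    by rewrite ler_pXn2r ?nnegrE ?addr_ge0// E_zm_le.
  move: h1 h3; move: (`|zm m u - E (zm m)| ^+ 3) (`|zm m u| ^+ 3) (`|E (zm m)| ^+ 3) ((1 + K) ^+ 3) (`|z u| ^+ 3) (`|z u - zm m u| ^+ 3) => a b c d x y; lra.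
have It : Int mu (fun u => `|zm m u - E (zm m)| ^+ 3).
  apply: (Int_dom _ Ib) => [|u]; last by rewrite ger0_norm ?exprn_ge0.
  apply: measurable_funX; apply: measurableT_comp => //; exact: measurable_funB.
split=> //; apply: le_trans (Ex_le It Ib bd) _.
rewrite ExD; [|by apply: IntD; exact: IntZ|exact: Int_cst].
rewrite Ex_cst ExD; [|exact: IntZ|exact: IntZ].
rewrite !ExZ// /mom -/A; have := dz_le_K m; move: (E _) A ((1 + K) ^+ 3) => x y w; lra.
Qed.

Lemma truncated_int m j : Int mu (fun u => `|truncated m j u| ^+ 3).
Proof. by have [I3 _] := trunc_mom0 m; exact: (Int_shift mu_iid j I3). Qed.

Lemma truncated_mom m j : E (fun u => `|truncated m j u| ^+ 3) <= mom.
Proof. by have [I3 ?] := trunc_mom0 m; rewrite (Ex_shift mu_iid j I3). Qed.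

Lemma truncated_sum_err m a N :
  Int mu (fun u => (T a (a + N) u - block_sum (truncated m) a (a + N) u) ^+ 2) /\
  E (fun u => (T a (a + N) u - block_sum (truncated m) a (a + N) u) ^+ 2) <=
  N%:R ^+ 2 * ((1 + K) * s ^+ (2 * m)).
Proof.
pose dl u := (z u - zm m u) - E (fun u => z u - zm m u).
have dlE j u : shifted j u - truncated m j u = dl (shift j u).
  by rewrite /truncated /shifted /dl/= E_zm; move: (E _) => x; ring.
have Idl2 : Int mu (fun u => dl u ^+ 2) /\ E (fun u => dl u ^+ 2) <= (1 + K) * s ^+ (2 * m).
  pose e := E (fun u => z u - zm m u).
  have -> : (fun u => dl u ^+ 2) =
      fun u => ((z u - zm m u) ^+ 2 + (- (2 * e)) * (z u - zm m u)) + e ^+ 2.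
    by apply/funext => u; rewrite /dl -/e; ring.
  split; first by apply: IntD; [apply: IntD => //; exact: IntZ|exact: Int_cst].
  rewrite ExD; [|by apply: IntD => //; exact: IntZ|exact: Int_cst].
  rewrite Ex_cst ExD//; last exact: IntZ.
  rewrite ExZ// -/e; have := dz_sq m; move: (E _) (_ * s ^+ _) => x y.
  by have := sqr_ge0 e; move: e => e; rewrite !expr2; lra.
case: Idl2 => Idl2 Edl2.
have sumE u : T a (a + N) u - block_sum (truncated m) a (a + N) u =
    \sum_(a <= j < a + N) dl (shift j u).
  by rewrite /block_sum -sumrB; apply: eq_bigr => j _; exact: dlE.
have bd u : (T a (a + N) u - block_sum (truncated m) a (a + N) u) ^+ 2 <=
    N%:R * \sum_(a <= j < a + N) dl (shift j u) ^+ 2.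
  rewrite sumE; apply: le_trans (sqr_sum_le _ _) _.
  by rewrite size_iota addKn.
have Ish j : Int mu (fun u => dl (shift j u) ^+ 2) := Int_shift mu_iid j Idl2.
have Ib : Int mu (fun u => N%:R * \sum_(a <= j < a + N) dl (shift j u) ^+ 2).
  by apply: IntZ; apply: Int_sum.
have It : Int mu (fun u => (T a (a + N) u - block_sum (truncated m) a (a + N) u) ^+ 2).
  apply: (Int_dom _ Ib) => [|u]; last by rewrite ger0_norm ?sqr_ge0.
  apply: measurable_funX; apply: measurable_funB; first exact: measurable_block_sum measurable_shifted _ _.
  exact: measurable_block_sum (mtr m) _ _.
split=> //; apply: le_trans (Ex_le It Ib bd) _.
rewrite ExZ; last by apply: Int_sum.
rewrite Ex_sum// expr2 -mulrA ler_wpM2l//.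
apply: (@le_trans _ _ (\sum_(a <= j < a + N) ((1 + K) * s ^+ (2 * m)))).
  by apply: ler_sum => j _; rewrite (Ex_shift mu_iid j Idl2).
by rewrite sumr_const_nat addKn mulr_natl.
Qed.

Lemma sum_var_lower (l : R) : 0 < l -> sum_var n / n%:R @[n --> \oo] --> l ->
  exists n1, forall N, (n1 <= N)%N -> l / 2 * N%:R <= sum_var N.
Proof.
move=> l0 cv; have : \forall n \near \oo, l / 2 <= sum_var n / n%:R.
  by apply: (cvgr_ge _ cv); rewrite ltr_pdivrMr// ltr_pMr// ltr1n.
case=> n1 _ H; exists n1.+1 => N N1; have := H N (ltnW N1).
by rewrite /= ler_pdivlMr// ltr0n; lia.
Qed.

(** With a window of order [ln n] the truncated sums differ from the original
    ones by a power of [n^-1] in mean square, hence have comparable variances on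
    all long blocks, and [berry_esseen] applies to them with an error of order
    [m ^+ 2 / sqrt n]. *)
Theorem functional_berry_esseen (l : R) : 0 < l -> sum_var n / n%:R @[n --> \oo] --> l ->
  exists C : R, 0 < C /\ forall (n : nat) (x : R), (2 <= n)%N ->
    `|fine (mu [set u | T 0 n u < x * Num.sqrt (sum_var n)]) - Phi x| <=
    C * (ln n%:R ^+ 2 / Num.sqrt n%:R).
Proof.
move=> l0 cv; have [n1 low] := sum_var_lower l0 cv.
have [a [a0 win]] := log_window s01.
pose C1 := 1 + K; have C1_ge0 : 0 <= C1 by rewrite addr_ge0.
pose v := l / 8; have v0 : 0 < v by rewrite divr_gt0.
(* from this length on the variance of a block is at least [4 v] per term and
   dominates the truncation error *)
pose n0 := maxn n1 (Num.truncn (C1 / v)).+1.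
have A0 : 0 <= A by apply: Ex_ge0 => u; rewrite exprn_ge0.
have mom1 : 1 <= mom.
  by rewrite /mom lerDr addr_ge0// mulr_ge0 ?exprn_ge0 ?addr_ge0.
pose bc := be_const v mom n0.
pose C2 := 4 + 12 * C1 / l + Num.sqrt (2 / l) + C1.
have C20 : 0 <= C2.
  by rewrite !addr_ge0 ?sqrtr_ge0// divr_ge0 ?mulr_ge0// ltW.
have l2 : 0 < ln 2 :> R by rewrite ln_gt0// ltr1n.
pose cst := (C2 + Num.sqrt n0%:R) / ln 2 ^+ 2 + `|bc| * a ^+ 2 + 1.
have cst0 : 0 < cst.
  rewrite /cst ltr_pwDr// addr_ge0//; last by rewrite mulr_ge0 ?exprn_ge0 ?(ltW a0).
  apply: divr_ge0; last exact: sqr_ge0.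
  by apply: addr_ge0; last exact: sqrtr_ge0.
exists cst; split=> // n x n2; have n_gt0 : (0 < n)%N := ltnW n2.
have [m [m0 sm ma]] := win n n2.
pose w : R := Num.sqrt n%:R; rewrite -/w.
have w0 : 0 < w by rewrite sqrtr_gt0 ltr0n.
have w2 : w ^+ 2 = n%:R by rewrite sqr_sqrtr.
have w1 : 1 <= w by rewrite -sqrtr1 ler_wsqrtr// ler1n.
have lnn : ln 2 <= ln n%:R :> R by rewrite ler_ln ?posrE ?ltr0n ?ler_nat//.
have L1 : 1 <= ln n%:R ^+ 2 / ln 2 ^+ 2 :> R.
  rewrite ler_pdivlMr ?exprn_gt0// mul1r ler_pXn2r ?nnegrE ?(ltW l2)//.
  exact: le_trans (ltW l2) lnn.
have cstE : cst * (ln n%:R ^+ 2 / w) =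
   (C2 + Num.sqrt n0%:R) / w * (ln n%:R ^+ 2 / ln 2 ^+ 2) +
   `|bc| * ((a * ln n%:R) ^+ 2 / w) + ln n%:R ^+ 2 / w.
  by rewrite /cst; field; rewrite !gt_eqF.
have last0 : 0 <= ln n%:R ^+ 2 / w by rewrite divr_ge0 ?sqr_ge0 ?ltW.
have mS N : measurable_fun setT (T 0 N) := measurable_block_sum measurable_shifted 0 N.
have [nn0|n0n] := ltnP n n0.
  apply: (@le_trans _ _ 1).
    have mA : measurable [set u | T 0 n u < x * Num.sqrt (sum_var n)].
      have -> : [set u | T 0 n u < x * Num.sqrt (sum_var n)] =
          setT `&` T 0 n @^-1` `]-oo, x * Num.sqrt (sum_var n)[%classic.
        by rewrite setTI; apply/seteqP; split=> u /=; rewrite in_itv.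
      by apply: mS => //; exact: measurable_itv.
    have p1 := fine_prob_le1 mu mA.
    have p0 : 0 <= fine (mu [set u | T 0 n u < x * Num.sqrt (sum_var n)]) by rewrite fine_ge0.
    have := Phi01 x; move: (fine _) (Phi x) p0 p1 => p q p0 p1; rewrite ler_norml; lra.
  have wn : 1 <= (C2 + Num.sqrt n0%:R) / w.
    rewrite ler_pdivlMr// mul1r; apply: (@le_trans _ _ (Num.sqrt n0%:R)); last by rewrite lerDr.
    by apply: ler_wsqrtr; rewrite ler_nat ltnW.
  rewrite cstE -addrA; apply: (@le_trans _ _ ((C2 + Num.sqrt n0%:R) / w * (ln n%:R ^+ 2 / ln 2 ^+ 2))).
    by rewrite -[X in X <= _]mulr1 ler_pM.
  by rewrite lerDl addr_ge0// mulr_ge0// divr_ge0 ?sqr_ge0 ?(ltW w0).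
have IT b N : Int mu (fun u => T b (b + N) u ^+ 2) := Int_block_sumM measurable_shifted shifted_int b (b + N) b (b + N).
have IT' b N : Int mu (fun u => block_sum (truncated m) b (b + N) u ^+ 2) :=
  Int_block_sumM (mtr m) (truncated_int m) b (b + N) b (b + N).
have err b N : (N <= n)%N -> Int mu (fun u => (T b (b + N) u - block_sum (truncated m) b (b + N) u) ^+ 2) /\
    E (fun u => (T b (b + N) u - block_sum (truncated m) b (b + N) u) ^+ 2) <= C1 / n%:R ^+ 2.
  move=> Nn; have [I2 E2] := truncated_sum_err m b N; split=> //; apply: le_trans E2 _.
  have nn : 0 < n%:R :> R by rewrite ltr0n.
  rewrite ler_pdivlMr ?exprn_gt0//.
  have -> : N%:R ^+ 2 * ((1 + K) * s ^+ (2 * m)) * n%:R ^+ 2 =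
     C1 * (s ^+ m * (N%:R * n%:R)) ^+ 2 by rewrite mulnC exprM /C1; ring.
  rewrite -[X in _ <= X]mulr1 ler_wpM2l// exprn_ile1//.
    by rewrite !mulr_ge0 ?exprn_ge0 ?(ltW s0).
  apply: le_trans sm; rewrite ler_wpM2l ?exprn_ge0 ?(ltW s0)//.
  by rewrite expr2 ler_wpM2r// ler_nat.
have xi_var b N : (n0 <= N <= n)%N ->
    v * N%:R <= E (fun u => block_sum (truncated m) b (b + N) u * block_sum (truncated m) b (b + N) u).
  move=> /andP[n0N Nn]; have [I2 E2] := err b N Nn.
  have := Ex_sqr_half (IT b N) (IT' b N) I2.
  have -> : E (fun u => T b (b + N) u ^+ 2) = sum_var N := sum_var_shift b N.
  have vl : l / 2 * N%:R <= sum_var N by apply: low; apply: leq_trans n0N; exact: leq_maxl.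
  have C1n : C1 / n%:R ^+ 2 <= C1.
    by rewrite ler_pdivrMr ?exprn_gt0 ?ltr0n ?ler_peMr ?exprn_ege1 ?ler1n//.
  have C1v : C1 <= v * N%:R.
    rewrite mulrC -ler_pdivrMr//.
    have cv0 : 0 <= C1 / v by rewrite divr_ge0 ?(ltW v0).
    have /andP[_ /ltW] := truncn_itv cv0; move=> /le_trans; apply.
    by rewrite ler_nat; apply: leq_trans n0N; exact: leq_maxr.
  have -> : (fun u => block_sum (truncated m) b (b + N) u * block_sum (truncated m) b (b + N) u) =
    (fun u => block_sum (truncated m) b (b + N) u ^+ 2) by apply/funext => u; rewrite expr2.
  exact: (half_arith E2 vl C1v C1n).
have vn : l / 2 * n%:R <= sum_var n by apply: low; apply: leq_trans n0n; exact: leq_maxl.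
have var0 : 0 < sum_var n.
  by apply: lt_le_trans vn; rewrite mulr_gt0 ?divr_gt0// ltr0n.
pose B := Num.sqrt (sum_var n); have B0 : 0 < B by rewrite sqrtr_gt0.
have BB : B ^+ 2 = sum_var n by rewrite sqr_sqrtr// ltW.
have vB : v * n%:R <= B ^+ 2.
  rewrite BB; apply: le_trans vn; rewrite ler_wpM2r// /v; lra.
have be y := berry_esseen y mu_iid m0 mom1 (mtr m) (truncated_dep (m := m)) (truncated_int m)
  (truncated_mom m) (truncated_mean m) v0 xi_var n_gt0 B0 vB.
have [I2 E2] := err 0%N n (leqnn n); rewrite add0n in I2 E2.
have mS' : measurable_fun setT (block_sum (truncated m) 0 n) := measurable_block_sum (mtr m) 0 n.
have tr := prob_transfer (mS n) mS' I2 B0 be x.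
rewrite -/B; apply: le_trans tr _.
have iw0 : 0 < w^-1 by rewrite invr_gt0.
have := IT 0%N n; have := IT' 0%N n; rewrite add0n => IT'n ITn.
have dist := Ex_sqr_dist ITn IT'n I2 iw0.
have -> : `|E (fun u => block_sum (truncated m) 0 n u * block_sum (truncated m) 0 n u) / B ^+ 2 - 1| =
   `|E (fun u => block_sum (truncated m) 0 n u ^+ 2) - E (fun u => T 0 n u ^+ 2)| / B ^+ 2.
  have -> : E (fun u => T 0 n u ^+ 2) = B ^+ 2 by rewrite BB.
  by apply: dist_ratio; rewrite exprn_gt0.
rewrite -w2 -exprM in E2.
have d0 : 0 <= E (fun u => (T 0 n u - block_sum (truncated m) 0 n u) ^+ 2).
  by apply: Ex_ge0 => u; exact: sqr_ge0.
have vn' : l / 2 * w ^+ 2 <= B ^+ 2 by rewrite w2 BB.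
have varE : E (fun u => T 0 n u ^+ 2) = B ^+ 2 by rewrite BB.
rewrite {2}varE in dist.
have ta := tail_arith bc (m%:R ^+ 2) l0 C1_ge0 w1 vn' erefl B0 d0 E2 dist.
apply: le_trans ta _; rewrite -/C2 cstE -[X in X <= _]addr0; apply: lerD => //.
apply: lerD.
  rewrite -[X in X <= _]mulr1; apply: ler_pM => //; first by rewrite divr_ge0// ltW.
  by rewrite ler_wpM2r ?(ltW iw0)// lerDl sqrtr_ge0.
apply: (@le_trans _ _ (`|bc| * (m%:R ^+ 2 / w))).
  by rewrite ler_wpM2r ?ler_norm// divr_ge0 ?sqr_ge0 ?(ltW w0).
rewrite ler_wpM2l// ler_wpM2r ?(ltW iw0)// ler_pXn2r ?nnegrE// mulr_ge0 ?(ltW a0)//.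
by apply: le_trans lnn; exact: ltW.
Qed.

End Functional.

(** * The stationary solution of the volatility recursion *)

Section PowerDifference.
Context (R : realType).
Implicit Types p x y d h : R.

Lemma bernoulli_sub h N : 0 <= h <= 1 -> 1 - N%:R * h <= (1 - h) ^+ N.
Proof.
move=> /andP[h0 h1]; elim: N => [|N IH]; first by rewrite mul0r subr0 expr0.
have N0 : 0 <= N%:R :> R by [].
have h1' : 0 <= 1 - h by rewrite subr_ge0.
rewrite exprS -natr1; apply: le_trans (ler_wpM2l h1' IH).
by rewrite -subr_ge0 (_ : _ - _ = N%:R * h ^+ 2) ?mulr_ge0 ?sqr_ge0//; ring.
Qed.

Lemma powR_le p x y : 0 < p -> 0 <= x -> x <= y -> x `^ p <= y `^ p.
Proof.
by move=> p0 x0 xy; rewrite ge0_ler_powR ?nnegrE ?(ltW p0)// (le_trans x0).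
Qed.

(** If [d] is a small part of [x], the powers of [x] and [x - d] are close
    relatively to that of [x]; otherwise the power of [x] is controlled by that
    of [d]. This covers all positive exponents at once. *)
Lemma powR_diff p x y d h N : 0 < p <= N%:R -> 0 <= y -> 0 <= d -> x = y + d ->
  0 < h <= 1 -> 0 <= x `^ p - y `^ p <= N%:R * h * x `^ p + (d / h) `^ p.
Proof.
move=> /andP[p0 pN] y0 d0 xE /andP[h0 h1].
have x0 : 0 <= x by rewrite xE addr_ge0.
have yx : y <= x by rewrite xE lerDl.
have dh0 : 0 <= d / h by rewrite divr_ge0// ltW.
rewrite subr_ge0 powR_le//=.
have [xd|dx] := leP x (d / h).
  have xp := powR_le p0 x0 xd; have yp := powR_ge0 y p.
  have : 0 <= N%:R * h * x `^ p by rewrite !mulr_ge0 ?powR_ge0// ltW.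
  by move: xp yp; lra.
have hx : (1 - h) * x <= y.
  by move: dx; rewrite ltr_pdivrMr// xE mulrDl mulrDr; nra.
suff : (1 - N%:R * h) * x `^ p <= y `^ p.
  by have := powR_ge0 (d / h) p; lra.
have h1' : 0 <= 1 - h by rewrite subr_ge0.
apply: le_trans (powR_le p0 _ hx); last by rewrite mulr_ge0.
rewrite powRM// ler_wpM2r ?powR_ge0//.
apply: (le_trans (bernoulli_sub N _)); first by rewrite ltW.
have [h1e|h1n] := eqVneq (1 - h) 0.
  rewrite h1e powR0 ?gt_eqF// expr0n; case: N pN => [|//].
  by move=> /(lt_le_trans p0); rewrite ltxx.
have h2 : 0 < 1 - h by rewrite lt_def h1n.
by rewrite -powR_mulrn// ger_powR// h2/= lerBlDr lerDl ltW.
Qed.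

Lemma powR_cube p x : (x `^ p) ^+ 3 = x `^ (p * 3%:R).
Proof. by rewrite powRrM powR_mulrn ?powR_ge0. Qed.

Lemma powR_diff_cube p x y d h t N : 0 < p <= N%:R -> 0 <= y -> 0 <= d ->
  x = y + d -> 0 < h <= 1 -> h `^ (p * 3%:R) = t -> 0 < t ->
  0 <= x `^ p - y `^ p /\ (x `^ p - y `^ p) ^+ 3 <=
  4 * (N%:R * h) ^+ 3 * x `^ (p * 3%:R) + 4 / t * d `^ (p * 3%:R).
Proof.
move=> pN y0 d0 xE h01 ht t0; have /andP[dif0 difle] := powR_diff pN y0 d0 xE h01.
split=> //; have /andP[h0 _] := h01.
have X0 : 0 <= N%:R * h * x `^ p by rewrite !mulr_ge0 ?powR_ge0 ?(ltW h0).
have Y0 := powR_ge0 (d / h) p.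
apply: (@le_trans _ _ ((N%:R * h * x `^ p + (d / h) `^ p) ^+ 3)).
  by apply: lerXn2r difle; rewrite nnegrE; [exact: dif0|exact: addr_ge0].
have := cube_add (N%:R * h * x `^ p) ((d / h) `^ p).
rewrite !ger0_norm ?addr_ge0// => /le_trans; apply.
rewrite powR_cube exprMn powR_cube mulrA lerD2l powRM ?invr_ge0 ?(ltW h0)//.
have -> : h^-1 `^ (p * 3%:R) = t^-1.
  have : (h * h^-1) `^ (p * 3%:R) = 1 by rewrite divff ?gt_eqF// powR1.
  rewrite powRM ?invr_ge0 ?(ltW h0)// ht => e1.
  by apply: (mulfI (x := t)); rewrite ?gt_eqF// e1 divff ?gt_eqF.
by rewrite mulrCA mulrC.
Qed.

End PowerDifference.

Section AlmostEverywhere.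
Context d (T : measurableType d) (R : realType) (P : probability T R).
Implicit Types f g : T -> R.

Lemma Ex_ae_eq f g : measurable_fun setT f -> measurable_fun setT g ->
  {ae P, forall x, f x = g x} -> Ex P f = Ex P g.
Proof.
move=> mf mg fg; rewrite /Ex /Rintegral; congr fine.
apply: ae_eq_integral => //; [exact/measurable_EFinP|exact/measurable_EFinP|].
by apply: filterS fg => x /= -> _.
Qed.

Lemma Int_ae_dom f g : measurable_fun setT f -> Int P g ->
  {ae P, forall x, `|f x| <= g x} -> Int P f.
Proof.
move=> mf Ig fg; have mg := Int_measurable Ig; apply/integrableP; split.
  exact/measurable_EFinP.
have /integrableP[_ fin] := Ig; apply: le_lt_trans fin.
apply: ae_ge0_le_integral => //.
- by apply: measurableT_comp => //; exact/measurable_EFinP.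
- by apply: measurableT_comp => //; exact/measurable_EFinP.
- apply: filterS fg => x fgx _ /=; rewrite lee_fin.
  by apply: le_trans fgx _; exact: ler_norm.
Qed.

Lemma Ex_ae_le f g : Int P f -> Int P g -> {ae P, forall x, f x <= g x} ->
  Ex P f <= Ex P g.
Proof.
move=> If Ig fg; have mf := Int_measurable If; have mg := Int_measurable Ig.
have mm : measurable_fun setT (fun x => Num.min (f x) (g x)) by exact: measurable_minr.
have Im : Int P (fun x => Num.min (f x) (g x)).
  apply: (@Int_dom _ _ _ _ _ (fun x => `|f x| + `|g x|)) => //.
    by apply: IntD; exact: Int_abs.
  by move=> x; have [_|_] := leP (f x) (g x); rewrite ?lerDl ?lerDr.
rewrite (@Ex_ae_eq f (fun x => Num.min (f x) (g x)))//.
  by apply: Ex_le => // x; rewrite ge_min lexx orbT.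
by apply: filterS fg => x /= fgx; rewrite min_l.
Qed.

Lemma Ex_eq0_ae f : Int P f -> (forall x, 0 <= f x) -> Ex P f = 0 ->
  {ae P, forall x, f x = 0}.
Proof.
move=> If f0 Ef; have mf := Int_measurable If.
have : (\int[P]_(x in setT) `|(EFin \o f) x|)%E = 0%E.
  have <- : (Ex P f)%:E = 0%E by rewrite Ef.
  rewrite EFin_Ex//; apply: eq_integral => x _ /=; rewrite ger0_norm//.
move=> /ae_eq_integral_abs -/(_ measurableT) H.
have /H : measurable_fun setT (EFin \o f) by exact/measurable_EFinP.
by apply: filterS => x /(_ I) /= [].
Qed.

End AlmostEverywhere.

Lemma has_law_ae d1 d2 (T1 : measurableType d1) (T2 : measurableType d2)
    (R : realType) (P1 : probability T1 R) (P2 : probability T2 R) (X : T1 -> T2)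
    (Q : T2 -> Prop) : has_law P1 P2 X ->
  {ae P2, forall y, Q y} -> {ae P1, forall x, Q (X x)}.
Proof.
move=> [mX PX] [A [mA A0 QA]]; exists (X @^-1` A); split.
- by rewrite -[_ @^-1` _]setTI; exact: mX.
- by rewrite -PX.
- by move=> x /= nQ; exact: QA.
Qed.

Section ProductGe0.
Context (R : realType) (mu : probability (seqsp R) R) (nu : probability R R).
Hypothesis mu_iid : iid_law mu nu.

(** For nonnegative functions, infinite expectations allowed: integrability of
    the factors can then be deduced from that of the product. *)
Lemma dep_mul_ge0 (I J : pred nat) (f g : seqsp R -> R) :
  (forall i, I i -> J i -> false) -> dep I f -> dep J g ->
  measurable_fun setT f -> measurable_fun setT g ->
  (forall u, 0 <= f u) -> (forall u, 0 <= g u) ->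
  (\int[mu]_u (f u * g u)%:E = \int[mu]_u (f u)%:E * \int[mu]_u (g u)%:E)%E.
Proof.
move=> IJ df dg mf mg f0 g0.
have mfE : measurable_fun setT (EFin \o f) by exact/measurable_EFinP.
have mgE : measurable_fun setT (EFin \o g) by exact/measurable_EFinP.
rewrite (splice_ge0_integral mu_iid J (F := fun u => f u * g u)) => [||u]; last 2 first.
- exact: measurable_funM.
- exact: mulr_ge0.
transitivity (\int[mu]_v ((f v)%:E * \int[mu]_u (g u)%:E)%E)%E.
  apply: eq_integral => v _.
  rewrite -ge0_integralZl// ?lee_fin//; last by move=> u _; rewrite lee_fin.
  apply: eq_integral => u _; rewrite -EFinM; congr (_ * _)%:E.
    apply: dep_spliceN => w w' ww'; apply: df => i Ii; apply: ww'.
    by apply/negP => Ji; have := IJ i Ii Ji.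
  exact: dep_splice.
rewrite ge0_integralZr//.
- by move=> u _; rewrite lee_fin.
- by apply: integral_ge0 => u _; rewrite lee_fin.
Qed.

End ProductGe0.

Section Garch.
Context (R : realType) (mu : probability (seqsp R) R) (nu : probability R R).
Hypothesis mu_iid : iid_law mu nu.
Variables (c g : R -> R).
Hypothesis c_meas : measurable_fun setT c.
Hypothesis g_meas : measurable_fun setT g.
Hypothesis c_ge0 : forall x, 0 <= c x.
Hypothesis g_ge0 : forall x, 0 <= g x.
Implicit Types u : seqsp R.

(** The series [X_k] as a function of the innovations before time [k], the most
    recent one being [u 0].  Its value [vole] in the extended half-line is
    defined at every sequence. *)
Definition cprod j u : R := \prod_(0 <= i < j) c (u i).
Definition vterm i u : R := g (u i) * cprod i u.
Definition vpart m u : R := \sum_(0 <= i < m) vterm i u.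
Definition vole u : \bar R := (\sum_(i <oo) (vterm i u)%:E)%E.
Definition vol u : R := fine (vole u).

Lemma cprod_ge0 j u : 0 <= cprod j u.
Proof. by apply: prodr_ge0. Qed.

Lemma vterm_ge0 i u : 0 <= vterm i u.
Proof. by rewrite mulr_ge0// cprod_ge0. Qed.

Lemma vpart_ge0 m u : 0 <= vpart m u.
Proof. by apply: sumr_ge0 => i _; exact: vterm_ge0. Qed.

Lemma vole_ge0 u : (0 <= vole u)%E.
Proof. by apply: nneseries_ge0 => i _ _; rewrite lee_fin vterm_ge0. Qed.

Lemma vol_ge0 u : 0 <= vol u.
Proof. by rewrite fine_ge0// vole_ge0. Qed.

Lemma cprod_add m j u : cprod (m + j) u = cprod m u * cprod j (shift m u).
Proof.
rewrite /cprod (@big_cat_nat _ _ _ m)//= ?leq_addr//; congr (_ * _).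
by rewrite -{1}[m]add0n big_addn addKn.
Qed.

Lemma vterm_add m i u : vterm (i + m) u = cprod m u * vterm i (shift m u).
Proof. by rewrite /vterm addnC cprod_add mulrCA [(m + i)%N]addnC. Qed.

(** The recursion of the volatility, iterated [m] times. *)
Lemma vole_split m u : vole u = ((vpart m u)%:E + (cprod m u)%:E * vole (shift m u))%E.
Proof.
rewrite /vole (@nneseries_split _ _ 0 m); last by move=> k _; rewrite lee_fin vterm_ge0.
rewrite add0n sumEFin; congr (_ + _)%E.
rewrite -nneseries_addn; last by move=> i; rewrite lee_fin vterm_ge0.
rewrite -nneseriesZl; last by move=> i _; rewrite lee_fin vterm_ge0.
by apply: eq_eseriesr => i _; rewrite vterm_add EFinM.
Qed.

Lemma measurable_cprod j : measurable_fun setT (cprod j).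
Proof.
by apply: measurable_prod => i _; exact: measurableT_comp c_meas (measurable_coord i).
Qed.

Lemma measurable_vterm i : measurable_fun setT (vterm i).
Proof.
apply: measurable_funM; last exact: measurable_cprod.
exact: measurableT_comp g_meas (measurable_coord i).
Qed.

Lemma measurable_vpart m : measurable_fun setT (vpart m).
Proof. by apply: measurable_sum => i; exact: measurable_vterm. Qed.

Lemma measurable_vole : measurable_fun setT vole.
Proof.
apply: (@ge0_emeasurable_sum _ _ _ setT (fun i u => (vterm i u)%:E) xpredT) => [i u _ _|i _].
  by rewrite lee_fin vterm_ge0.
by apply/measurable_EFinP; exact: measurable_vterm.
Qed.

Lemma measurable_vol : measurable_fun setT vol.
Proof. by apply: measurableT_comp => //; exact: measurable_vole. Qed.

Lemma cprod_dep m : dep (fun i => i < m)%N (cprod m).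
Proof.
by move=> v u vu; apply: eq_big_nat => i /andP[_ im]; rewrite vu.
Qed.

Lemma vpart_dep m : dep (fun i => i < m)%N (vpart m).
Proof.
move=> v u vu; apply: eq_big_nat => i /andP[_ im]; rewrite /vterm vu//.
by congr (_ * _); apply: cprod_dep => k ki; apply: vu; exact: ltn_trans im.
Qed.

Hypothesis vol_fin : {ae mu, forall u, (vole u < +oo)%E}.

Lemma vol_split m :
  {ae mu, forall u, vol u = vpart m u + cprod m u * vol (shift m u)}.
Proof.
have vs := has_law_ae (shift_law mu_iid m) vol_fin.
apply: filterS2 vol_fin vs => u fu fs.
have eu := vole_split m u.
have : vole u \is a fin_num by rewrite ge0_fin_numE ?vole_ge0.
have : vole (shift m u) \is a fin_num by rewrite ge0_fin_numE ?vole_ge0.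
rewrite /vol; move: eu; move: (vole u) (vole (shift m u)) => a b eu fb fa.
by rewrite eu -(fineK fb).
Qed.

Variable q : R.
Hypothesis q_gt0 : 0 < q.
Hypothesis vol_int : Int mu (fun u => vol u `^ q).
Local Notation E := (Ex mu).
Local Notation mq := (E (fun u => vol u `^ q)).
Hypothesis mq_gt0 : 0 < mq.

Definition contraction := E (fun u => c (u 0%N) `^ q).

Lemma measurable_powR_fun (f : seqsp R -> R) r : measurable_fun setT f ->
  measurable_fun setT (fun u => f u `^ r).
Proof. by move=> mf; exact: (measurableT_comp (measurable_powR r) mf). Qed.

Let mc0 : measurable_fun setT (fun u => c (u 0%N)).
Proof. exact: measurableT_comp c_meas (measurable_coord 0). Qed.

Let mvs j : measurable_fun setT (fun u => vol (shift j u)).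
Proof. exact: measurableT_comp measurable_vol (measurable_shift j). Qed.

Let Ivs j : Int mu (fun u => vol (shift j u) `^ q).
Proof. exact: (Int_shift mu_iid j vol_int). Qed.

Let Evs j : E (fun u => vol (shift j u) `^ q) = mq.
Proof. exact: (Ex_shift mu_iid j vol_int). Qed.

Let cq0 u : 0 <= c (u 0%N) `^ q. Proof. exact: powR_ge0. Qed.

Let dc : dep (fun i => i == 0)%N (fun u => c (u 0%N) `^ q).
Proof. by move=> v u vu; rewrite vu. Qed.

Let dsh (f : seqsp R -> R) : dep (fun i => 0 < i)%N (fun u => f (shift 1 u)).
Proof.
by move=> v u vu; congr f; apply/funext => i; rewrite /shift vu// addn1.
Qed.

Let disj i : (i == 0)%N -> (0 < i)%N -> false. Proof. by case: i. Qed.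

Let below : {ae mu, forall u, c (u 0%N) * vol (shift 1 u) <= vol u /\
  (vol u <= c (u 0%N) * vol (shift 1 u) -> g (u 0%N) = 0)}.
Proof.
apply: filterS (vol_split 1) => u ->.
rewrite /vpart /vterm /cprod !big_nat1 big_geq// mulr1; split.
  by rewrite lerDr.
by rewrite gerDr => g0; apply/eqP; rewrite eq_le g0 g_ge0.
Qed.

Let Icv : Int mu (fun u => (c (u 0%N) * vol (shift 1 u)) `^ q).
Proof.
apply: (Int_ae_dom _ vol_int); first by apply: measurable_powR_fun; exact: measurable_funM.
apply: filterS below => u [le _]; rewrite ger0_norm ?powR_ge0//.
by apply: powR_le => //; rewrite mulr_ge0 ?vol_ge0.
Qed.

Let cvE : (fun u => (c (u 0%N) * vol (shift 1 u)) `^ q) =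
  fun u => c (u 0%N) `^ q * vol (shift 1 u) `^ q.
Proof. by apply/funext => u; rewrite powRM ?vol_ge0. Qed.

Lemma Int_contraction : Int mu (fun u => c (u 0%N) `^ q).
Proof.
have mcq : measurable_fun setT (fun u => c (u 0%N) `^ q) by exact: measurable_powR_fun.
apply/integrableP; split; first exact/measurable_EFinP.
have H := dep_mul_ge0 mu_iid disj dc (dsh (fun u => vol u `^ q)) mcq
  (measurable_powR_fun q (mvs 1)) cq0 (fun u => powR_ge0 _ _).
have -> : (\int[mu]_x `|(c (x 0%N) `^ q)%:E| = \int[mu]_x (c (x 0%N) `^ q)%:E)%E.
  by apply: eq_integral => u _ /=; rewrite ger0_norm.
have Efin : (\int[mu]_u (c (u 0%N) `^ q * vol (shift 1 u) `^ q)%:E < +oo)%E.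
  by have := Icv; rewrite cvE => I2; rewrite -(EFin_Ex I2) ltry.
have mv : (0 < \int[mu]_u (vol (shift 1 u) `^ q)%:E)%E.
  by rewrite -(EFin_Ex (Ivs 1)) lte_fin Evs.
rewrite H in Efin; rewrite ltey; apply/negP => /eqP e.
by move: Efin; rewrite e gt0_mulye// ltxx.
Qed.

Lemma contraction_ge0 : 0 <= contraction.
Proof. exact: Ex_ge0. Qed.

Let Ecv : E (fun u => (c (u 0%N) * vol (shift 1 u)) `^ q) = contraction * mq.
Proof.
have [_] := dep_mul mu_iid disj dc (dsh (fun u => vol u `^ q)) Int_contraction (Ivs 1).
by rewrite cvE => ->; rewrite Evs.
Qed.

(** The volatility dominates the product of [c] with an independent copy of
    itself, strictly unless [g] vanishes; as the moment is finite, the moment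
    of [c] is below 1. *)
Lemma contraction_lt1 : contraction < 1.
Proof.
rewrite ltNge; apply/negP => rho1.
pose h u := Num.max (vol u `^ q - (c (u 0%N) * vol (shift 1 u)) `^ q) 0.
have Ih0 : Int mu (fun u => vol u `^ q - (c (u 0%N) * vol (shift 1 u)) `^ q).
  exact: IntB.
have mh : measurable_fun setT h.
  by apply: measurable_maxr => //; exact: Int_measurable Ih0.
have Ih : Int mu h.
  apply: (Int_dom mh (Int_abs Ih0)) => u; rewrite /h.
  by have [h0|h0] := leP (vol u `^ q - _) 0; rewrite ?normr0.
have h_ge0 u : 0 <= h u by rewrite le_max lexx orbT.
have Eh : E h = 0.
  apply/eqP; rewrite eq_le Ex_ge0// andbT.
  have -> : E h = E (fun u => vol u `^ q - (c (u 0%N) * vol (shift 1 u)) `^ q).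
    apply: Ex_ae_eq => //; first exact: Int_measurable Ih0.
    apply: filterS below => u [le _]; rewrite /h max_l// subr_ge0.
    by apply: powR_le => //; rewrite mulr_ge0 ?vol_ge0.
  rewrite (ExB vol_int Icv) Ecv subr_le0; move: mq_gt0 rho1.
  by move: contraction (Ex mu _) => r x x0 r1; rewrite ler_peMl// ltW.
have g0 : {ae mu, forall u, g (u 0%N) = 0}.
  apply: filterS2 below (Ex_eq0_ae Ih h_ge0 Eh) => u [_ gu] hu; apply: gu.
  have : vol u `^ q - (c (u 0%N) * vol (shift 1 u)) `^ q <= 0.
    by rewrite -hu /h le_max lexx.
  rewrite subr_le0 => le; rewrite leNgt; apply/negP => lt.
  have := gt0_ltr_powR q_gt0 _ _ lt; rewrite ltNge le => /(_ _ _)/negP; apply=> //.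
  - by rewrite nnegrE mulr_ge0 ?vol_ge0.
  - by rewrite nnegrE vol_ge0.
have gi : {ae mu, forall u, forall i, g (u i) = 0}.
  by apply: ae_foralln => i; exact: has_law_ae (shift_law mu_iid i) g0.
have v0 : {ae mu, forall u, vol u `^ q = 0}.
  apply: filterS gi => u gu; have -> : vol u = 0.
    rewrite /vol /vole eseries0// => i _ _; by rewrite /vterm gu mul0r.
  by rewrite powR0 ?gt_eqF.
have : mq = 0.
  apply: etrans (Ex_cst mu 0); have m0 : measurable_fun setT (fun _ : seqsp R => 0 : R) by [].
  exact: (Ex_ae_eq (Int_measurable vol_int) m0 v0).
by move=> m0; move: mq_gt0; rewrite m0 ltxx.
Qed.

(** The remainder after [m] terms is a product of [m] independent factors [c] and
    an independent copy of the volatility. *)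
Lemma tail_moment m : Int mu (fun u => (cprod m u * vol (shift m u)) `^ q) /\
  E (fun u => (cprod m u * vol (shift m u)) `^ q) = contraction ^+ m * mq.
Proof.
elim: m => [|m [Im Em]].
  have -> : (fun u => (cprod 0 u * vol (shift 0 u)) `^ q) = fun u => vol u `^ q.
    apply/funext => u; rewrite /cprod big_geq// mul1r; congr (vol _ `^ _).
    by apply/funext => i; rewrite /shift addn0.
  by rewrite expr0 mul1r.
pose D u := (cprod m u * vol (shift m u)) `^ q.
have -> : (fun u => (cprod m.+1 u * vol (shift m.+1 u)) `^ q) =
    fun u => c (u 0%N) `^ q * D (shift 1 u).
  apply/funext => u; rewrite -add1n cprod_add -mulrA /D shift_shift addnC.
  rewrite {1}/cprod big_nat1 powRM// mulr_ge0 ?cprod_ge0 ?vol_ge0//.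
have IDs : Int mu (fun u => D (shift 1 u)) := Int_shift mu_iid 1 Im.
have EDs : E (fun u => D (shift 1 u)) = E D := Ex_shift mu_iid 1 Im.
have [I2 E2] := dep_mul mu_iid disj dc (dsh D) Int_contraction IDs.
split; first exact: I2.
by apply: (etrans E2); rewrite EDs exprS -mulrA; congr (_ * _); exact: Em.
Qed.

End Garch.

Lemma mule_fin_pos (R : realType) (a b : \bar R) : (0 <= a)%E -> (0 <= b)%E ->
  (0 < a * b < +oo)%E -> (0 < a < +oo)%E.
Proof.
move=> a0 b0 /andP[ab0 abf].
have an0 : a != 0%E by apply: contraTneq ab0 => ->; rewrite mul0e ltxx.
have bn0 : b != 0%E by apply: contraTneq ab0 => ->; rewrite mule0 ltxx.
rewrite lt_def an0 a0/= ltey; apply/eqP => ae.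
by move: abf; rewrite ae gt0_mulye ?ltxx// lt_def bn0.
Qed.

(** A geometric rate [s] compatible with both error terms of [powR_diff], when
    the threshold is a power of [k]. *)
Lemma geometric_rate (R : realType) (rho q : R) : 0 < q -> 0 <= rho < 1 ->
  exists k t s : R, [/\ 0 < k <= 1, 0 < t, k `^ q = t, 0 < s < 1 &
    forall m, k ^+ m ^+ 3 <= s ^+ (3 * m) /\ rho ^+ m / t ^+ m <= s ^+ (3 * m)].
Proof.
move=> q0 /andP[r0 r1].
(* dividing [rho] by [t] leaves a rate [t]: half of the decay pays for the
   threshold *)
have [t [t0 t1 rt]] : exists t, [/\ 0 < t, t < 1 & rho <= t ^+ 2].
  exists ((1 + rho) / 2); split; first by rewrite divr_gt0// ltr_pwDl.
    by rewrite ltr_pdivrMr//; lra.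
  by rewrite -subr_ge0 (_ : _ - _ = ((1 - rho) / 2) ^+ 2) ?sqr_ge0//; field.
have lt1 (r : R) : 0 < r -> t `^ r < 1.
  move=> rp; have -> : 1 = 1 `^ r by rewrite powR1.
  by rewrite gt0_ltr_powR ?nnegrE// ltW.
pose k := t `^ q^-1; pose k3 := t `^ 3^-1.
have k0 : 0 < k by exact: powR_gt0.
have k30 : 0 < k3 by exact: powR_gt0.
have k1 : k < 1 by rewrite lt1// invr_gt0.
have k31 : k3 < 1 by rewrite lt1// invr_gt0.
have kq : k `^ q = t by rewrite /k -powRrM mulVf ?gt_eqF// powRr1// ltW.
have k3E : k3 ^+ 3 = t.
  have e3 : 3^-1 * 3%:R = 1 :> R by rewrite mulVf// pnatr_eq0.
  apply: etrans (esym (powR_mulrn 3 (ltW k30))) _.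
  by apply: etrans (esym (powRrM _ _ _)) _; rewrite e3 powRr1// ltW.
pose s := Num.max k k3.
have s0 : 0 < s by rewrite lt_max k0.
exists k, t, s; split=> //; first by rewrite k0 ltW.
  by rewrite s0/= gt_max k1 k31.
move=> m; rewrite exprM; split.
  rewrite exprAC; apply: lerXn2r; rewrite ?nnegrE ?exprn_ge0 ?(ltW k0) ?(ltW s0)//.
  by apply: lerXn2r; rewrite ?nnegrE ?(ltW k0) ?(ltW s0)// le_max lexx.
have -> : rho ^+ m / t ^+ m = (rho / t) ^+ m := esym (expr_div_n rho t m).
apply: lerXn2r; rewrite ?nnegrE ?divr_ge0 ?exprn_ge0 ?(ltW t0) ?(ltW s0)//.
apply: (@le_trans _ _ t); first by rewrite ler_pdivrMr// -expr2.
by rewrite -[X in X <= _]k3E ler_pXn2r ?nnegrE ?(ltW k30) ?(ltW s0)// le_max lexx orbT.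
Qed.

(** The arithmetic of [garch_approx], [f] and [w] standing for the moments of the
    innovation and of the volatility. *)
Lemma rate_arith (R : realType) (f w y h t r : R) (N : nat) : 0 <= w -> 0 <= f ->
  h ^+ 3 <= y -> r / t <= y ->
  4 * (N%:R * h) ^+ 3 * (f * w) + 4 / t * (f * (r * w)) <=
  4 * (N%:R ^+ 3 + 1) * w * f * y.
Proof.
move=> w0 f0 r1 r2.
have -> : 4 * (N%:R * h) ^+ 3 * (f * w) + 4 / t * (f * (r * w)) =
  (4 * w * f) * (N%:R ^+ 3 * h ^+ 3 + r / t) by ring.
have -> : 4 * (N%:R ^+ 3 + 1) * w * f * y = (4 * w * f) * (N%:R ^+ 3 * y + y) by ring.
by rewrite ler_wpM2l ?mulr_ge0// lerD// ler_wpM2l// exprn_ge0.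
Qed.

Section GarchFunctional.
Context (R : realType) (mu : probability (seqsp R) R) (nu : probability R R).
Hypothesis mu_iid : iid_law mu nu.
Variables (c g fe : R -> R) (p : R).
Hypothesis c_meas : measurable_fun setT c.
Hypothesis g_meas : measurable_fun setT g.
Hypothesis fe_meas : measurable_fun setT fe.
Hypothesis c_ge0 : forall x, 0 <= c x.
Hypothesis g_ge0 : forall x, 0 <= g x.
Hypothesis vol_fin : {ae mu, forall u, (vole c g u < +oo)%E}.
Hypothesis p_gt0 : 0 < p.
Implicit Types u : seqsp R.
Local Notation E := (Ex mu).
Local Notation vol := (vol c g).

(** [u 0] is the innovation of the observation itself, the volatility only
    depends on the earlier ones.  [garch_win m] keeps [m] terms of the series,
    hence [m + 1] innovations. *)
Definition garch_obs u : R := vol (shift 1 u) `^ p * fe (u 0%N).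
Definition garch_win m u : R := vpart c g m (shift 1 u) `^ p * fe (u 0%N).

Hypothesis obs_int : Int mu (fun u => `|garch_obs u| ^+ 3).
Hypothesis obs_pos : 0 < E (fun u => `|garch_obs u| ^+ 3).

Let q := p * 3%:R.
Let q_gt0 : 0 < q. Proof. by rewrite mulr_gt0. Qed.

Let phi u := `|fe (u 0%N)| ^+ 3.

Let mphi : measurable_fun setT phi.
Proof.
apply: measurable_funX; apply: measurableT_comp => //.
exact: measurableT_comp fe_meas (measurable_coord 0).
Qed.

Let phi_ge0 u : 0 <= phi u. Proof. exact: exprn_ge0. Qed.

Let dphi : dep (fun i => i == 0)%N phi.
Proof. by move=> v u vu; rewrite /phi vu. Qed.

Let dsh (f : seqsp R -> R) : dep (fun i => 0 < i)%N (fun u => f (shift 1 u)).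
Proof.
by move=> v u vu; congr f; apply/funext => i; rewrite /shift vu// addn1.
Qed.

Let disj i : (i == 0)%N -> (0 < i)%N -> false. Proof. by case: i. Qed.

Let mvol : measurable_fun setT vol.
Proof. exact: measurable_vol. Qed.

Let mvq : measurable_fun setT (fun u => vol u `^ q).
Proof. exact: measurable_powR_fun. Qed.

Let mvsq : measurable_fun setT (fun u => vol (shift 1 u) `^ q).
Proof. exact: measurableT_comp mvq (measurable_shift 1). Qed.

Let obsE : (fun u => `|garch_obs u| ^+ 3) = fun u => phi u * vol (shift 1 u) `^ q.
Proof.
apply/funext => u; rewrite normrM exprMn ger0_norm ?powR_ge0// powR_cube.
by rewrite mulrC.
Qed.

Let prodE : (\int[mu]_u (`|garch_obs u| ^+ 3)%:E =
  \int[mu]_u (phi u)%:E * \int[mu]_u (vol u `^ q)%:E)%E.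
Proof.
have -> : (\int[mu]_u (vol u `^ q)%:E = \int[mu]_u (vol (shift 1 u) `^ q)%:E)%E.
  apply: (has_law_ge0_integral (shift_law mu_iid 1) (f := fun u => (vol u `^ q)%:E)).
    exact/measurable_EFinP.
  by move=> u; rewrite lee_fin powR_ge0.
have -> : (fun u => (`|garch_obs u| ^+ 3)%:E) = fun u => (phi u * vol (shift 1 u) `^ q)%:E.
  by apply/funext => u; have := congr1 (fun f => (f u)%:E) obsE.
exact: (dep_mul_ge0 mu_iid disj dphi (dsh (fun u => vol u `^ q)) mphi mvsq
  phi_ge0 (fun u => powR_ge0 _ _)).
Qed.

Let posfin (f : seqsp R -> R) : measurable_fun setT f -> (forall u, 0 <= f u) ->
  (0 < \int[mu]_u (f u)%:E < +oo)%E -> Int mu f /\ 0 < E f.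
Proof.
move=> mf f0 /andP[i0 ioo].
have If : Int mu f.
  apply/integrableP; split; first exact/measurable_EFinP.
  have -> : (\int[mu]_x `|(EFin \o f) x| = \int[mu]_x (f x)%:E)%E.
    by apply: eq_integral => u _ /=; rewrite ger0_norm.
  exact: ioo.
by split=> //; rewrite -lte_fin EFin_Ex.
Qed.

(* an observation is a product of independent factors: its finite nonzero
   third moment makes both factors have finite nonzero moments *)
Let bounds : (Int mu phi /\ 0 < E phi) /\
  (Int mu (fun u => vol u `^ q) /\ 0 < E (fun u => vol u `^ q)).
Proof.
have a0 : (0 <= \int[mu]_u (phi u)%:E)%E by apply: integral_ge0 => u _; rewrite lee_fin.
have b0 : (0 <= \int[mu]_u (vol u `^ q)%:E)%E.
  by apply: integral_ge0 => u _; rewrite lee_fin powR_ge0.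
have ab : (0 < \int[mu]_u (phi u)%:E * \int[mu]_u (vol u `^ q)%:E < +oo)%E.
  by rewrite -prodE -(EFin_Ex obs_int) lte_fin obs_pos ltry.
split; first exact: posfin mphi phi_ge0 (mule_fin_pos a0 b0 ab).
apply: posfin => //; first by move=> u; exact: powR_ge0.
by apply: (mule_fin_pos b0 a0); rewrite muleC.
Qed.

Let Iphi := bounds.1.1.
Let Ivq := bounds.2.1.
Let mq_gt0 := bounds.2.2.

Lemma measurable_garch_win m : measurable_fun setT (garch_win m).
Proof.
apply: measurable_funM; last exact: measurableT_comp fe_meas (measurable_coord 0).
apply: measurable_powR_fun.
exact: measurableT_comp (measurable_vpart c_meas g_meas m) (measurable_shift 1).
Qed.

Lemma measurable_garch_obs : measurable_fun setT garch_obs.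
Proof.
apply: measurable_funM; last exact: measurableT_comp fe_meas (measurable_coord 0).
apply: measurable_powR_fun.
exact: measurableT_comp mvol (measurable_shift 1).
Qed.

Lemma garch_win_dep m : dep (fun i => i <= m)%N (garch_win m).
Proof.
move=> v u vu; rewrite /garch_win vu//; congr (_ `^ _ * _).
by apply: vpart_dep => i im; rewrite /shift vu// addn1.
Qed.

Let md m : measurable_fun setT (fun u => `|garch_obs u - garch_win m u| ^+ 3).
Proof.
apply: measurable_funX; apply: measurableT_comp => //; apply: measurable_funB.
  exact: measurable_garch_obs.
exact: measurable_garch_win.
Qed.

(** The remainder after [m] terms is geometrically small in mean of order [q];
    [powR_diff], with a threshold [h] itself geometrically small in [m], turns
    this into closeness of the powers of order [p], without loss of moments. *)
Lemma garch_approx : exists s K : R, 0 < s < 1 /\ forall m,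
  Int mu (fun u => `|garch_obs u - garch_win m u| ^+ 3) /\
  E (fun u => `|garch_obs u - garch_win m u| ^+ 3) <= K * s ^+ (3 * m).
Proof.
pose rho := contraction mu c q.
have rho0 : 0 <= rho by exact: contraction_ge0.
have rho1 : rho < 1.
  exact: (contraction_lt1 mu_iid c_meas g_meas c_ge0 g_ge0 vol_fin q_gt0 Ivq mq_gt0).
have rho01 : 0 <= rho < 1 by rewrite rho0.
have [k [t [s [/andP[k0 k1] t0 kq s01 rate]]]] := geometric_rate q_gt0 rho01.
pose mq := E (fun u => vol u `^ q).
pose N := (Num.truncn p).+1.
have pN : 0 < p <= N%:R.
  by rewrite p_gt0/= ltW//; have /andP[] := truncn_itv (ltW p_gt0).
exists s, (4 * (N%:R ^+ 3 + 1) * mq * E phi); split=> // m.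
have [h [h0 h1 hq hE]] : exists h, [/\ 0 < h, h <= 1, h `^ q = t ^+ m & h = k ^+ m].
  exists (k ^+ m); split=> //; [exact: exprn_gt0|exact: exprn_ile1 (ltW k0) k1|].
  by rewrite -(powR_mulrn m (ltW k0)) powRAC kq (powR_mulrn m (ltW t0)).
pose D u := (cprod c m u * vol (shift m u)) `^ q.
have [ID ED] : Int mu D /\ E D = rho ^+ m * mq.
  exact: (tail_moment mu_iid c_meas g_meas c_ge0 g_ge0 vol_fin q_gt0 Ivq mq_gt0 m).
have IDs : Int mu (fun u => D (shift 1 u)) := Int_shift mu_iid 1 ID.
have EDs : E (fun u => D (shift 1 u)) = E D := Ex_shift mu_iid 1 ID.
have Ivs : Int mu (fun u => vol (shift 1 u) `^ q) := Int_shift mu_iid 1 Ivq.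
have Evs : E (fun u => vol (shift 1 u) `^ q) = mq := Ex_shift mu_iid 1 Ivq.
have [I1 E1] := dep_mul mu_iid disj dphi (dsh (fun u => vol u `^ q)) Iphi Ivs.
have [I2 E2] := dep_mul mu_iid disj dphi (dsh D) Iphi IDs.
have tm0 : 0 < t ^+ m by rewrite exprn_gt0.
pose a1 := 4 * (N%:R * h) ^+ 3; pose a2 := 4 / t ^+ m.
have bd : {ae mu, forall u, `|garch_obs u - garch_win m u| ^+ 3 <=
    a1 * (phi u * vol (shift 1 u) `^ q) + a2 * (phi u * D (shift 1 u))}.
  have vs := has_law_ae (shift_law mu_iid 1) (vol_split mu_iid c_ge0 g_ge0 vol_fin m).
  apply: filterS vs => u; set w := shift 1 u => vE.
  have d0 : 0 <= cprod c m w * vol (shift m w) by rewrite mulr_ge0 ?cprod_ge0 ?vol_ge0.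
  have h01 : 0 < h <= 1 by rewrite h0 h1.
  have [dif0 dif3] := powR_diff_cube pN (vpart_ge0 c_ge0 g_ge0 m w) d0 vE h01 hq tm0.
  rewrite /garch_obs /garch_win -mulrBl normrM exprMn -/w (ger0_norm dif0).
  rewrite -/(phi u) [X in X <= _]mulrC.
  have -> : a1 * (phi u * vol w `^ q) + a2 * (phi u * D w) =
    phi u * (a1 * vol w `^ q + a2 * D w) by move: (phi u) (D w) => x y; ring.
  exact: (ler_wpM2l (phi_ge0 u) dif3).
have Ib : Int mu (fun u => a1 * (phi u * vol (shift 1 u) `^ q) + a2 * (phi u * D (shift 1 u))).
  by apply: IntD; exact: IntZ.
have Id : Int mu (fun u => `|garch_obs u - garch_win m u| ^+ 3).
  apply: (Int_ae_dom (md m) Ib); apply: filterS bd => u.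
  by rewrite [`| `|_| ^+ 3|]ger0_norm ?exprn_ge0.
split; first exact: Id.
apply: (le_trans (Ex_ae_le Id Ib bd)).
rewrite (ExD (IntZ a1 I1) (IntZ a2 I2)) (ExZ a1 I1) (ExZ a2 I2) E1 E2 Evs EDs ED.
have [r1 r2] := rate m; rewrite -hE in r1.
have mq0 : 0 <= mq := Ex_ge0 mu (fun u => powR_ge0 (vol u) q).
have Ep0 : 0 <= E phi := Ex_ge0 mu phi_ge0.
exact: (rate_arith N mq0 Ep0 r1 r2).
Qed.

End GarchFunctional.

Section GarchRate.
Context (R : realType) (mu : probability (seqsp R) R) (nu : probability R R).
Hypothesis mu_iid : iid_law mu nu.

(** Subtracting the mean from a functional and from its approximations does not
    change the errors of approximation. *)
Lemma centred_rate (f : seqsp R -> R) (fm : nat -> seqsp R -> R) (s K : R) :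
  measurable_fun setT f -> Int mu (fun u => `|f u| ^+ 3) ->
  (forall m, measurable_fun setT (fm m)) ->
  (forall m, dep (fun i => i <= m)%N (fm m)) -> 0 < s < 1 ->
  (forall m, Int mu (fun u => `|f u - fm m u| ^+ 3) /\
     Ex mu (fun u => `|f u - fm m u| ^+ 3) <= K * s ^+ (3 * m)) ->
  let z := fun u => f u - Ex mu f in
  exists l : R, [/\ 0 <= l, sum_var mu z n / n%:R @[n --> \oo] --> l &
    0 < l -> exists C : R, 0 < C /\ forall (n : nat) (x : R), (2 <= n)%N ->
      `|fine (mu [set u | block_sum (shifted z) 0 n u < x * Num.sqrt (sum_var mu z n)]) - Phi x| <=
      C * (ln n%:R ^+ 2 / Num.sqrt n%:R)].
Proof.
move=> mf If mfm dfm s01 ap z; pose e := Ex mu f.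
have Ifm : Int mu f.
  apply: (@Int_dom _ _ _ _ _ (fun u => 1 + `|f u| ^+ 3)) => //.
    by apply: IntD => //; exact: Int_cst.
  by move=> u; exact: norm_le1_cube.
have mz : measurable_fun setT z by exact: measurable_funB.
have Iz : Int mu (fun u => `|z u| ^+ 3).
  apply: (@Int_dom _ _ _ _ _ (fun u => 4 * `|f u| ^+ 3 + 4 * `|- e| ^+ 3)).
  - by apply: measurable_funX; exact: measurableT_comp.
  - by apply: IntD; [exact: IntZ|exact: Int_cst].
  - by move=> u; rewrite ger0_norm ?exprn_ge0//; exact: cube_add.
have Ez : Ex mu z = 0.
  by rewrite (ExB Ifm (Int_cst mu e)) Ex_cst subrr.
pose zm m u := fm m u - e.
have mzm m : measurable_fun setT (zm m) by exact: measurable_funB.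
have dzm m : dep (fun i => i <= m)%N (zm m).
  by move=> v u vu; rewrite /zm (dfm m v u vu).
have dE m : (fun u => `|z u - zm m u| ^+ 3) = fun u => `|f u - fm m u| ^+ 3.
  by apply/funext => u; congr (`|_| ^+ 3); rewrite /z /zm -/e; ring.
have Id m : Int mu (fun u => `|z u - zm m u| ^+ 3) by rewrite dE; case: (ap m).
have Ed m : Ex mu (fun u => `|z u - zm m u| ^+ 3) <= K * s ^+ (3 * m).
  by rewrite dE; case: (ap m).
have [l [l0 cv]] := cvg_sum_var mu_iid s01 mz Iz Ez mzm dzm Id Ed.
exists l; split=> // lp.
exact: (functional_berry_esseen mu_iid s01 mz Iz Ez mzm dzm Id Ed lp cv).
Qed.

Variables (c g fe : R -> R) (p : R).
Hypothesis c_meas : measurable_fun setT c.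
Hypothesis g_meas : measurable_fun setT g.
Hypothesis fe_meas : measurable_fun setT fe.
Hypothesis c_ge0 : forall x, 0 <= c x.
Hypothesis g_ge0 : forall x, 0 <= g x.
Hypothesis vol_fin : {ae mu, forall u, (vole c g u < +oo)%E}.
Hypothesis p_gt0 : 0 < p.
Hypothesis obs_int : Int mu (fun u => `|garch_obs c g fe p u| ^+ 3).

(** If the third moment is zero, the observations vanish almost surely and are
    approximated by 0. *)
Theorem garch_rate :
  let z := fun u => garch_obs c g fe p u - Ex mu (garch_obs c g fe p) in
  exists l : R, [/\ 0 <= l, sum_var mu z n / n%:R @[n --> \oo] --> l &
    0 < l -> exists C : R, 0 < C /\ forall (n : nat) (x : R), (2 <= n)%N ->
      `|fine (mu [set u | block_sum (shifted z) 0 n u < x * Num.sqrt (sum_var mu z n)]) - Phi x| <=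
      C * (ln n%:R ^+ 2 / Num.sqrt n%:R)].
Proof.
have mo : measurable_fun setT (garch_obs c g fe p) by exact: measurable_garch_obs.
have := Ex_ge0 mu (fun u => exprn_ge0 3 (normr_ge0 (garch_obs c g fe p u))).
rewrite le_eqVlt => /predU1P[/esym E0|pos].
  have s01 : 0 < (2^-1 : R) < 1 by rewrite invr_gt0 ltr0n invf_lt1// ltr1n.
  pose f0 (m : nat) (u : seqsp R) : R := 0.
  have m0 m : measurable_fun setT (f0 m) by exact: measurable_cst.
  have d0 m : dep (fun i => i <= m)%N (f0 m) by [].
  refine (centred_rate (K := 0) mo obs_int m0 d0 s01 _) => m; rewrite /f0.
  have -> : (fun u => `|garch_obs c g fe p u - 0| ^+ 3) = fun u => `|garch_obs c g fe p u| ^+ 3.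
    by apply/funext => u; rewrite subr0.
  by split; [exact: obs_int|rewrite E0 mul0r].
have [s [K [s01 ap]]] := garch_approx mu_iid c_meas g_meas fe_meas c_ge0 g_ge0
  vol_fin p_gt0 obs_int pos.
have mw m : measurable_fun setT (garch_win c g fe p m) by exact: measurable_garch_win.
exact: (centred_rate mo obs_int mw (garch_win_dep c g fe p) s01 ap).
Qed.

End GarchRate.

(** * The two-sided process *)

Section Past.
Context d (T : measurableType d) (R : realType) (P : probability T R).
Variable eps : int -> {RV P >-> R}.
Hypothesis eps_iid : iid eps.

(** The innovations up to time [k], most recent first: moving [k] back by one is
    a shift of the sequence. *)
Definition past (k : int) (w : T) : seqsp R := fun i => eps (k - i%:Z) w.

Lemma measurable_past k : measurable_fun setT (past k).
Proof. by apply: measurable_to_seq => i. Qed.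

Lemma shift_past j k w : shift j (past k w) = past (k - j%:Z) w.
Proof.
by apply/funext => i; rewrite /shift /past PoszD opprD addrA addrAC.
Qed.

HB.instance Definition _ := isMeasurableFun.Build _ _ _ _ _ (measurable_past 0).

Definition past_law : probability (seqsp R) R := distribution P (past 0).
Definition eps_law : probability R R := distribution P (eps 0).

Let cyl_prob k n (B : nat -> set R) : (forall i, measurable (B i)) ->
  P (past k @^-1` cyl n B) = (\prod_(i < n) eps_law (B i))%E.
Proof.
move=> mB; have [ind idd] := eps_iid.
pose J : seq int := [seq k - i%:Z | i <- iota 0 n].
pose C (z : int) : set R := B `|(k - z)%R|%N.
have CE i : C (k - i%:Z) = B i by rewrite /C subKr.
have uJ : uniq J.
  rewrite map_inj_uniq ?iota_uniq// => i j /(congr1 (fun z => k - z)).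
  by rewrite !subKr => -[].
have -> : past k @^-1` cyl n B = [set w | forall z, z \in J -> C z (eps z w)].
  apply/seteqP; split=> w /= H.
    by move=> z /mapP[i]; rewrite mem_iota add0n => /andP[_ i_n] ->; rewrite CE; exact: H.
  move=> i i_n; have := H (k - i%:Z); rewrite CE; apply.
  by apply/mapP; exists i => //; rewrite mem_iota add0n.
have mC z : measurable (C z) by exact: mB.
apply: (etrans (ind J C uJ mC)); rewrite -(big_mkord xpredT (fun i => eps_law (B i))).
rewrite /index_iota subn0 /J; elim: (iota 0 n) => [|i l IH]; first by rewrite !big_nil.
rewrite /= !big_cons IH CE; congr (_ * _)%E; exact: idd.
Qed.

Lemma past_iid : iid_law past_law eps_law.
Proof. by move=> n B mB; exact: cyl_prob. Qed.

(** The law does not depend on [k]: this is the stationarity of the process. *)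
Lemma past_has_law k : has_law P past_law (past k).
Proof. by apply: (iid_image past_iid); [exact: measurable_past|exact: cyl_prob]. Qed.

Lemma ae_eps (A : set R) : measurable A -> {ae P, forall w, A (eps 0 w)} ->
  {ae P, forall w, forall k, A (eps k w)}.
Proof.
move=> mA A0.
have mpre k : measurable (eps k @^-1` (~` A)).
  by rewrite -[_ @^-1` _]setTI; apply: measurable_funP => //; exact: measurableC.
have z0 : P (eps 0 @^-1` (~` A)) = 0%E by apply/negligibleP.
have [_ idd] := eps_iid.
have zk k : P (eps k @^-1` (~` A)) = 0%E.
  by rewrite -z0; apply: idd; exact: measurableC.
have ak k : {ae P, forall w, A (eps k w)} by exists (eps k @^-1` (~` A)); split => //; exact: zk.
have an : {ae P, forall w, forall n : nat, A (eps n%:Z w) /\ A (eps (- n%:Z) w)}.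
  by apply: ae_foralln => n; apply: filterS2 (ak n%:Z) (ak (- n%:Z)).
apply: filterS an => w H k; case: k => n; first by case: (H n).
by rewrite NegzE; case: (H n.+1).
Qed.

End Past.

Section DeterministicSeries.
Context (T : Type) (R : realType).

Lemma garch_partialE (c g : R -> R) (eps : int -> T -> R) k w m :
  garch_partial c g eps k w m.+1 = vpart c g m (fun i => eps (k - 1 - i%:Z) w).
Proof.
have kE i : k - i.+1%:Z = k - 1 - i%:Z by rewrite intS opprD addrA.
rewrite /garch_partial /vpart big_add1 /=; apply: eq_bigr => i _.
rewrite /vterm /cprod kE; congr (_ * _); rewrite big_add1 /=.
by apply: eq_bigr => j _; rewrite kE.
Qed.

Lemma vole_lim (c g : R -> R) (u : seqsp R) : (forall x, 0 <= c x) ->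
  (forall x, 0 <= g x) -> cvgn (fun m => vpart c g m u) ->
  vole c g u = (limn (fun m => vpart c g m u))%:E.
Proof.
move=> c0 g0 cv; rewrite -EFin_lim//.
by apply/congr_lim/funext => m /=; rewrite /vpart -sumEFin.
Qed.

End DeterministicSeries.

(** [c] and [g] are only known to be nonnegative at almost every innovation.
    Their positive parts agree with them there and make the series monotone at
    every sequence. *)
Definition pos_part (R : realType) (f : R -> R) x : R := Num.max (f x) 0.

Lemma pos_part_ge0 (R : realType) (f : R -> R) x : 0 <= pos_part f x.
Proof. by rewrite le_max lexx orbT. Qed.

Lemma measurable_pos_part (R : realType) (f : R -> R) :
  measurable_fun setT f -> measurable_fun setT (pos_part f).
Proof. by move=> mf; exact: measurable_maxr. Qed.

Section Volatility.
Context d (T : measurableType d) (R : realType) (P : probability T R).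
Variables (eps : int -> {RV P >-> R}) (c g : R -> R).
Hypothesis eps_iid : iid eps.
Hypothesis c_meas : measurable_fun [set: R] c.
Hypothesis g_meas : measurable_fun [set: R] g.
Hypothesis c_ge0 : {ae P, forall w, 0 <= c (eps 0 w)}.
Hypothesis g_ge0 : {ae P, forall w, 0 <= g (eps 0 w)}.
Hypothesis X_cvg : forall k : int, {ae P, forall w, cvgn (garch_partial c g eps k w)}.

Local Notation cp := (pos_part c).
Local Notation gp := (pos_part g).

Let ae_pos (h : R -> R) : measurable_fun setT h ->
  {ae P, forall w, 0 <= h (eps 0 w)} ->
  {ae P, forall w, forall k, pos_part h (eps k w) = h (eps k w)}.
Proof.
move=> mh h0; have mA : measurable [set x | 0 <= h x].
  have -> : [set x | 0 <= h x] = setT `&` h @^-1` `[0, +oo[%classic.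
    by rewrite setTI; apply/seteqP; split=> x /=; rewrite in_itv/= andbT.
  by apply: mh => //; exact: measurable_itv.
by apply: filterS (ae_eps eps_iid mA h0) => w H k; rewrite /pos_part max_l//; exact: H.
Qed.

Let partial_ae : {ae P, forall w, forall k m,
  garch_partial c g eps k w m.+1 = vpart cp gp m (past eps (k - 1) w)}.
Proof.
apply: filterS2 (ae_pos c_meas c_ge0) (ae_pos g_meas g_ge0) => w cE gE k m.
rewrite -[RHS](garch_partialE cp gp eps k w m).
apply: eq_bigr => i _; rewrite gE; congr (_ * _).
by apply: eq_bigr => j _; rewrite cE.
Qed.

Let vole_ae k : {ae P, forall w,
  vole cp gp (past eps (k - 1) w) = (garch_X c g eps k w)%:E}.
Proof.
apply: filterS2 (X_cvg k) partial_ae => w /cvg_ex[l cl] pE.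
have pEf : (fun m => vpart cp gp m (past eps (k - 1) w)) =
    fun m => garch_partial c g eps k w m.+1 by apply/funext => m; rewrite pE.
have cl' : (fun m => garch_partial c g eps k w m.+1) @ \oo --> l.
  by rewrite cvg_shiftS.
rewrite (vole_lim (pos_part_ge0 c) (pos_part_ge0 g)) pEf.
  by rewrite /garch_X (cvg_lim _ cl)// (cvg_lim _ cl').
by apply/cvg_ex; exists l.
Qed.

Lemma past_vol_fin : {ae past_law eps, forall u, (vole cp gp u < +oo)%E}.
Proof.
pose A := [set u | vole cp gp u = +oo%E].
have mv : measurable_fun setT (vole cp gp).
  by apply: measurable_vole; [exact: measurable_pos_part..|exact: pos_part_ge0|exact: pos_part_ge0].
have mA : measurable A.
  have -> : A = setT `&` vole cp gp @^-1` [set +oo%E] by rewrite setTI.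
  by apply: mv.
exists A; split=> //; last by move=> u /= /negP; rewrite -leNgt leye_eq => /eqP.
have [mp ->//] := past_has_law eps_iid 0.
apply/negligibleP; first by rewrite -[_ @^-1` _]setTI; exact: mp.
have [B [mB B0 BA]] : {ae P, forall w, ~ A (past eps 0 w)}.
  by apply: filterS (vole_ae 1) => w; rewrite subrr => vE; rewrite /A/= vE.
by exists B; split=> // w Aw; apply: BA => /= nA; exact: nA Aw.
Qed.

Lemma garch_X_ae k : {ae P, forall w,
  garch_X c g eps k w = vol cp gp (shift 1 (past eps k w))}.
Proof. by apply: filterS (vole_ae k) => w vE; rewrite shift_past /vol vE. Qed.

End Volatility.

(** * From the process to the functional *)

Section PowerFunction.
Context (R : realType) (delta nu : R) (f : R -> R).
Hypothesis nu_gt0 : 0 < nu.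
Hypothesis f_def :
  f = (fun x => `|x| `^ nu) \/ f = (fun x => Num.sg x * `|x| `^ nu).

Lemma measurable_power : measurable_fun setT f.
Proof.
have mn r : measurable_fun setT (fun x : R => `|x| `^ r).
  have mnorm : measurable_fun setT (fun x : R => `|x|) by exact: measurableT_comp.
  exact: (measurableT_comp (measurable_powR r) mnorm).
case: f_def => ->; first exact: mn.
have -> : (fun x => Num.sg x * `|x| `^ nu) = fun x : R => x * `|x| `^ (nu - 1).
  by apply/funext => x; rewrite -(mulr_powRB1 (normr_ge0 x) nu_gt0) mulrA -numEsg.
exact: measurable_funM.
Qed.

Lemma power_scale (s e : R) : 0 <= s -> f (s * e) = s `^ nu * f e.
Proof.
move=> s0; have nE : `|s * e| `^ nu = s `^ nu * `|e| `^ nu.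
  by rewrite normrM (ger0_norm s0) powRM.
case: f_def => ->; first exact: nE.
rewrite nE sgrM; have [->|sn0] := eqVneq s 0.
  by rewrite powR0 ?gt_eqF// !mul0r mulr0.
by rewrite (gtr0_sg (_ : 0 < s)) ?lt_def ?sn0// mul1r mulrCA.
Qed.

Lemma power_sigma (s : R) : 0 < delta -> 0 <= s ->
  ((s ^+ 2) `^ delta) `^ (nu / (2 * delta)) = s `^ nu.
Proof.
move=> d0 s0; rewrite -(powR_mulrn 2 s0) -!powRrM; congr (_ `^ _).
by field; rewrite gt_eqF.
Qed.

End PowerFunction.

Lemma sum_rev1 (R : realType) (F : nat -> R) n :
  \sum_(1 <= k < n.+1) F k = \sum_(0 <= j < n) F (n - j)%N.
Proof.
rewrite big_nat_rev big_add1 /=; apply: eq_bigr => j _.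
by rewrite add1n !subSS.
Qed.

Section Transfer.
Context d (T : measurableType d) (R : realType) (P : probability T R).
Variables (eps : int -> {RV P >-> R}) (Z : int -> T -> R) (obs : seqsp R -> R).
Hypothesis eps_iid : iid eps.
Hypothesis Z_meas : forall k, measurable_fun setT (Z k).
Hypothesis obs_meas : measurable_fun setT obs.
Hypothesis ZE : forall k, {ae P, forall w, Z k w = obs (past eps k w)}.
Local Notation mu := (past_law eps).

Lemma obs_moment : ('E_P[(fun w => `|Z 0 w| ^+ 3)%R] < +oo)%E ->
  Int mu (fun u => `|obs u| ^+ 3).
Proof.
rewrite unlock => fin.
have mZ3 : measurable_fun setT (fun w => `|Z 0 w| ^+ 3).
  by apply: measurable_funX; exact: measurableT_comp.
have mo3 : measurable_fun setT (fun u => `|obs u| ^+ 3).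
  by apply: measurable_funX; exact: measurableT_comp.
have IZ : Int P (fun w => `|Z 0 w| ^+ 3).
  apply/integrableP; split; first exact/measurable_EFinP.
  apply: le_lt_trans fin; rewrite le_eqVlt; apply/orP; left; apply/eqP.
  by apply: eq_integral => w _ /=; rewrite ger0_norm// exprn_ge0.
apply/(has_law_Int (past_has_law eps_iid 0) mo3).
apply: (Int_ae_dom _ IZ); first exact: measurableT_comp mo3 (measurable_past eps 0).
by apply: filterS (ZE 0) => w -> /=; rewrite ger0_norm// exprn_ge0.
Qed.

Hypothesis obs_int : Int mu (fun u => `|obs u| ^+ 3).

Let z u := obs u - Ex mu obs.

Let Iobs : Int mu obs.
Proof.
apply: (@Int_dom _ _ _ _ _ (fun u => 1 + `|obs u| ^+ 3)) => //.
  by apply: IntD => //; exact: Int_cst.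
by move=> u; exact: norm_le1_cube.
Qed.

Let mz : measurable_fun setT z. Proof. exact: measurable_funB. Qed.

Let EZ1 : fine 'E_P[Z 1] = Ex mu obs.
Proof.
have Ip : Int P (obs \o past eps 1) by apply/(has_law_Int (past_has_law eps_iid 1) obs_meas).
rewrite unlock (has_law_Ex (past_has_law eps_iid 1) obs_meas Ip).
exact: (Ex_ae_eq (Z_meas 1) (measurableT_comp obs_meas (measurable_past eps 1)) (ZE 1)).
Qed.

Let sum_ae n : {ae P, forall w,
  S_ P Z n w = block_sum (shifted z) 0 n (past eps n%:Z w)}.
Proof.
have ae_all : {ae P, forall w, forall k : nat, Z k%:Z w = obs (past eps k%:Z w)}.
  by apply: ae_foralln => k; exact: ZE.
apply: filterS ae_all => w H; rewrite /S_ EZ1 sum_rev1 /block_sum.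
have -> : n%:R * Ex mu obs = \sum_(0 <= j < n) Ex mu obs.
  by rewrite sumr_const_nat subn0 mulr_natl.
rewrite -sumrB; apply: eq_big_nat => j /andP[_ jn].
by rewrite H /shifted /= /z shift_past subzn// ltnW.
Qed.

Let mS n : measurable_fun setT (S_ P Z n).
Proof.
apply: measurable_funB; last exact: measurable_cst.
by apply: measurable_sum => k; exact: Z_meas.
Qed.

Let mo j : measurable_fun setT (shifted z j) := measurable_shifted mz j.

Let Iz3 : Int mu (fun u => `|z u| ^+ 3).
Proof.
apply: (@Int_dom _ _ _ _ _ (fun u => 4 * `|obs u| ^+ 3 + 4 * `|- Ex mu obs| ^+ 3)).
- by apply: measurable_funX; exact: measurableT_comp.
- by apply: IntD; [exact: IntZ|exact: Int_cst].
- by move=> u; rewrite ger0_norm ?exprn_ge0//; exact: cube_add.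
Qed.

Let io j : Int mu (fun u => `|shifted z j u| ^+ 3) := shifted_int (past_iid eps_iid) Iz3 j.

Let Ez : Ex mu z = 0.
Proof. by rewrite (ExB Iobs (Int_cst mu _)) Ex_cst subrr. Qed.

Lemma B_E n : B_ P Z n = Num.sqrt (sum_var mu z n).
Proof.
have L := past_has_law eps_iid n%:Z.
have mT := measurable_block_sum mo 0 n.
have mTp : measurable_fun setT (fun w => block_sum (shifted z) 0 n (past eps n%:Z w)).
  exact: measurableT_comp mT (measurable_past eps n%:Z).
have IT := Int_block_sum mo io 0 n; have ITT := Int_block_sumM mo io 0 n 0 n.
have ES : fine 'E_P[S_ P Z n] = 0.
  rewrite unlock; apply: (etrans (Ex_ae_eq (mS n) mTp (sum_ae n))).
  have ITp := (has_law_Int L mT).1 IT.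
  apply: etrans (esym (has_law_Ex L mT ITp)) _.
  rewrite /block_sum (Ex_sum (s := index_iota 0 n)); last first.
    by move=> j _; exact: Int_xi mo io j.
  by rewrite big1// => j _; exact: (shifted_mean (past_iid eps_iid) mz Iz3 Ez).
congr Num.sqrt; rewrite /variance covariance.unlock ES unlock.
have mT2 : measurable_fun setT (fun u => block_sum (shifted z) 0 n u * block_sum (shifted z) 0 n u).
  exact: measurable_funM.
have ITp := (has_law_Int L mT2).1 ITT.
apply: etrans (esym (has_law_Ex L mT2 ITp)).
apply: Ex_ae_eq.
- apply: measurable_funM; apply: measurable_funB => //; exact: mS.
- exact: measurable_funM.
- apply: filterS (sum_ae n) => w sE.
  transitivity ((S_ P Z n w - 0) * (S_ P Z n w - 0)); first by [].
  by rewrite subr0 sE.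
Qed.

(** The sum over times 1 to [n] is the sum of the first [n] shifts of the
    functional along the past of time [n], in reverse order. *)
Lemma prob_E n y : fine (P [set w | S_ P Z n w < y]) =
  fine (mu [set u | block_sum (shifted z) 0 n u < y]).
Proof.
have L := past_has_law eps_iid n%:Z.
have mT := measurable_block_sum mo 0 n.
have mlt d' (T' : measurableType d') (h : T' -> R) : measurable_fun setT h ->
    measurable [set w | h w < y].
  move=> mh; have -> : [set w | h w < y] = setT `&` h @^-1` `]-oo, y[%classic.
    by rewrite setTI; apply/seteqP; split=> w /=; rewrite in_itv.
  by apply: mh => //; exact: measurable_itv.
have mTp : measurable_fun setT (fun w => block_sum (shifted z) 0 n (past eps n%:Z w)).
  exact: measurableT_comp mT (measurable_past eps n%:Z).
have -> : mu [set u | block_sum (shifted z) 0 n u < y] =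
    P [set w | block_sum (shifted z) 0 n (past eps n%:Z w) < y].
  by have [_ ->] := L; last exact: mlt.
rewrite -(Ex_indic P (mlt _ _ _ (mS n))) -(Ex_indic P (mlt _ _ _ mTp)).
apply: Ex_ae_eq.
- by apply: measurable_indic; exact: mlt (mS n).
- by apply: measurable_indic; exact: mlt mTp.
- apply: filterS (sum_ae n) => w sE; rewrite !indicE; congr (_%:R); congr nat_of_bool.
  by apply/idP/idP; rewrite !inE /= sE.
Qed.

End Transfer.

(** * The Berry-Esseen bound for augmented GARCH processes *)

Theorem theorem6 (d : measure_display) (T : measurableType d) (R : realType)
    (P : probability T R)
    (eps : int -> {RV P >-> R}) (c g : R -> R)
    (delta nu : R) (sigma : int -> {RV P >-> R}) (f : R -> R)
    (eps_iid : iid eps)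
    (c_meas : measurable_fun [set: R] c) (g_meas : measurable_fun [set: R] g)
    (c_ge0 : {ae P, forall w, 0 <= c (eps 0 w)})
    (g_ge0 : {ae P, forall w, 0 <= g (eps 0 w)})
    (X_cvg : forall k : int, {ae P, forall w, cvgn (garch_partial c g eps k w)})
    (delta_gt0 : 0 < delta)
    (sigma_def : forall k : int, {ae P, forall w,
       0 <= sigma k w /\ (sigma k w ^+ 2) `^ delta = garch_X c g eps k w})
    (nu_gt0 : 0 < nu)
    (f_def : f = (fun x => `|x| `^ nu) \/ f = (fun x => Num.sg x * `|x| `^ nu)) :
  let y := garch_y sigma eps in
  let Z := fun (k : int) (w : T) => f (y k w) in
  ('E_P[(fun w => `|Z 0 w| ^+ 3)%R] < +oo)%E ->
  exists beta : R, beta_ P Z n @[n --> \oo] --> beta /\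
    (0 < beta ->
     exists C : R, 0 < C /\
       forall (n : nat) (x : R), (2 <= n)%N ->
         `|fine (P [set w | S_ P Z n w < x * B_ P Z n]) - Phi x|
           <= C * (ln n%:R ^+ 2 / Num.sqrt n%:R)).
Proof.
move=> y Z Z3.
(* [sigma ^+ 2] is a power of order [1 / delta] of the series and [f] is
   homogeneous of order [nu] *)
pose p := nu / (2 * delta).
have p_gt0 : 0 < p by rewrite divr_gt0// mulr_gt0.
pose cp := pos_part c; pose gp := pos_part g.
have mcp : measurable_fun setT cp by exact: measurable_pos_part.
have mgp : measurable_fun setT gp by exact: measurable_pos_part.
have mf : measurable_fun setT f := measurable_power nu_gt0 f_def.
have cp0 : forall x, 0 <= cp x := pos_part_ge0 c.
have gp0 : forall x, 0 <= gp x := pos_part_ge0 g.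
pose obs := garch_obs cp gp f p.
have mobs : measurable_fun setT obs by exact: measurable_garch_obs.
have mZ k : measurable_fun setT (Z k).
  by apply: (measurableT_comp mf); exact: measurable_funM.
have ZE k : {ae P, forall w, Z k w = obs (past eps k w)}.
  have XE := garch_X_ae eps_iid c_meas g_meas c_ge0 g_ge0 X_cvg k.
  apply: filterS2 (sigma_def k) XE => w [s0 sE] XE.
  rewrite /Z /y /garch_y (power_scale nu_gt0 f_def)// /obs /garch_obs -XE -sE.
  by rewrite (power_sigma nu delta_gt0 s0) /past subr0.
have obs3 := obs_moment eps_iid mZ mobs ZE Z3.
have vol_fin := past_vol_fin eps_iid c_meas g_meas c_ge0 g_ge0 X_cvg.
have [l [l0 cv rate]] := garch_rate (past_iid eps_iid) mcp mgp mf cp0 gp0 vol_fin p_gt0 obs3.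
have BE := B_E eps_iid mZ mobs ZE obs3.
exists (Num.sqrt l); split.
  have -> : beta_ P Z = fun n => Num.sqrt (sum_var (past_law eps)
      (fun u => obs u - Ex (past_law eps) obs) n / n%:R).
    apply/funext => n; rewrite /beta_ BE sqr_sqrtr//.
    by apply: Ex_ge0 => u; rewrite -expr2 sqr_ge0.
  by apply: continuous_cvg => //; exact: sqrt_continuous.
rewrite sqrtr_gt0 => lp; have [C [C0 bd]] := rate lp.
exists C; split=> // n x n2.
by rewrite (prob_E eps_iid mZ mobs ZE obs3) BE; exact: bd.
Qed.
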